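(* Let $\sigma>0$ and $\rho>0$. For $\nu\ge0$ define $$\ell(\nu)=\limsup_{n\to\infty}\frac1n\log\mathrm{Vol}\left(\mathcal S_n(\sigma,\rho)\oplus B_n(\sqrt{n\nu})\right).$$ For $n\ge1$ let $\mu_n(0),\dots,\mu_n(n)$ be the intrinsic volumes of $\mathcal S_n(\sigma,\rho)$, and define $G_n,g_n:\mathbb R\to\mathbb R$ by $$G_n(t)=\log\sum_{j=0}^n\mu_n(j)e^{jt},\qquad g_n(t)=\frac{G_n(t)}{n}.$$ Then the sequence $\{g_n\}$ has a pointwise limit $\Lambda:\mathbb R\to\mathbb R$, and, with $\Lambda^*$ denoting the convex conjugate of $\Lambda$, the following hold: 1. $\ell$ is continuous on $[0,\infty)$. 2. For $\nu>0$, $$\ell(\nu)=\sup_{\theta\in[0,1]}\left[-\Lambda^*(1-\theta)+\frac{\theta}{2}\log\frac{2\pi e\nu}{\theta}\right].$$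
   Context: Logarithms are natural. $\mathcal S_n(\sigma,\rho)=\{x^n\in\mathbb R^n:\ \sum_{j=k+1}^{l}x_j^2\le \sigma+(l-k)\rho\ \text{ for all } 0\le k<l\le n\}$, a compact convex set. $B_n(r)$ is the closed Euclidean ball of radius $r$ in $\mathbb R^n$ centered at the origin, $\oplus$ denotes Minkowski sum, $\mathrm{Vol}$ is $n$-dimensional Lebesgue measure. The intrinsic volumes $\mu_0(K),\dots,\mu_n(K)$ of a compact convex $K\subset\mathbb R^n$ are the numbers determined by Steiner's formula $\mathrm{Vol}(K\oplus tB_n(1))=\sum_{j=0}^n\mu_{n-j}(K)\epsilon_jt^j$ for all $t\ge0$, where $\epsilon_j$ is the volume of the $j$-dimensional unit ball; here $\mu_n(j):=\mu_j(\mathcal S_n(\sigma,\rho))$. The convex conjugate is $\Lambda^*(x)=\sup_{t\in\mathbb R}(xt-\Lambda(t))$. The expression $\frac\theta2\log\frac{2\pi e\nu}{\theta}$ is taken to be $0$ at $\theta=0$. *)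

(* Defs.v *)
From HB Require Import structures.
From mathcomp Require Import all_boot all_order all_algebra.
From mathcomp Require Import all_classical all_reals all_analysis.
Import Order.TTheory GRing.Theory Num.Theory.
Import numFieldNormedType.Exports.

Set Implicit Arguments.
Unset Strict Implicit.
Unset Printing Implicit Defensive.

Local Open Scope classical_set_scope.
Local Open Scope ring_scope.

(* Points of R^n are row vectors 'rV[R]_n; the 1-based coordinate x_j of the
   mathematical text is x 0 i with i = j - 1. *)

(* n-dimensional Lebesgue measure as the n-fold product of lebesgue_measure,
   in iterated-integral (Fubini) form; it is the usual measure on Borel sets. *)
Fixpoint lebesgue_tuple (R : realType) (n : nat) :
    set (n.-tuple R) -> \bar R :=
  match n return set (n.-tuple R) -> \bar R with
  | 0 => fun A => \d_([tuple] : 0.-tuple R) A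
  | m.+1 => fun A =>
      (\int[lebesgue_measure]_(x in [set: R])
          lebesgue_tuple [set y : m.-tuple R | A [tuple of x :: y]])%E
  end.

Definition vol (R : realType) (n : nat) (A : set 'rV[R]_n) : \bar R :=
  lebesgue_tuple [set y : n.-tuple R | A (\row_i tnth y i)].

(* The library norm on 'rV[R]_n is the sup norm, hence the explicit formula. *)
Definition eball (R : realType) (n : nat) (r : R) : set 'rV[R]_n :=
  [set x | Num.sqrt (\sum_(i < n) x 0 i ^+ 2) <= r].
Arguments eball {R} n r.

Definition minkowski (R : realType) (n : nat) (A B : set 'rV[R]_n) :
    set 'rV[R]_n :=
  [set x + y | x in A & y in B].

Definition dilate (R : realType) (n : nat) (t : R) (A : set 'rV[R]_n) :
    set 'rV[R]_n :=
  [set t *: x | x in A].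

Definition Sset (R : realType) (sigma rho : R) (n : nat) : set 'rV[R]_n :=
  [set x | forall k l : nat, (k < l)%N -> (l <= n)%N ->
     \sum_(i < n | (k <= i < l)%N) x 0 i ^+ 2 <= sigma + (l - k)%:R * rho].
Arguments Sset {R} sigma rho n.

(* mu 0, ..., mu n are the intrinsic volumes of K, i.e. the coefficients in
   Steiner's formula (which determines them); mu j is irrelevant for j > n. *)
Definition intrinsic_volumes (R : realType) (n : nat) (K : set 'rV[R]_n)
    (mu : nat -> R) : Prop :=
  forall t : R, 0 <= t ->
    vol (minkowski K (dilate t (eball n 1))) =
    (\sum_(j < n.+1) (mu (n - j)%N)%:E * vol (eball j 1%R) * (t ^+ j)%:E)%E.

Definition ell (R : realType) (sigma rho nu : R) : \bar R :=
  limn_esup (fun n : nat =>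
    ((n%:R^-1)%:E *
     lne (vol (minkowski (Sset sigma rho n)
                         (eball n (Num.sqrt (n%:R * nu))))))%E).

Definition Gfun (R : realType) (mu : nat -> nat -> R) (n : nat) (t : R) : R :=
  ln (\sum_(j < n.+1) mu n j * expR (j%:R * t)).

Definition gfun (R : realType) (mu : nat -> nat -> R) (n : nat) (t : R) : R :=
  Gfun mu n t / n%:R.

Definition conjugate (R : realType) (L : R -> R) (x : R) : \bar R :=
  ereal_sup [set (x * t - L t)%:E | t in [set: R]].

(* At theta = 0 this is 0, since the factor theta / 2 vanishes. *)
Definition ball_term (R : realType) (nu theta : R) : R :=
  theta / 2 * ln (2 * pi * expR 1 * nu / theta).

(* Main.v *)
Require Import Defs.
From HB Require Import structures.
From mathcomp Require Import all_boot all_order all_algebra.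
From mathcomp Require Import all_classical all_reals all_analysis.
From mathcomp Require Import measurable_realfun.
From mathcomp Require Import ring lra zify.
Import Order.TTheory GRing.Theory Num.Theory.
Import numFieldNormedType.Exports.

Set Implicit Arguments.
Unset Strict Implicit.
Unset Printing Implicit Defensive.

Local Open Scope classical_set_scope.
Local Open Scope ring_scope.

(** Write V_n(r) for the volume of the r-neighbourhood of S_n and
    W_n(t) = \int exp (- pi e^(2t) dist(x, S_n)^2) dx. The layer-cake formula and
    Steiner's formula give W_n(t) = \sum_j mu_n(n - j) e^(-jt), so that
    g_n(t) = t + log W_n(t) / n. Since S_(m+n) is contained in S_m x S_n, W is
    submultiplicative and Fekete's lemma yields the limit Lambda(t) = t + w(t).

    Put D(nu) = inf_t (w(t) + pi nu e^(2t)). Markov's inequality gives ell <= D.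
    Conversely S_m x Q x S_n is contained in S_(m+p+n) for a fixed cube Q, so
    log V_n(sqrt E), as a function of (n, E), is superadditive up to a bounded
    gap. Separating the semigroup of its values from a quadrant gives
    V_n(r) <= C e^(n (v - beta nu) + beta r^2) with v = ell(nu); integrating
    this bound against a Gaussian weight gives D(nu) <= v.

    The function D is concave, finite and nondecreasing, hence continuous on
    nu > 0, and an infimum of affine functions, hence upper semicontinuous at 0.
    The formula for D is the minimax theorem at the minimizer t, where
    theta = 2 pi nu e^(2t); it requires Lambda to be convex. This follows from
    V_n(sqrt (ab))^2 <= V_n(a) V_n(b): for a zonotope in place of the ball, the
    volume is separately affine in the lengths of the generating segments, with
    nonnegative coefficients, and the inequality is Cauchy-Schwarz; the ball is
    a limit of zonotopes whose generators discretize a Gaussian vector g, by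
    E |<g, y>| = c |y|. *)

(** Convexity of G_n would be immediate if mu_n(j) >= 0 were known, but Steiner's formula presents
    the intrinsic volumes only as coefficients of a polynomial and does not display their signs. The
    zonotope argument supplies a substitute: log-convexity of V_n in log r, which integration
    against a fixed kernel passes on to W_n. The approximation of the ball must be uniform, with
    error at most e |y| in the direction y, because it serves to compare support functions.

    The product S_m x S_n is not contained in S_(m+n): a window meeting both factors may use the
    allowance sigma twice. The cube Q repairs this at the cost of p extra coordinates, so all
    superadditive statements carry n + p in place of n; p is fixed and disappears after division by
    n.

    The limit of superadditive quantities is read from ell, a mere limsup. Concatenating many copies
    of one block of size (n, E) turns an asymptotic upper bound into one valid for every n, and this
    uniformity is what lets the separating line bound V_n(r) for all n and r at once. Its slope beta
    selects t, with pi e^(2t) just above beta. *)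

Local Notation msum := Defs.minkowski.

(** * Iterated integrals *)

Section itint.
Context {R : realType}.
Local Notation mR := (measurableTypeR R).
Local Notation leb := (@lebesgue_measure R).

(* Integrands live on lists rather than on vectors, so that splitting and
   joining dimensions needs no casts; only lists of size n matter. *)
Fixpoint itint (n : nat) (f : seq R -> \bar R) : \bar R :=
  if n is m.+1 then (\int[leb]_x itint m (fun s => f (x :: s)))%E else f [::].

Definition tmeas (n : nat) (f : seq R -> \bar R) :=
  measurable_fun [set: n.-tuple mR] (fun t : n.-tuple mR => f (tval t)).

(** The parameter space [T] is arbitrary so that inductions on n can move the head coordinate of the
    list into the parameter. *)
Definition pmeas d (T : measurableType d) (n : nat) (f : T -> seq R -> \bar R) :=
  measurable_fun [set: T * n.-tuple mR] (fun p => f p.1 (tval p.2)).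

Lemma eq_itint n f g : (forall s, size s = n -> f s = g s) -> itint n f = itint n g.
Proof.
elim: n f g => [|n IH] f g fg /=; first exact: fg.
by apply: eq_integral => x _; apply: IH => s sn; apply: fg; rewrite /= sn.
Qed.

Lemma itint_ge0 n f : (forall s, 0 <= f s)%E -> (0 <= itint n f)%E.
Proof.
by elim: n f => [|n IH] f f0 //=; apply: integral_ge0 => x _; exact: IH.
Qed.

Lemma pmeas_cons d (T : measurableType d) n (f : T -> seq R -> \bar R) :
  pmeas n.+1 f -> @pmeas _ (T * mR)%type n (fun p s => f p.1 (p.2 :: s)).
Proof.
move=> mf; rewrite /pmeas.
apply: (measurableT_comp (f := fun p : T * n.+1.-tuple mR => f p.1 (tval p.2)) mf
  (g := fun q : (T * mR) * n.-tuple mR => (q.1.1, [tuple of q.1.2 :: q.2]))).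
apply/measurable_fun_pairP; split => /=.
  exact: (measurableT_comp measurable_fst measurable_fst).
apply: (@measurable_cons _ _ _ mR (fun q : (T * mR) * n.-tuple mR => q.1.2)).
  exact: (measurableT_comp measurable_snd measurable_fst).
exact: measurable_snd.
Qed.

Lemma measurable_itint d (T : measurableType d) n (f : T -> seq R -> \bar R) :
  (forall x s, 0 <= f x s)%E -> pmeas n f ->
  measurable_fun [set: T] (fun x => itint n (f x)).
Proof.
elim: n d T f => [|n IH] d T f f0 mf /=.
  apply: (measurableT_comp (f := fun p : T * 0.-tuple mR => f p.1 (tval p.2)) mf
    (g := fun x => (x, [tuple]))).
  apply/measurable_fun_pairP; split => //=.
    exact: measurable_id.
  by apply: (proj2 (@measurable_fun_tnthP _ _ T mR 0 (fun=> [tuple]))) => -[].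
apply: (@measurable_fun_fubini_tonelli_F _ _ T mR R lebesgue_measure
  (fun p => itint n (fun s => f p.1 (p.2 :: s)))).
  by apply: IH => //; exact: pmeas_cons.
by move=> p; apply: itint_ge0.
Qed.

Lemma pmeas_sec d (T : measurableType d) n (f : T -> seq R -> \bar R) x :
  pmeas n f -> tmeas n (f x).
Proof.
move=> mf.
apply: (measurableT_comp (f := fun p : T * n.-tuple mR => f p.1 (tval p.2)) mf
    (g := fun t => (x, t))).
by apply/measurable_fun_pairP; split; [exact: measurable_cst|exact: measurable_id].
Qed.

Lemma tmeas_cons n f : tmeas n.+1 f -> pmeas n (fun (x : mR) s => f (x :: s)).
Proof.
move=> mf.
apply: (measurableT_comp (f := fun t : n.+1.-tuple mR => f (tval t)) mf
    (g := fun q : mR * n.-tuple mR => [tuple of q.1 :: q.2])).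
by apply: (@measurable_cons _ _ _ mR fst).
Qed.

Lemma tmeas_itint n f : (forall s, 0 <= f s)%E -> tmeas n.+1 f ->
  measurable_fun [set: mR] (fun x => itint n (fun s => f (x :: s))).
Proof. by move=> f0 mf; apply: measurable_itint => //; exact: tmeas_cons. Qed.

Lemma le_itint n f g : (forall s, 0 <= f s)%E -> (forall s, 0 <= g s)%E ->
  tmeas n f -> tmeas n g ->
  (forall s, size s = n -> f s <= g s)%E -> (itint n f <= itint n g)%E.
Proof.
elim: n f g => [|n IH] f g f0 g0 mf mg fg /=; first exact: fg.
apply: ge0_le_integral => //=.
- by move=> x _; exact: itint_ge0.
- exact: tmeas_itint.
- exact: tmeas_itint.
- move=> x _; apply: IH => //.
  + exact: (pmeas_sec x (tmeas_cons mf)).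
  + exact: (pmeas_sec x (tmeas_cons mg)).
  + by move=> s sn; apply: fg; rewrite /= sn.
Qed.

Lemma itintD n f g : (forall s, 0 <= f s)%E -> (forall s, 0 <= g s)%E ->
  tmeas n f -> tmeas n g ->
  (itint n (fun s => f s + g s) = itint n f + itint n g)%E.
Proof.
elim: n f g => [|n IH] f g f0 g0 mf mg //=.
under eq_integral => x _.
  rewrite IH //; last first.
  - exact: (pmeas_sec x (tmeas_cons mg)).
  - exact: (pmeas_sec x (tmeas_cons mf)).
  over.
rewrite ge0_integralD//.
- by move=> x _; exact: itint_ge0.
- exact: tmeas_itint.
- by move=> x _; exact: itint_ge0.
- exact: tmeas_itint.
Qed.

Lemma itintZl n k f : (0 <= k)%E -> (forall s, 0 <= f s)%E -> tmeas n f ->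
  (itint n (fun s => k * f s) = k * itint n f)%E.
Proof.
move=> k0; elim: n f => [|n IH] f f0 mf //=.
under eq_integral => x _.
  rewrite IH //; last exact: (pmeas_sec x (tmeas_cons mf)).
  over.
rewrite ge0_integralZl//; first exact: tmeas_itint.
by move=> x _; exact: itint_ge0.
Qed.

Lemma itint_cat m n f :
  itint (m + n) f = itint m (fun s => itint n (fun t => f (s ++ t))).
Proof.
by elim: m f => [|m IH] f //=; apply: eq_integral => x _; rewrite IH.
Qed.

Lemma itint_swap d (T : measurableType d) (m : {sigma_finite_measure set T -> \bar R})
    n (f : T -> seq R -> \bar R) :
  (forall x s, 0 <= f x s)%E -> pmeas n f ->
  (itint n (fun s => \int[m]_x f x s) = \int[m]_x itint n (f x))%E.
Proof.
elim: n f => [|n IH] f f0 mf //=.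
have mf1 (y : mR) : pmeas n (fun x s => f x (y :: s)).
  have := pmeas_cons mf.
  pose h := (fun p : (T * mR) * n.-tuple mR => f p.1.1 (p.1.2 :: tval p.2)).
  move=> mh; apply: (measurableT_comp (f := h) mh (g := fun q : T * n.-tuple mR => ((q.1, y), q.2))).
  apply: measurable_fun_pair => /=; last exact: measurable_snd.
  apply: measurable_fun_pair; [exact: measurable_fst|exact: measurable_cst].
under eq_integral => y _ do rewrite IH //.
have mF : measurable_fun setT (fun p : mR * T => itint n (fun s => f p.2 (p.1 :: s))).
  apply: measurable_itint => //.
  have := pmeas_cons mf.
  pose h := (fun p : (T * mR) * n.-tuple mR => f p.1.1 (p.1.2 :: tval p.2)).
  move=> mh; apply: (measurableT_comp (f := h) mh (g := fun q : (mR * T) * n.-tuple mR => ((q.1.2, q.1.1), q.2))).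
  apply: measurable_fun_pair => /=; last exact: measurable_snd.
  apply: measurable_fun_pair.
    exact: (measurableT_comp measurable_snd measurable_fst).
  exact: (measurableT_comp measurable_fst measurable_fst).
rewrite (@fubini_tonelli _ _ mR T R lebesgue_measure m _ mF)// => p.
exact: itint_ge0.
Qed.

(** The pushforward of Lebesgue measure under x -> a x + b, multiplied by a, agrees with Lebesgue
    measure on half-open intervals, hence everywhere by uniqueness. *)
Lemma ge0_integral_affine (a b : R) (f : mR -> \bar R) : 0 < a ->
  measurable_fun setT f -> (forall x, 0 <= f x)%E ->
  (\int[leb]_x f (a * x + b)%R = (a^-1)%:E * \int[leb]_x f x)%E.
Proof.
move=> a0 mf f0.
pose phi : mR -> mR := fun x => a * x + b.
have mphi : measurable_fun setT phi.
  by apply: measurable_funD => //; exact: measurable_funM.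
have a0' : 0 <= a by exact: ltW.
pose k : {nonneg R} := NngNum a0'.
have E A : measurable A -> leb A = mscale k (pushforward leb phi) A.
  apply: lebesgue_measure_unique => //= _ [[c d]] _ <-.
  rewrite /mscale/= /pushforward/=.
  have -> : phi @^-1` `]c, d] = `](c - b) / a, (d - b) / a]%classic.
    apply/seteqP; split => x; rewrite /phi /= !in_itv/= ltr_pdivrMr// ler_pdivlMr//;
    by rewrite ltrBlDr lerBrDr [x * a]mulrC.
  rewrite !lebesgue_measure_itv/= !lte_fin.
  rewrite ltr_pM2r ?invr_gt0// ltrD2r; case: ifPn => cd; last by rewrite mule0.
  by rewrite -!EFinD -EFinM; congr EFin; field; lra.
rewrite (@eq_measure_integral _ _ _ setT (mscale k (pushforward leb phi)) leb f); last first.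
  by move=> A mA _; exact: E.
rewrite ge0_integral_mscale// ge0_integral_pushforward//.
by rewrite muleA -EFinM mulVf ?mul1e ?gt_eqF.
Qed.

End itint.

(** * Volume as an iterated integral *)

Section vol.
Context {R : realType}.
Local Notation mR := (measurableTypeR R).
Local Notation leb := (@lebesgue_measure R).

Fixpoint aff (a : R) (c : nat -> R) (s : seq R) : seq R :=
  if s is x :: s' then (a * x + c 0%N) :: aff a (fun i => c i.+1) s' else [::].

Lemma nth_aff a c s i : (i < size s)%N -> (aff a c s)`_i = a * s`_i + c i.
Proof. by elim: s c i => //= x s IH c [|i] //= si; rewrite IH. Qed.

Lemma itint_aff n a c (f : seq R -> \bar R) : 0 < a ->
  (forall s, 0 <= f s)%E -> tmeas n f ->
  (itint n (fun s => f (aff a c s)) = (a ^- n)%:E * itint n f)%E.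
Proof.
move=> a0; elim: n c f => [|n IH] c f f0 mf /=; first by rewrite expr0 invr1 mul1e.
under eq_integral => x _.
  rewrite (IH _ (fun s => f (a * x + c 0%N :: s))) //; last first.
    exact: (pmeas_sec (a * x + c 0%N : mR) (tmeas_cons mf)).
  over.
have mg := tmeas_itint f0 mf.
have g0 x : (0 <= itint n (fun s => f (x :: s)))%E by exact: itint_ge0.
rewrite ge0_integralZl//; last 2 first.
  - apply: (measurableT_comp mg).
    by apply: measurable_funD => //; exact: measurable_funM.
  - by rewrite lee_fin invr_ge0 exprn_ge0// ltW.
rewrite (ge0_integral_affine (c 0%N) a0 mg)// muleA -EFinM.
by rewrite -invfM -exprSr.
Qed.

Definition rv n (s : seq R) : 'rV[R]_n := \row_i s`_i.

Definition rcons_hd n (x : R) (y : 'rV[R]_n) : 'rV[R]_n.+1 :=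
  row_mx (x%:M : 'rV[R]_1) y.

Lemma rv_cat m n s t : size s = m -> rv (m + n) (s ++ t) = row_mx (rv m s) (rv n t).
Proof.
move=> sm; apply/rowP => i; rewrite !mxE; case: splitP => j ij; rewrite !mxE ij nth_cat sm.
  by rewrite ltn_ord.
by rewrite ltnNge leq_addr/= addKn.
Qed.

Lemma rv_cons n x s : rv n.+1 (x :: s) = rcons_hd x (rv n s).
Proof.
rewrite /rcons_hd (_ : x%:M = rv 1 [:: x]); first exact: (@rv_cat 1 n [:: x] s erefl).
by apply/rowP => i; rewrite !mxE !ord1.
Qed.

Definition itr n (F : 'rV[R]_n -> \bar R) : \bar R := itint n (fun s => F (rv n s)).

Definition rmeasf n (F : 'rV[R]_n -> \bar R) := tmeas n (fun s => F (rv n s)).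

Definition rmeas n (A : set 'rV[R]_n) := rmeasf (fun x => (\1_A x)%:E).

Lemma lebesgue_tupleE n (A : set (n.-tuple R)) (f : seq R -> \bar R) :
  (forall t : n.-tuple R, f t = (\1_A t)%:E) -> lebesgue_tuple A = itint n f.
Proof.
elim: n A f => [|n IH] A f fA /=; first by rewrite (fA [tuple]).
apply: eq_integral => x _; apply: IH => t.
by have := fA [tuple of x :: t]; rewrite /= => ->.
Qed.

Lemma volE n (A : set 'rV[R]_n) : vol A = itr (fun x => (\1_A x)%:E).
Proof.
apply: lebesgue_tupleE => t; rewrite !indicE.
rewrite (_ : rv n t = \row_i tnth t i) //.
by apply/rowP => i; rewrite !mxE (tnth_nth 0).
Qed.

Lemma itr_ge0 n F : (forall x, 0 <= F x)%E -> (0 <= @itr n F)%E.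
Proof. by move=> F0; exact: itint_ge0. Qed.

Lemma le_itr n (F G : 'rV[R]_n -> \bar R) :
  (forall x, 0 <= F x)%E -> rmeasf F -> rmeasf G ->
  (forall x, F x <= G x)%E -> (itr F <= itr G)%E.
Proof.
by move=> F0 mF mG FG; apply: le_itint => // s; exact: le_trans (FG _).
Qed.

Lemma itrD n (F G : 'rV[R]_n -> \bar R) :
  (forall x, 0 <= F x)%E -> (forall x, 0 <= G x)%E -> rmeasf F -> rmeasf G ->
  (itr (fun x => F x + G x) = itr F + itr G)%E.
Proof. by move=> F0 G0 mF mG; rewrite /itr itintD. Qed.

Lemma itrZl n k (F : 'rV[R]_n -> \bar R) :
  (0 <= k)%E -> (forall x, 0 <= F x)%E -> rmeasf F ->
  (itr (fun x => k * F x) = k * itr F)%E.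
Proof. by move=> k0 F0 mF; rewrite /itr itintZl. Qed.

Lemma itr_hd n (F : 'rV[R]_n.+1 -> \bar R) :
  itr F = (\int[leb]_x itr (fun y => F (rcons_hd x y)))%E.
Proof.
by apply: eq_integral => x _; apply: eq_itint => s _; rewrite rv_cons.
Qed.

Lemma itr_aff n (a : R) (v : 'rV[R]_n) (F : 'rV[R]_n -> \bar R) : 0 < a ->
  (forall x, 0 <= F x)%E -> rmeasf F ->
  (itr (fun x => F (a *: x + v)%R) = (a ^- n)%:E * itr F)%E.
Proof.
move=> a0 F0 mF; pose c (i : nat) := if insub i is Some j then v 0 j else 0.
rewrite /itr -(itint_aff c a0)//; apply: eq_itint => s sn; congr F.
apply/rowP => i; rewrite !mxE nth_aff ?sn// /c.
by case: insubP => [j _ /ord_inj ->//|]; rewrite ltn_ord.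
Qed.

Lemma tmeas_cat m n f : tmeas (m + n) f ->
  @pmeas _ _ (m.-tuple mR) n (fun t s => f (tval t ++ s)).
Proof.
move=> mf.
apply: (measurableT_comp (f := fun t : (m + n).-tuple mR => f (tval t)) mf
    (g := fun q : m.-tuple mR * n.-tuple mR => [tuple of q.1 ++ q.2])).
apply/measurable_fun_tnthP => i.
case: (split_ordP i) => j ij.
  rewrite (_ : _ \o _ = (fun q => tnth q.1 j)).
    exact: (measurableT_comp (measurable_tnth j) measurable_fst).
  by apply/funext => q /=; rewrite ij tnth_lshift.
rewrite (_ : _ \o _ = (fun q => tnth q.2 j)).
  exact: (measurableT_comp (measurable_tnth j) measurable_snd).
by apply/funext => q /=; rewrite ij tnth_rshift.
Qed.

Lemma rat_near (x e : R) : 0 < e -> exists q : rat, `|ratr q - x| < e.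
Proof.
move=> e0; have : x - e < x + e by lra.
by move=> /rat_in_itvoo[q]; rewrite in_itv/= => qi; exists q; rewrite distrC ltr_distlC; lra.
Qed.

Lemma dist_tri (z x y d e : R) : d < e / 2 -> `|z - x| < d -> `|z - y| < d ->
  `|x - y| < e.
Proof. by move=> de; rewrite !ltr_norml => *; lra. Qed.

(** An open set is the countable union of the cubes with rational centre and radius 1/(k+1) that it
    contains, and each cube is measurable for the product structure on tuples. This links the
    topology of row vectors to that structure. *)
Lemma measurable_rv_open n (U : set 'rV[R]_n) : open U ->
  measurable [set t : n.-tuple mR | U (rv n (tval t))].
Proof.
move=> oU.
pose cub (q : {ffun 'I_n -> rat} * nat) : set (n.-tuple mR) :=
  \bigcap_(i : 'I_n) [set t | `|ratr (q.1 i) - tnth t i| < q.2.+1%:R^-1].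
pose F k := if unpickle k is Some q then
    if `[< cub q `<=` [set t : n.-tuple mR | U (rv n (tval t))] >] then cub q else set0
  else set0.
have mcub q : measurable (cub q).
  apply: fin_bigcap_measurable => // i _.
  rewrite (_ : mkset _ = (fun t : n.-tuple mR => tnth t i) @^-1`
       `]ratr (q.1 i) - q.2.+1%:R^-1, ratr (q.1 i) + q.2.+1%:R^-1[); last first.
    by apply/seteqP; split => t /=; rewrite in_itv/= ltr_distlC.
  by rewrite -[X in measurable X]setTI; apply: measurable_tnth => //; exact: measurable_itv.
rewrite (_ : mkset _ = \bigcup_k F k); last first.
  apply/seteqP; split => t /=; last first.
    case=> k _; rewrite /F; case: unpickle => // q; case: asboolP => // qU.
    exact: qU.
  move=> Ut; have := open_nbhs_nbhs (conj oU Ut).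
  move=> /nbhs_ballP[e /= e0 eU].
  have [k ke] : exists k : nat, k.+1%:R^-1 < e / 2.
    have /ltr_add_invr[k kk] : 0 < e / 2 by lra.
    by exists k; rewrite add0r in kk.
  have qq (i : 'I_n) : exists q : rat, `|ratr q - tnth t i| < k.+1%:R^-1.
    by apply: rat_near; rewrite invr_gt0.
  have [q qP] := choice qq.
  exists (pickle ([ffun i => q i], k)) => //.
  rewrite /F pickleK; case: asboolP => [_ i _|] /=; first by rewrite ffunE.
  case => u /= ucub; apply: eU.
  split => // i j; rewrite !mxE -!tnth_nth.
  apply: (dist_tri (z := ratr (q j)) (d := k.+1%:R^-1)) => //; last first.
  by have := ucub j Logic.I; rewrite /= ffunE.
apply: bigcup_measurable => k _; rewrite /F.
by case: unpickle => // q; case: ifP.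
Qed.

Lemma closed_rmeas n (A : set 'rV[R]_n) : closed A -> rmeas A.
Proof.
move=> cA; apply/measurable_EFinP.
rewrite (_ : (fun _ => _) = \1_([set t : n.-tuple mR | A (rv n (tval t))])).
  apply: measurable_indic.
  rewrite -[X in measurable X]setCK; apply: measurableC.
  by apply: (@measurable_rv_open n (~` A)); exact: closed_openC.
by [].
Qed.

Lemma compact_rmeas n (A : set 'rV[R]_n) : compact A -> rmeas A.
Proof.
by move=> cA; apply: closed_rmeas; apply: compact_closed => //; exact: norm_hausdorff.
Qed.

End vol.

(** * Euclidean geometry of row vectors *)

Section geometry.
Context {R : realType}.
Local Notation mR := (measurableTypeR R).
Local Notation leb := (@lebesgue_measure R).

Lemma continuous_row (T : topologicalType) n (f : T -> 'rV[R]_n) :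
  (forall i, continuous (fun t => f t 0 i)) -> continuous f.
Proof.
move=> cf x; apply/cvg_ballP => e e0.
have : \forall t \near x, forall i, ball (f x 0 i) e (f t 0 i).
  by apply: filter_forall => i; move: (cf i x) => /cvg_ballP; exact.
apply: filterS => t H; split => // i j; rewrite ord1; exact: H.
Qed.

Lemma continuous_sum_row (T : topologicalType) (I : Type) (r : seq I) (P : pred I)
    (f : I -> T -> R) :
  (forall i, continuous (f i)) -> continuous (fun t => \sum_(i <- r | P i) f i t).
Proof.
move=> cf x; apply: (@cvg_big _ _ +%R) => //; first exact: add_continuous.
by move=> i _; exact: cf.
Qed.

Lemma continuous_mul (T : topologicalType) (f g : T -> R) :
  continuous f -> continuous g -> continuous (fun t => f t * g t).
Proof. by move=> cf cg x; apply: cvgM; [exact: cf|exact: cg]. Qed.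

Lemma continuous_add (T : topologicalType) (f g : T -> R) :
  continuous f -> continuous g -> continuous (fun t => f t + g t).
Proof. by move=> cf cg x; apply: cvgD; [exact: cf|exact: cg]. Qed.

Lemma continuous_coord n (i : 'I_n) : continuous (fun x : 'rV[R]_n => x 0 i).
Proof. exact: coord_continuous. Qed.

Lemma closed_le_fun (T : topologicalType) (f : T -> R) c :
  continuous f -> closed [set x | f x <= c].
Proof.
move=> cf; rewrite (_ : mkset _ = f @^-1` [set x | x <= c])//.
apply: preimage_closed; last exact: closed_le.
by move=> x _; exact: cf.
Qed.

Lemma bounded_compact n (A : set 'rV[R]_n) M : closed A ->
  (forall x, A x -> forall i, `|x 0 i| <= M) -> compact A.
Proof.
move=> cA bA.
have K : compact [set v : 'rV[R]_n | forall i, v ord0 i \in `[- M, M]].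
  apply: (@rV_compact _ _ (fun=> `[- M, M]%classic)) => i; exact: segment_compact.
apply: subclosed_compact cA K _ => x /bA + i; rewrite in_itv/= -ler_norml; exact.
Qed.

Definition nsq n (x : 'rV[R]_n) : R := \sum_(i < n) x 0 i ^+ 2.
Definition dot n (x y : 'rV[R]_n) : R := \sum_(i < n) x 0 i * y 0 i.
Definition enorm n (x : 'rV[R]_n) : R := Num.sqrt (nsq x).

Lemma nsq_ge0 n (x : 'rV[R]_n) : 0 <= nsq x.
Proof. by apply: sumr_ge0 => i _; exact: sqr_ge0. Qed.

Lemma enorm_ge0 n (x : 'rV[R]_n) : 0 <= enorm x.
Proof. exact: sqrtr_ge0. Qed.

Lemma enorm_sqr n (x : 'rV[R]_n) : enorm x ^+ 2 = nsq x.
Proof. by rewrite sqr_sqrtr// nsq_ge0. Qed.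

Lemma dotxx n (x : 'rV[R]_n) : dot x x = nsq x.
Proof. by []. Qed.

Lemma dotC n (x y : 'rV[R]_n) : dot x y = dot y x.
Proof. by apply: eq_bigr => i _; rewrite mulrC. Qed.

Lemma dotDl n (x y z : 'rV[R]_n) : dot (x + y) z = dot x z + dot y z.
Proof. by rewrite -big_split; apply: eq_bigr => i _; rewrite mxE mulrDl. Qed.

Lemma dotZl n a (x z : 'rV[R]_n) : dot (a *: x) z = a * dot x z.
Proof. by rewrite mulr_sumr; apply: eq_bigr => i _; rewrite mxE mulrA. Qed.

Lemma nsqD n (x y : 'rV[R]_n) : nsq (x + y) = nsq x + 2 * dot x y + nsq y.
Proof.
rewrite -!dotxx dotDl !(dotC _ (x + y)) !dotDl (dotC y x); ring.
Qed.

Lemma nsqZ n a (x : 'rV[R]_n) : nsq (a *: x) = a ^+ 2 * nsq x.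
Proof. by rewrite -!dotxx dotZl (dotC x) dotZl mulrA expr2. Qed.

Lemma enormZ n a (x : 'rV[R]_n) : enorm (a *: x) = `|a| * enorm x.
Proof. by rewrite /enorm nsqZ sqrtrM ?sqr_ge0// sqrtr_sqr. Qed.

Lemma nsq_eq0 n (x : 'rV[R]_n) : nsq x = 0 -> x = 0.
Proof.
move=> /eqP; rewrite psumr_eq0; last by move=> i _; exact: sqr_ge0.
move=> /allP h; apply/rowP => i; rewrite mxE.
by have := h i (mem_index_enum i); rewrite sqrf_eq0 => /eqP.
Qed.

Lemma dot_le n (x y : 'rV[R]_n) : dot x y <= enorm x * enorm y.
Proof.
have [x0|x0] := eqVneq (nsq x) 0.
  rewrite (nsq_eq0 x0) /dot big1 ?mulr_ge0 ?enorm_ge0// => i _.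
  by rewrite mxE mul0r.
have xp : 0 < nsq x by rewrite lt_def x0 nsq_ge0.
have H : dot x y ^+ 2 <= nsq x * nsq y.
  have := nsq_ge0 ((- dot x y / nsq x) *: x + y).
  rewrite nsqD nsqZ dotZl => h.
  have : 0 <= (nsq x) * ((- dot x y / nsq x) ^+ 2 * nsq x + 2 * (- dot x y / nsq x * dot x y) + nsq y).
    by rewrite mulr_ge0// ltW.
  rewrite (_ : _ * _ = nsq x * nsq y - dot x y ^+ 2); last by field.
  lra.
have e0 : 0 <= enorm x * enorm y by rewrite mulr_ge0 ?enorm_ge0.
rewrite -!enorm_sqr -exprMn in H.
by rewrite leNgt; apply/negP => lt; nra.
Qed.

Lemma eballE n r (x : 'rV[R]_n) : eball n r x <-> enorm x <= r.
Proof. by []. Qed.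

Lemma continuous_nsq n : continuous (@nsq n).
Proof.
apply: continuous_sum_row => i.
rewrite (_ : (fun _ => _) = (fun t : 'rV[R]_n => t 0 i * t 0 i)); last by apply/funext.
by apply: continuous_mul; exact: continuous_coord.
Qed.

Lemma continuous_enorm n : continuous (@enorm n).
Proof.
move=> x; apply: (@continuous_comp _ _ _ (@nsq n) Num.sqrt); first exact: continuous_nsq.
exact: sqrt_continuous.
Qed.

Lemma coord_le_enorm n (x : 'rV[R]_n) i : `|x 0 i| <= enorm x.
Proof.
rewrite -sqrtr_sqr ler_wsqrtr// /nsq (bigD1 i)//= lerDl.
by apply: sumr_ge0 => j _; exact: sqr_ge0.
Qed.

Lemma compact_eball n r : compact (@eball R n r).
Proof.
apply: (@bounded_compact _ _ r).
  exact/closed_le_fun/continuous_enorm.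
by move=> x xr i; exact: le_trans (coord_le_enorm _ _) xr.
Qed.

Lemma compact_minkowski n (A B : set 'rV[R]_n) :
  compact A -> compact B -> compact (msum A B).
Proof.
move=> cA cB.
rewrite (_ : msum A B = (fun p => p.1 + p.2) @` (A `*` B)).
  apply: continuous_compact; last exact: compact_setX.
  exact/continuous_subspaceT/add_continuous.
apply/seteqP; split => x.
  by case=> a Aa [b Bb <-]; exists (a, b).
by case=> -[a b] [/= Aa Bb] <-; exists a => //; exists b.
Qed.

Definition cvx n (A : set 'rV[R]_n) := forall x y, A x -> A y ->
  forall l : R, 0 <= l <= 1 -> A (l *: x + (1 - l) *: y).

Lemma cvx_minkowski n (A B : set 'rV[R]_n) : cvx A -> cvx B -> cvx (msum A B).
Proof.
move=> cA cB _ _ [a Aa [b Bb <-]] [a' Aa' [b' Bb' <-]] l l01.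
exists (l *: a + (1 - l) *: a'); first exact: cA.
exists (l *: b + (1 - l) *: b'); first exact: cB.
by rewrite !scalerDr addrACA.
Qed.

Definition seg n (u : 'rV[R]_n) (t : R) : set 'rV[R]_n :=
  [set c *: u | c in `[- t, t]].

Lemma cvx_seg n (u : 'rV[R]_n) t : cvx (seg u t).
Proof.
move=> _ _ [c + <-] [d + <-] l; rewrite /= !in_itv/= => /andP[c1 c2] /andP[d1 d2] /andP[l0 l1].
exists (l * c + (1 - l) * d); last by rewrite !scalerA -scalerDl.
rewrite /= in_itv/=; apply/andP; split; nra.
Qed.

Lemma compact_seg n (u : 'rV[R]_n) t : compact (seg u t).
Proof.
apply: continuous_compact; last exact: segment_compact.
apply: continuous_subspaceT; apply: continuous_row => i.
rewrite (_ : (fun _ => _) = (fun t : R => t * u 0 i)); last by apply/funext => s; rewrite mxE.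
apply: continuous_mul => x; first exact: cvg_id.
exact: cvg_cst.
Qed.

End geometry.

(** * Sweeping a convex body along a segment *)

Section segments.
Context {R : realType}.
Local Notation mR := (measurableTypeR R).
Local Notation leb := (@lebesgue_measure R).

Lemma rcons_hd0 n (x : R) (y : 'rV[R]_n) : rcons_hd x y 0 0 = x.
Proof. by rewrite /rcons_hd mxE; case: splitP => j //= _; rewrite mxE ord1. Qed.

Lemma rcons_hdS n (x : R) (y : 'rV[R]_n) i : rcons_hd x y 0 (lift 0 i) = y 0 i.
Proof.
rewrite /rcons_hd mxE; case: splitP => j /=; first by rewrite ord1.
by rewrite /bump/= => /eqP; rewrite eqn_add2l => /eqP/ord_inj ->.
Qed.

Lemma rowDZ n (a b : 'rV[R]_n) c i : (a + c *: b) 0 i = a 0 i + c * b 0 i.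
Proof. by rewrite !mxE. Qed.

Lemma rcons_hdP n (x : R) (y : 'rV[R]_n) (z : 'rV[R]_n.+1) :
  (z 0 0 = x) -> (forall i, z 0 (lift 0 i) = y 0 i) -> z = rcons_hd x y.
Proof.
move=> z0 zS; apply/rowP => i; case: (unliftP 0 i) => [j ->|->].
  by rewrite rcons_hdS zS.
by rewrite rcons_hd0.
Qed.

Definition tl n (z : 'rV[R]_n.+1) : 'rV[R]_n := \row_i z 0 (lift 0 i).

Lemma rcons_hd_eta n (z : 'rV[R]_n.+1) : rcons_hd (z 0 0) (tl z) = z.
Proof. by apply/esym/rcons_hdP => // i; rewrite mxE. Qed.

Lemma tl_rcons_hd n (x : R) (y : 'rV[R]_n) : tl (rcons_hd x y) = y.
Proof. by apply/rowP => i; rewrite mxE rcons_hdS. Qed.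

Lemma rcons_hdD n (x x' : R) (y y' : 'rV[R]_n) :
  rcons_hd x y + rcons_hd x' y' = rcons_hd (x + x') (y + y').
Proof. by apply: rcons_hdP => [|i]; rewrite [LHS]mxE ?rcons_hd0// !rcons_hdS mxE. Qed.

Lemma rcons_hdZ n (a x : R) (y : 'rV[R]_n) :
  a *: rcons_hd x y = rcons_hd (a * x) (a *: y).
Proof. by apply: rcons_hdP => [|i]; rewrite [LHS]mxE ?rcons_hd0// !rcons_hdS mxE. Qed.

(** A nonempty compact convex I is some [a, b], and adding [-t, t] gives [a - t, b + t]. The
    indicator at [tt] is the number 1 or 0 according to whether I is nonempty. *)
Lemma leb_itvD (I : set R) (t : R) : 0 <= t -> compact I ->
  (forall x y, I x -> I y -> forall l, 0 <= l <= 1 -> I (l * x + (1 - l) * y)) ->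
  leb [set s | exists2 c, - t <= c <= t & I (s - c)] =
  (leb I + (2 * t * \1_[set _ | I !=set0] tt)%:E)%E.
Proof.
move=> t0 cI vI; have [I0|I0] := pselect (I !=set0); last first.
  rewrite (_ : [set s | _] = set0); last first.
    by apply/seteqP; split => // s [c _ Ic]; case: I0; exists (s - c).
  rewrite (_ : I = set0); last by apply/seteqP; split => // s Is; case: I0; exists s.
  rewrite !measure0 indicE memNset ?mulr0 ?adde0//= => -[x]; exact.
have cid : {within I, continuous (@id R)} by apply: continuous_subspaceT => x; exact: cvg_id.
have [a /set_mem Ia amin] := compact_EVT_min I0 cI cid.
have [b /set_mem Ib bmax] := compact_EVT_max I0 cI cid.
have ab : a <= b by apply: amin; rewrite inE.
have IE : I = `[a, b]%classic.
  apply/seteqP; split => x /=; rewrite in_itv/=.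
    by move=> Ix; rewrite amin ?inE// bmax ?inE.
  move=> /andP[ax xb]; have [abE|/negbTE abN] := eqVneq a b.
    by rewrite (_ : x = a)//; lra.
  have ba : 0 < b - a by move: ab; rewrite subr_gt0 le_eqVlt abN.
  rewrite (_ : x = ((b - x) / (b - a)) * a + (1 - (b - x) / (b - a)) * b); last first.
    by field; rewrite gt_eqF.
  by apply: vI => //; rewrite divr_ge0 ?ler_pdivrMr//=; lra.
rewrite (_ : [set s | _] = `[a - t, b + t]%classic); last first.
  apply/seteqP; split => s; rewrite IE /= in_itv/=.
    by move=> [c ct]; rewrite in_itv/= => h; lra.
  move=> /andP[s1 s2].
  have [sa|sa] := leP s a; first by exists (s - a); rewrite ?in_itv/=; lra.
  have [sb|sb] := leP s b; first by exists 0; rewrite ?in_itv/=; lra.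
  by exists (s - b); rewrite ?in_itv/=; lra.
rewrite indicE mem_set// mulr1 IE !lebesgue_measure_itv/= !lte_fin.
rewrite -!EFinD; case: ltP => h1; case: ltP => h2; rewrite -?EFinD; congr EFin; lra.
Qed.

Section segment.
Variables (n : nat) (w : 'rV[R]_n).

(** The trace of A on the line through (0, y) with direction (1, w), parametrized by the first
    coordinate. *)
Definition line (A : set 'rV[R]_n.+1) (y : 'rV[R]_n) : set R :=
  [set s | A (rcons_hd s (y + s *: w))].

Lemma continuous_line y : continuous (fun s : R => rcons_hd s (y + s *: w)).
Proof.
apply: continuous_row => i; case: (unliftP 0 i) => [j ->|->].
  rewrite (_ : (fun _ => _) = (fun s => y 0 j + s * w 0 j)); last first.
    by apply/funext => s; rewrite rcons_hdS !mxE.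
  apply: continuous_add => [|]; first by move=> x; exact: cvg_cst.
  apply: continuous_mul => x; first exact: cvg_id.
  exact: cvg_cst.
rewrite (_ : (fun _ => _) = id); last by apply/funext => s; rewrite rcons_hd0.
by move=> x; exact: cvg_id.
Qed.

Lemma continuous_shear (a : R) :
  continuous (fun z : 'rV[R]_n.+1 => rcons_hd (z 0 0) (tl z + (a * z 0 0) *: w)).
Proof.
apply: continuous_row => i; case: (unliftP 0 i) => [j ->|->].
  rewrite (_ : (fun _ => _) = (fun z : 'rV[R]_n.+1 => z 0 (lift 0 j) + (a * w 0 j) * z 0 0)); last first.
    by apply/funext => s; rewrite rcons_hdS !mxE; ring.
  apply: continuous_add; first exact: continuous_coord.
  apply: continuous_mul; last exact: continuous_coord.
  exact: cst_continuous.
rewrite (_ : (fun _ => _) = (fun z : 'rV[R]_n.+1 => z 0 0)); last first.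
  by apply/funext => s; rewrite rcons_hd0.
exact: continuous_coord.
Qed.

Lemma pmeas_line (A : set 'rV[R]_n.+1) : compact A ->
  pmeas n (fun (x : mR) s => (\1_(line A (rv n s)) x)%:E).
Proof.
move=> cA.
have cA' : closed ((fun z : 'rV[R]_n.+1 => rcons_hd (z 0 0) (tl z + (1 * z 0 0) *: w)) @^-1` A).
  apply: preimage_closed; last by apply: compact_closed => //; exact: norm_hausdorff.
  by move=> x _; exact: continuous_shear.
have := tmeas_cons (closed_rmeas cA').
rewrite /pmeas; congr (measurable_fun _ _); apply/funext => p.
rewrite !indicE rv_cons; congr ((nat_of_bool _)%:R%:E).
by apply/idP/idP => /set_mem h; apply/mem_set; move: h;
  rewrite /line/= rcons_hd0 tl_rcons_hd mul1r.
Qed.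

(** Translating the slice at height x by x w does not change its volume; after this shear Tonelli
    integrates along the lines first. *)
Lemma vol_line (A : set 'rV[R]_n.+1) : compact A ->
  vol A = itr (fun y => leb (line A y)).
Proof.
move=> cA; have mA := compact_rmeas cA; have A0 z : (0 <= (\1_A z)%:E :> \bar R)%E by rewrite lee_fin.
rewrite volE itr_hd.
transitivity (\int[leb]_x itr (fun y => (\1_(line A y) x)%:E))%E.
  apply: eq_integral => x _.
  have mAx : rmeasf (fun y => (\1_A (rcons_hd x y))%:E).
    have := pmeas_sec (x : mR) (tmeas_cons mA).
    by rewrite /rmeasf /tmeas; congr (measurable_fun _ _); apply/funext => t; rewrite rv_cons.
  rewrite -[LHS]mul1e -[X in (X * _)%E](_ : (1 ^- n)%:E = _); last by rewrite expr1n invr1.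
  rewrite -(itr_aff (x *: w) ltr01)//.
  by rewrite /itr; apply: eq_itint => s _; rewrite scale1r.
rewrite /itr -(itint_swap leb)//.
- apply: eq_itint => s _; rewrite integral_indic//= ?setIT//.
  have := @compact_closed _ _ (@norm_hausdorff _ _) cA.
  move=> /(preimage_closed (f := fun x : R => rcons_hd x (rv n s + x *: w))) h.
  by apply: closed_measurable; apply: h => x _; exact: continuous_line.
- exact: pmeas_line.
Qed.

Lemma rmeasf_line (A : set 'rV[R]_n.+1) : compact A -> rmeasf (fun y => leb (line A y)).
Proof.
move=> cA.
have := @measurable_fun_fubini_tonelli_G _ _ mR (n.-tuple mR) R lebesgue_measure _ (pmeas_line cA).
rewrite /rmeasf /tmeas => h.
suff -> : (fun t : n.-tuple mR => leb (line A (rv n (tval t)))) =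
  fubini_G leb (fun p : mR * n.-tuple mR => (\1_(line A (rv n (tval p.2))) p.1)%:E).
  by apply: h => p; rewrite lee_fin.
apply/funext => t; rewrite /fubini_G/= integral_indic//= ?setIT//.
have := @compact_closed _ _ (@norm_hausdorff _ _) cA.
move=> /(preimage_closed (f := fun x : R => rcons_hd x (rv n t + x *: w))) h'.
by apply: closed_measurable; apply: h' => x _; exact: continuous_line.
Qed.

(** The projection of A along (1, w) onto the hyperplane of vanishing first coordinate. *)
Definition shadow (A : set 'rV[R]_n.+1) : set 'rV[R]_n := [set y | line A y !=set0].

Lemma compact_shadow (A : set 'rV[R]_n.+1) : compact A -> compact (shadow A).
Proof.
move=> cA.
rewrite (_ : shadow A = (fun z => tl z - z 0 0 *: w) @` A).
  apply: continuous_compact => //; apply: continuous_subspaceT.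
  apply: continuous_row => i.
  rewrite (_ : (fun _ => _) = (fun z : 'rV[R]_n.+1 => z 0 (lift 0 i) + (- w 0 i) * z 0 0)); last first.
    by apply/funext => s; rewrite !mxE; ring.
  apply: continuous_add; first exact: continuous_coord.
  apply: continuous_mul; last exact: continuous_coord.
  exact: cst_continuous.
apply/seteqP; split => y.
  by case=> s; rewrite /line/= => As; eexists; first exact: As; rewrite tl_rcons_hd rcons_hd0 addrK.
case=> z Az <-; exists (z 0 0).
by rewrite /line/= subrK rcons_hd_eta.
Qed.

Lemma compact_line (A : set 'rV[R]_n.+1) y : compact A -> compact (line A y).
Proof.
move=> cA; apply: (@subclosed_compact _ _ ((fun z : 'rV[R]_n.+1 => z 0 0) @` A)).
- have := @compact_closed _ _ (@norm_hausdorff _ _) cA.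
  move=> /(preimage_closed (f := fun x : R => rcons_hd x (y + x *: w))); apply => x _.
  exact: continuous_line.
- apply: continuous_compact => //; apply: continuous_subspaceT; exact: continuous_coord.
- by move=> s As; exists (rcons_hd s (y + s *: w)) => //; rewrite rcons_hd0.
Qed.

Lemma cvx_line (A : set 'rV[R]_n.+1) y : cvx A ->
  forall s t, line A y s -> line A y t -> forall l, 0 <= l <= 1 -> line A y (l * s + (1 - l) * t).
Proof.
move=> cA s t As At l l01; rewrite /line/=.
have := cA _ _ As At _ l01; rewrite !rcons_hdZ rcons_hdD.
congr (A (rcons_hd _ _)).
by apply/rowP => i; rewrite !mxE; ring.
Qed.

End segment.

(** Cut along the direction u: each nonempty section is an interval that lengthens by 2 t |u_0| in
    the first coordinate, and empty sections stay empty. Hence the growth is linear in t, with a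
    slope proportional to the volume of the shadow. The condition on u makes the first coordinate a
    parameter on these lines. *)
Lemma vol_segment n (K : set 'rV[R]_n.+1) (u : 'rV[R]_n.+1) :
  compact K -> cvx K -> u 0 0 != 0 ->
  exists2 h : \bar R, (0 <= h)%E &
    forall t, 0 <= t -> (vol (msum K (seg u t)) = vol K + t%:E * h)%E.
Proof.
move=> cK vK u0; pose w := (u 0 0)^-1 *: tl u.
have cS : compact (shadow w K) by exact: compact_shadow.
exists ((2 * `|u 0 0|)%:E * vol (shadow w K))%E.
  by rewrite mule_ge0 ?lee_fin ?mulr_ge0// volE; apply: itr_ge0 => x; rewrite lee_fin.
move=> t t0.
have cKs : compact (msum K (seg u t)) by apply: compact_minkowski => //; exact: compact_seg.
rewrite (@vol_line _ w _ cKs) (@vol_line _ w _ cK) muleA -EFinM (volE (shadow w K)).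
rewrite -itrZl; last 3 first.
- by rewrite lee_fin !mulr_ge0.
- by move=> x; rewrite lee_fin.
- exact: compact_rmeas.
rewrite -itrD; last 4 first.
- by move=> y.
- by move=> y; rewrite -EFinM lee_fin !mulr_ge0.
- exact: rmeasf_line.
- by apply: measurable_funeM; exact: (compact_rmeas cS).
congr itr; apply/funext => y.
transitivity (leb [set s | exists2 c, - (t * `|u 0 0|) <= c <= t * `|u 0 0| & line w K y (s - c)]).
  congr (leb _); apply/seteqP; split => s.
    case=> k Kk [_ [c + <-]]; rewrite /= in_itv/= -ler_norml => ct kE.
    exists (c * u 0 0); first by rewrite -ler_norml normrM ler_wpM2r.
    rewrite /line/=.
    suff <- : k = rcons_hd (s - c * u 0 0) (y + (s - c * u 0 0) *: w) by [].
    have -> : k = rcons_hd s (y + s *: w) + (- c) *: u by rewrite -kE scaleNr addrK.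
    apply: rcons_hdP => [|i]; first by rewrite rowDZ rcons_hd0 mulNr.
    by rewrite rowDZ rcons_hdS !mxE; field.
  case=> c; rewrite -ler_norml => ct; rewrite /line/= => Kc.
  eexists; first exact: Kc.
  exists ((c / u 0 0) *: u).
    exists (c / u 0 0) => //=; rewrite in_itv/= -ler_norml normrM normfV.
    by rewrite ler_pdivrMr ?normr_gt0.
  apply: rcons_hdP => [|i]; first by rewrite rowDZ rcons_hd0; field.
  by rewrite rowDZ rcons_hdS !mxE; field.
rewrite leb_itvD//.
- congr (_ + _)%E; rewrite -EFinM; congr EFin.
  rewrite (_ : \1_[set _ | line w K y !=set0] tt = \1_(shadow w K) y); first ring.
  rewrite !indicE; congr ((nat_of_bool _)%:R).
- by rewrite mulr_ge0.
- exact: compact_line.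
- exact: cvx_line.
Qed.

End segments.

(** * Gaussian means *)

Section gaussian.
Context {R : realType}.
Local Notation mR := (measurableTypeR R).
Local Notation leb := (@lebesgue_measure R).

(** The density of the centred Gaussian law of variance 1/2. *)
Definition phi (x : R) : R := gauss_fun x / Num.sqrt pi.

Lemma phi_ge0 x : 0 <= phi x.
Proof. by rewrite divr_ge0 ?gauss_fun_ge0 ?sqrtr_ge0. Qed.

Lemma measurable_phi : measurable_fun [set: mR] phi.
Proof. by apply: measurable_funM => //; exact: measurable_gauss_fun. Qed.

Lemma integral_phi : (\int[leb]_x (phi x)%:E = 1)%E.
Proof.
under eq_integral do rewrite /phi EFinM muleC.
rewrite ge0_integralZl//; last 2 first.
- by apply/measurable_EFinP; exact: measurable_gauss_fun.
- by move=> x _; rewrite lee_fin gauss_fun_ge0.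
by rewrite integralT_gauss -EFinM mulVf// gt_eqF// sqrtr_gt0 pi_gt0.
Qed.

Definition gauss_mean (g : R -> R) : \bar R := (\int[leb]_x (g x * phi x)%:E)%E.

Definition ge0meas (g : R -> R) := measurable_fun [set: mR] g /\ forall x, 0 <= g x.

Lemma ge0meas_phi g : ge0meas g -> ge0meas (fun x => g x * phi x).
Proof.
case=> mg g0; split; last by move=> x; rewrite mulr_ge0 ?phi_ge0.
by apply: measurable_funM => //; exact: measurable_phi.
Qed.

Lemma gauss_mean_ge0 g : ge0meas g -> (0 <= gauss_mean g)%E.
Proof. by move=> /ge0meas_phi[_ g0]; apply: integral_ge0 => x _; rewrite lee_fin. Qed.

Lemma le_gauss_mean g h : ge0meas g -> ge0meas h -> (forall x, g x <= h x) -> (gauss_mean g <= gauss_mean h)%E.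
Proof.
move=> /ge0meas_phi[mg g0] /ge0meas_phi[mh h0] gh; apply: ge0_le_integral => //.
- by move=> x _; rewrite lee_fin g0.
- exact/measurable_EFinP.
- exact/measurable_EFinP.
- by move=> x _; rewrite lee_fin ler_wpM2r ?phi_ge0.
Qed.

Lemma gauss_meanD g h : ge0meas g -> ge0meas h -> (gauss_mean (fun x => g x + h x)%R = gauss_mean g + gauss_mean h)%E.
Proof.
move=> /ge0meas_phi[mg g0] /ge0meas_phi[mh h0].
rewrite /gauss_mean; under eq_integral do rewrite mulrDl EFinD.
by rewrite ge0_integralD//; first [exact/measurable_EFinP|move=> x _; rewrite lee_fin ?g0 ?h0].
Qed.

Lemma gauss_meanZ k g : 0 <= k -> ge0meas g -> (gauss_mean (fun x => k * g x)%R = k%:E * gauss_mean g)%E.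
Proof.
move=> k0 /ge0meas_phi[mg g0].
rewrite /gauss_mean; under eq_integral do rewrite -mulrA EFinM.
by rewrite ge0_integralZl//; first [exact/measurable_EFinP|move=> x _; rewrite lee_fin ?g0].
Qed.

Lemma ge0meas_cst k : 0 <= k -> ge0meas (fun=> k).
Proof. by move=> k0; split => //; exact: measurable_cst. Qed.

Lemma gauss_mean_cst k : 0 <= k -> gauss_mean (fun=> k) = k%:E.
Proof.
move=> k0; rewrite (_ : (fun=> k) = (fun x => k * 1)); last by apply/funext => x; rewrite mulr1.
rewrite (@gauss_meanZ k (fun=> 1) k0 (ge0meas_cst ler01)).
rewrite /gauss_mean; under eq_integral do rewrite mul1r.
by rewrite integral_phi mule1.
Qed.

Lemma ge0meas_abs a b : ge0meas (fun x => `|a + b * x|).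
Proof.
split => // ; apply: measurableT_comp => //.
by apply: measurable_funD => //; exact: measurable_funM.
Qed.

Lemma ge0meas_sqr : ge0meas (fun x => x ^+ 2).
Proof. by split; [exact: exprn_measurable|move=> x; exact: sqr_ge0]. Qed.

(** Half of the exponent absorbs the square, since x^2 / 2 <= exp(x^2 / 2); the other half is a
    dilated Gaussian of finite mass. *)
Lemma gauss_mean_sqr_fin : (gauss_mean (fun x => x ^+ 2)%R < +oo)%E.
Proof.
have s2 : 0 < Num.sqrt (2^-1 : R) by rewrite sqrtr_gt0.
have -> : gauss_mean (fun x => x ^+ 2) = (\int[leb]_x ((x ^+ 2 * phi x)%:E))%E by [].
apply: (@le_lt_trans _ _ (\int[leb]_x (2%:E * (phi (Num.sqrt 2^-1 * x + 0))%:E))%E).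
  apply: ge0_le_integral => //.
  - by move=> x _; rewrite lee_fin mulr_ge0 ?sqr_ge0 ?phi_ge0.
  - by apply/measurable_EFinP; exact: (ge0meas_phi ge0meas_sqr).1.
  - apply/measurable_EFinP/measurable_funM => //; apply: (measurableT_comp measurable_phi).
    by apply: measurable_funD => //; exact: measurable_funM.
  - move=> x _; rewrite -EFinM lee_fin /phi addr0 /gauss_fun !mulrA ler_wpM2r ?invr_ge0 ?sqrtr_ge0//.
    rewrite exprMn sqr_sqrtr ?invr_ge0//.
    have -> : - x ^+ 2 = - (2^-1 * x ^+ 2) + - (2^-1 * x ^+ 2) by field.
    rewrite expRD mulrA ler_wpM2r ?expR_ge0// expRN ler_pdivrMr ?expR_gt0//.
    have := expR_ge1Dx (2^-1 * x ^+ 2).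
    have := expR_gt0 (2^-1 * x ^+ 2); lra.
rewrite ge0_integralZl//; last 2 first.
- apply/measurable_EFinP; apply: (measurableT_comp measurable_phi).
  by apply: measurable_funD => //; exact: measurable_funM.
- by move=> x _; rewrite lee_fin phi_ge0.
rewrite (@ge0_integral_affine _ _ 0 (fun x => (phi x)%:E) s2)//.
- by rewrite integral_phi mule1 -EFinM ltry.
- by apply/measurable_EFinP; exact: measurable_phi.
- by move=> x; rewrite lee_fin phi_ge0.
Qed.

Lemma gauss_mean_abs_fin a b : (gauss_mean (fun x => `|a + b * x|)%R < +oo)%E.
Proof.
apply: (@le_lt_trans _ _ (gauss_mean (fun x => (`|a| + `|b|) * 1 + `|b| * x ^+ 2)%R)).
  apply: le_gauss_mean; first exact: ge0meas_abs.
    split; last by move=> x; rewrite mulr1 !addr_ge0// mulr_ge0 ?sqr_ge0.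
    apply: measurable_funD; first exact: measurable_cst.
    apply: measurable_funM; [exact: measurable_cst|exact: exprn_measurable].
  move=> x; apply: (le_trans (ler_normD _ _)); rewrite normrM mulr1 -addrA lerD2l.
  have := normr_ge0 b; have : `|x| <= 1 + x ^+ 2; last by nra.
  by rewrite -(real_normK (num_real x)); nra.
rewrite gauss_meanD; last 2 first.
- by apply: ge0meas_cst; rewrite mulr1 addr_ge0.
- by split; [apply: measurable_funM => //; exact: exprn_measurable|move=> x; rewrite mulr_ge0 ?sqr_ge0].
rewrite gauss_mean_cst ?mulr1 ?addr_ge0// gauss_meanZ//; last exact: ge0meas_sqr.
rewrite lte_add_pinfty ?ltry// lte_mul_pinfty ?lee_fin//; exact: gauss_mean_sqr_fin.
Qed.

(* The mean of |c + N| for a centred Gaussian N of standard deviation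
   proportional to r. *)
Definition gauss_abs (r c : R) : R := fine (gauss_mean (fun x => `|c + r * x|)).

Lemma gauss_absE r c : (gauss_abs r c)%:E = gauss_mean (fun x => `|c + r * x|).
Proof.
rewrite fineK// ge0_fin_numE ?gauss_mean_abs_fin//; apply: gauss_mean_ge0; exact: ge0meas_abs.
Qed.

Lemma gauss_abs_ge0 r c : 0 <= gauss_abs r c.
Proof. by apply: fine_ge0; apply: gauss_mean_ge0; exact: ge0meas_abs. Qed.

Lemma gauss_abs0 c : gauss_abs 0 c = `|c|.
Proof.
rewrite /gauss_abs (_ : (fun _ => _) = fun=> `|c|); first by rewrite gauss_mean_cst.
by apply/funext => x; rewrite mul0r addr0.
Qed.

Lemma gauss_abs_lip r c c' : gauss_abs r c <= gauss_abs r c' + `|c - c'|.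
Proof.
rewrite -lee_fin EFinD !gauss_absE -(gauss_mean_cst (normr_ge0 (c - c'))) -gauss_meanD; last 2 first.
- exact: ge0meas_abs.
- exact: ge0meas_cst.
apply: le_gauss_mean => [||x]; first exact: ge0meas_abs.
  split; last by move=> x; rewrite addr_ge0.
  by apply: measurable_funD => //; exact: (ge0meas_abs _ _).1.
have -> : c + r * x = (c' + r * x) + (c - c') by ring.
exact: ler_normD.
Qed.

Lemma gauss_abs_homo r : 0 <= r -> gauss_abs r 0 = r * gauss_abs 1 0.
Proof.
move=> r0; apply: EFin_inj; rewrite EFinM !gauss_absE -gauss_meanZ//; last exact: ge0meas_abs.
by congr gauss_mean; apply/funext => x; rewrite !add0r normrM ger0_norm// mul1r.
Qed.

Lemma sqrt_pi_ge1 : 1 <= Num.sqrt (pi : R).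
Proof. by rewrite -[1]sqrtr1 ler_wsqrtr//; have := @pi_ge2 R; lra. Qed.

Lemma phi_le1 x : phi x <= 1.
Proof.
rewrite ler_pdivrMr ?sqrtr_gt0 ?pi_gt0// mul1r.
exact: le_trans (gauss_fun_le1 x) sqrt_pi_ge1.
Qed.

Lemma ge0meas_add g h : ge0meas g -> ge0meas h -> ge0meas (fun x => g x + h x).
Proof.
by case=> mg g0 [mh h0]; split; [exact: measurable_funD|move=> x; rewrite addr_ge0].
Qed.

Lemma ge0meas_scale k g : 0 <= k -> ge0meas g -> ge0meas (fun x => k * g x).
Proof.
by move=> k0 [mg g0]; split; [exact: measurable_funM|move=> x; rewrite mulr_ge0].
Qed.

(** Pointwise 1 <= 4 |x| + 1_[-1/4, 1/4](x), and the indicator has mean at most 1/2 because [phi] is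
    at most 1. *)
Lemma gauss_abs1_gt0 : 0 < gauss_abs 1 0.
Proof.
pose I01 : R -> R := \1_(`[- 4^-1, 4^-1]%classic : set R).
have mI : ge0meas I01.
  by split => [|x]; [exact: measurable_indic|rewrite ler0n].
have EI : (gauss_mean I01 <= (2^-1)%:E)%E.
  apply: (@le_trans _ _ (\int[leb]_x (I01 x)%:E)%E).
    apply: ge0_le_integral => //.
    - by move=> x _; rewrite lee_fin (ge0meas_phi mI).2.
    - by apply/measurable_EFinP; exact: (ge0meas_phi mI).1.
    - by apply/measurable_EFinP; exact: mI.1.
    - by move=> x _; rewrite lee_fin -[leRHS]mulr1 ler_wpM2l ?phi_le1// mI.2.
  rewrite integral_indic//= setIT lebesgue_measure_itv/= lte_fin.
  by case: ifPn => _; rewrite ?lee_fin; lra.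
have m4 := ge0meas_scale (ler0n _ 4) (ge0meas_abs 0 1).
have : (gauss_mean (fun=> 1%R) <= gauss_mean (fun x => 4 * `|0 + 1 * x| + I01 x)%R)%E.
  apply: le_gauss_mean; [exact: ge0meas_cst|exact: ge0meas_add|move=> x].
  rewrite add0r mul1r /I01 indicE; case: (boolP (x \in _)) => /=.
    by have := normr_ge0 x; lra.
  rewrite notin_setE/= in_itv/= -ler_norml => /negP; rewrite -ltNge; lra.
rewrite gauss_mean_cst// gauss_meanD// gauss_meanZ//; last exact: ge0meas_abs.
rewrite -gauss_absE => h; have := le_trans h (leeD2l _ EI).
by rewrite -EFinM -EFinD lee_fin; lra.
Qed.

Lemma phi_affine_meas a b : measurable_fun [set: mR] (fun x => phi (a * x + b)).
Proof.
apply: (measurableT_comp measurable_phi).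
by apply: measurable_funD => //; exact: measurable_funM.
Qed.

(* Completing the square. *)
Lemma phi_convolution a r x : 0 < r -> let q := Num.sqrt (a ^+ 2 + r ^+ 2) in
  (\int[leb]_s (phi s * phi ((x - a * s) / r))%:E = (r / q * phi (x / q))%:E)%E.
Proof.
move=> r0 q.
have q0 : 0 < q by rewrite sqrtr_gt0; have := sqr_ge0 a; nra.
have q2 : q ^+ 2 = a ^+ 2 + r ^+ 2 by rewrite sqr_sqrtr// addr_ge0 ?sqr_ge0.
transitivity (\int[leb]_s ((phi (x / q))%:E * (phi (q / r * s + - (a * x / (r * q))))%:E))%E.
  apply: eq_integral => s _; rewrite -EFinM /phi; congr EFin.
  rewrite mulf_div [RHS]mulf_div; congr (_ / _); rewrite /gauss_fun -!expRD; congr expR.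
  have -> : x = x / q * q by rewrite divfK// gt_eqF.
  set y := x / q.
  (* The factor (q^2 - a^2) / r^2 equals 1. Inserting it here and below turns the claim into a
     rational identity that holds without the relation between q, a and r. *)
  have -> : s ^+ 2 = s ^+ 2 * (q ^+ 2 - a ^+ 2) / r ^+ 2.
    by rewrite q2 addrC addKr mulfK// gt_eqF// exprn_gt0.
  have -> : y * q / q = y by rewrite mulfK// gt_eqF.
  have -> : y ^+ 2 = y ^+ 2 * (q ^+ 2 - a ^+ 2) / r ^+ 2.
    by rewrite q2 addrC addKr mulfK// gt_eqF// exprn_gt0.
  by field; rewrite !gt_eqF.
rewrite ge0_integralZl//; last 3 first.
- by apply/measurable_EFinP; exact: phi_affine_meas.
- by move=> s _; rewrite lee_fin phi_ge0.
- by rewrite lee_fin phi_ge0.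
rewrite (@ge0_integral_affine _ (q / r) _ (fun x => (phi x)%:E))//; last 3 first.
- by rewrite divr_gt0.
- by apply/measurable_EFinP; exact: measurable_phi.
- by move=> s; rewrite lee_fin phi_ge0.
by rewrite integral_phi mule1 -EFinM invf_div mulrC.
Qed.

Lemma gauss_mean_density r c : 0 < r ->
  (gauss_mean (fun x => `|c + r * x|)%R = \int[leb]_z (`|z| * (r^-1 * phi ((z - c) / r)))%:E)%E.
Proof.
move=> r0.
have := @ge0_integral_affine R r c (fun z => (`|z| * (r^-1 * phi ((z - c) / r)))%:E) r0.
have m : measurable_fun [set: mR] (fun z => `|z| * (r^-1 * phi ((z - c) / r))).
  apply: measurable_funM; first exact: normr_measurable.
  apply: measurable_funM; first exact: measurable_cst.
  apply: (measurableT_comp measurable_phi).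
  apply: measurable_funM; last exact: measurable_cst.
  by apply: measurable_funB; [exact: measurable_id|exact: measurable_cst].
have m0 z : 0 <= `|z| * (r^-1 * phi ((z - c) / r)).
  by apply: mulr_ge0 => //; apply: mulr_ge0; rewrite ?phi_ge0 ?invr_ge0 ?ltW.
have mE : measurable_fun [set: mR] (fun z => (`|z| * (r^-1 * phi ((z - c) / r)))%:E).
  exact/measurable_EFinP.
move=> /(_ mE (fun z => m0 z)) E.
have -> : (\int[leb]_z (`|z| * (r^-1 * phi ((z - c) / r)))%:E =
  r%:E * (r^-1%:E * \int[leb]_z (`|z| * (r^-1 * phi ((z - c) / r)))%:E))%E.
  by rewrite muleA -EFinM mulfV ?gt_eqF// mul1e.
rewrite -E -ge0_integralZl//; last 3 first.
- apply/measurable_EFinP; apply: (measurableT_comp m).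
  by apply: measurable_funD => //; exact: measurable_funM.
- by move=> z _; rewrite lee_fin.
- by rewrite lee_fin ltW.
apply: eq_integral => x _; rewrite -EFinM; congr EFin.
have -> : (r * x + c - c) / r = x by field; rewrite gt_eqF.
by rewrite (addrC c); set A := `|_|; field; rewrite gt_eqF.
Qed.

Lemma gauss_mean_opp g : ge0meas g -> gauss_mean (fun x => g (- x)) = gauss_mean g.
Proof.
move=> /ge0meas_phi[mg g0]; rewrite /gauss_mean.
have E : (\int[leb]_x (g x * phi x)%:E = \int[pushforward leb (-%R : mR -> mR)]_x (g x * phi x)%:E)%E.
  by apply: eq_measure_integral => A mA _; exact/esym/lebesgue_measureN.
rewrite E ge0_integral_pushforward//=.
- by apply: eq_integral => x _ /=; rewrite /phi /gauss_fun sqrrN.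
- exact/measurable_EFinP.
- by move=> x _; rewrite lee_fin.
Qed.

Lemma gauss_abs_norm a c : gauss_abs a c = gauss_abs `|a| c.
Proof.
have [a0|a0] := leP 0 a; first by rewrite ger0_norm.
rewrite ltr0_norm// /gauss_abs -[in RHS]gauss_mean_opp; last exact: ge0meas_abs.
by congr (fine (gauss_mean _)); apply/funext => x; rewrite mulrNN.
Qed.

(* An independent sum of centred Gaussians is Gaussian. *)
Lemma gauss_mean_stable a r c : 0 <= r ->
  gauss_mean (fun s => gauss_abs r (c + a * s)) = (gauss_abs (Num.sqrt (a ^+ 2 + r ^+ 2)) c)%:E.
Proof.
rewrite le_eqVlt => /predU1P[<-|r0].
  rewrite expr0n/= addr0 sqrtr_sqr -gauss_abs_norm gauss_absE; congr gauss_mean; apply/funext => s.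
  by rewrite gauss_abs0.
set q := Num.sqrt _.
have q0 : 0 < q by rewrite sqrtr_gt0; have := sqr_ge0 a; nra.
pose K (s z : R) := `|z| * (r^-1 * (phi s * phi (r^-1 * (z - c - a * s)))).
have K0 s z : 0 <= K s z.
  by rewrite /K; do 2 (apply: mulr_ge0 => //); rewrite ?invr_ge0 ?(ltW r0)// mulr_ge0 ?phi_ge0.
have mK : measurable_fun [set: mR * mR] (fun p => K p.1 p.2).
  apply: measurable_funM.
    exact: (measurableT_comp (@normr_measurable R setT) measurable_snd).
  apply: measurable_funM; first exact: measurable_cst.
  apply: measurable_funM.
    exact: (measurableT_comp measurable_phi measurable_fst).
  apply: (measurableT_comp measurable_phi).
  apply: measurable_funM; first exact: measurable_cst.
  apply: measurable_funB.
    apply: measurable_funB; first exact: measurable_snd.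
    exact: measurable_cst.
  apply: measurable_funM; first exact: measurable_cst.
  exact: measurable_fst.
have mKs s : measurable_fun [set: mR] (K s).
  apply: measurable_funM; first exact: normr_measurable.
  apply: measurable_funM; first exact: measurable_cst.
  apply: measurable_funM; first exact: measurable_cst.
  apply: (measurableT_comp measurable_phi).
  apply: measurable_funM; first exact: measurable_cst.
  apply: measurable_funB; last exact: measurable_cst.
  by apply: measurable_funB; [exact: measurable_id|exact: measurable_cst].
transitivity (\int[leb]_s \int[leb]_z (K s z)%:E)%E.
  rewrite /gauss_mean; apply: eq_integral => s _.
  rewrite EFinM gauss_absE gauss_mean_density// muleC -ge0_integralZl//; last 3 first.
  - apply/measurable_EFinP.
    apply: measurable_funM; first exact: normr_measurable.
    apply: measurable_funM; first exact: measurable_cst.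
    apply: (measurableT_comp measurable_phi).
    apply: measurable_funM; last exact: measurable_cst.
    by apply: measurable_funB; [exact: measurable_id|exact: measurable_cst].
  - move=> z _; rewrite lee_fin; do 2 (apply: mulr_ge0 => //); rewrite ?invr_ge0 ?(ltW r0)//.
    exact: phi_ge0.
  - by rewrite lee_fin phi_ge0.
  apply: eq_integral => z _; rewrite -EFinM; congr EFin.
  rewrite /K opprD addrA [_ / r]mulrC.
  set A := phi (_ * _); set B := `|_|; ring.
rewrite (@fubini_tonelli _ _ mR mR R lebesgue_measure lebesgue_measure
  (fun p => (K p.1 p.2)%:E)); last 2 first.
- exact/measurable_EFinP.
- by move=> p; rewrite lee_fin.
rewrite gauss_absE gauss_mean_density//; apply: eq_integral => z _ /=.
transitivity (\int[leb]_s ((`|z| * r^-1)%:E * (phi s * phi ((z - c - a * s) / r))%:E))%E.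
  apply: eq_integral => s _; rewrite -EFinM; congr EFin.
  by rewrite /K (mulrC r^-1 (_ - _)) -!mulrA.
rewrite ge0_integralZl//; last 3 first.
- apply/measurable_EFinP; apply: measurable_funM; first exact: measurable_phi.
  apply: (measurableT_comp measurable_phi).
  apply: measurable_funM; last exact: measurable_cst.
  apply: measurable_funB; first exact: measurable_cst.
  by apply: measurable_funM; [exact: measurable_cst|exact: measurable_id].
- by move=> s _; rewrite lee_fin mulr_ge0 ?phi_ge0.
- by rewrite lee_fin mulr_ge0// invr_ge0 ltW.
rewrite phi_convolution// -/q -EFinM; congr EFin.
by set A := phi _; set B := `|_|; field; rewrite !gt_eqF.
Qed.

End gaussian.

(** * Discretizing the Gaussian law *)

Section discretization.
Context {R : realType}.
Local Notation mR := (measurableTypeR R).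
Local Notation leb := (@lebesgue_measure R).

Lemma lip_ge0meas (g : R -> R) (L : R) : (forall x, 0 <= g x) ->
  (forall x y, g x <= g y + L * `|x - y|) -> ge0meas g.
Proof.
move=> g0 gL; split; last exact: g0.
apply: continuous_measurable_fun => x.
apply/cvgrPdist_le => e e0.
have L1 : 0 < `|L| + 1 by rewrite ltr_wpDl.
near=> y.
have xy : `|x - y| <= e / (`|L| + 1).
  by near: y; apply: cvgr_dist_le => //; rewrite divr_gt0.
have : (`|L| + 1) * `|x - y| <= e by rewrite mulrC -ler_pdivlMr.
have := gL x y; have := gL y x; rewrite (distrC y x).
have := normr_ge0 (x - y); have := ler_norm L; have := ler_norm (- L); rewrite normrN.
move=> h1 h2 h3 h4 h5 h6; rewrite ler_norml; nra.
Unshelve. all: by end_near. Qed.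

Lemma gauss_mean_sum (vs : seq R) (w : R -> R) (F : R -> R -> R) :
  (forall v, 0 <= w v) -> (forall v, ge0meas (F v)) ->
  ge0meas (fun x => \sum_(v <- vs) w v * F v x) /\
  gauss_mean (fun x => \sum_(v <- vs) w v * F v x) = (\sum_(v <- vs) ((w v)%:E * gauss_mean (F v)))%E.
Proof.
move=> w0 mF; elim: vs => [|v vs [mS IH]].
  rewrite big_nil (_ : (fun _ => _) = fun=> 0); last by apply/funext => x; rewrite big_nil.
  by split; [exact: ge0meas_cst|exact: gauss_mean_cst].
rewrite big_cons (_ : (fun x => \sum_(v <- _ :: _) _) =
  (fun x => w v * F v x + \sum_(v <- vs) w v * F v x)); last first.
  by apply/funext => x; rewrite big_cons.
split; first by apply: ge0meas_add => //; exact: ge0meas_scale.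
by rewrite gauss_meanD ?gauss_meanZ ?IH//; exact: ge0meas_scale.
Qed.

Definition rnd (n : nat) (x : R) : R :=
  if `|x| < n%:R then (Num.floor (n%:R * x))%:~R / n%:R else 0.

(** [undup] ensures that a sum over this list meets each value of [rnd] exactly once. *)
Definition rnds (n : nat) : seq R :=
  undup [seq (i%:Z - (n ^ 2)%N%:Z)%:~R / n%:R | i <- iota 0 (2 * n ^ 2).+1].

Lemma rnd_in n x : (0 < n)%N -> rnd n x \in rnds n.
Proof.
move=> n0; rewrite mem_undup; apply/mapP; rewrite /rnd; case: ifPn => xn; last first.
  by exists (n ^ 2)%N; rewrite ?subrr ?mul0r// mem_iota/=; lia.
have nR : 0 < n%:R :> R by rewrite ltr0n.
set k := Num.floor _.
have xb : - (n%:R ^+ 2) <= n%:R * x < n%:R ^+ 2.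
  by move: xn; rewrite ltr_norml => /andP[h1 h2]; apply/andP; split; rewrite expr2; nra.
have nE : ((n ^ 2)%N%:Z)%:~R = n%:R ^+ 2 :> R by rewrite -pmulrn natrX.
have k1 : - (n ^ 2)%N%:Z <= k.
  by rewrite /k floor_ge_int rmorphN/= nE; case/andP: xb.
have k2 : k < (n ^ 2)%N%:Z.
  by rewrite /k floor_lt_int nE; case/andP: xb.
exists (absz (k + (n ^ 2)%N%:Z)).
  by rewrite mem_iota; lia.
by congr (_%:~R / _); lia.
Qed.

(** Rounding down costs at most 1/n where |x| < n; elsewhere the value is replaced by 0 and |x| <=
    x^2 / n. The bound has a finite Gaussian mean of order 1/n. *)
Lemma rnd_err n x : (0 < n)%N -> `|x - rnd n x| <= n%:R^-1 * 1 + n%:R^-1 * x ^+ 2.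
Proof.
move=> n0; have nR : 0 < n%:R :> R by rewrite ltr0n.
rewrite -mulrDr mulrC ler_pdivlMr// mulrC -[X in X * _](ger0_norm (ltW nR)) -normrM.
rewrite /rnd; case: ifPn => xn.
  rewrite mulrBr [X in _ - X]mulrC divfK ?gt_eqF//.
  have := floor_itv (n%:R * x); rewrite intrD => /andP[h1 h2].
  by have := sqr_ge0 x; rewrite ler_norml; move=> h3; lra.
rewrite subr0 normrM (ger0_norm (ltW nR)).
rewrite -leNgt in xn; rewrite -(real_normK (num_real x)).
by rewrite expr2; nra.
Qed.

Lemma measurable_rnd n : measurable_fun [set: mR] (rnd n).
Proof.
apply: measurable_fun_ifT.
- apply: (measurable_fun_ltr (f := fun x : R => `|x|)); first exact: normr_measurable.
  exact: measurable_cst.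
- apply: measurable_funM; last exact: measurable_cst.
  apply: nondecreasing_measurable => //= s r sr.
  by rewrite ler_int le_floor// ler_wpM2l.
- exact: measurable_cst.
Qed.

(** The weights are the Gaussian masses of the fibres of [rnd]. They are chosen before g, so one
    finite measure serves all Lipschitz integrands, with an error proportional to the Lipschitz
    constant. *)
Lemma discretize (e : R) : 0 < e -> exists ps : seq (R * R),
  (forall p, p \in ps -> 0 <= p.1) /\
  forall (g : R -> R) (L : R), 0 <= L -> (forall x, 0 <= g x) ->
    (forall x y, g x <= g y + L * `|x - y|) -> (gauss_mean g < +oo)%E ->
    `|\sum_(p <- ps) p.1 * g p.2 - fine (gauss_mean g)| <= e * L.
Proof.
move=> e0.
pose s2 : R := fine (gauss_mean (fun x : R => x ^+ 2)).
have s2E : gauss_mean (fun x : R => x ^+ 2) = s2%:E.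
  rewrite fineK// ge0_fin_numE ?gauss_mean_sqr_fin//; apply: gauss_mean_ge0; exact: ge0meas_sqr.
have s20 : 0 <= s2 by rewrite -lee_fin -s2E; apply: gauss_mean_ge0; exact: ge0meas_sqr.
have [n0 ne] : exists n0 : nat, n0.+1%:R^-1 * (1 + s2) < e.
  have /ltr_add_invr[k kk] : 0 < e / (1 + s2) by rewrite divr_gt0// ltr_pwDl.
  by exists k; rewrite add0r in kk; rewrite -ltr_pdivlMr// ltr_pwDl.
set n := n0.+1 in ne; have n0' : (0 < n)%N by [].
pose I (v x : R) : R := (rnd n x == v)%:R.
have mI v : ge0meas (I v).
  split => [|x]; last exact: ler0n.
  rewrite /I (_ : (fun _ => _) = \1_(rnd n @^-1` [set v])); last first.
    apply/funext => x; rewrite indicE; congr ((nat_of_bool _)%:R).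
    by apply/eqP/idP => [h|/set_mem//]; apply/mem_set.
  apply: measurable_indic; rewrite -[X in measurable X]setTI.
  by apply: measurable_rnd => //; exact: measurable_set1.
have Ifin v : gauss_mean (I v) \is a fin_num.
  rewrite ge0_fin_numE; last exact: gauss_mean_ge0.
  apply: (@le_lt_trans _ _ 1%E); last exact: ltry.
  rewrite -(gauss_mean_cst ler01); apply: le_gauss_mean; [exact: mI|exact: (ge0meas_cst ler01)|].
  by move=> x; rewrite /I; case: eqP.
exists [seq (fine (gauss_mean (I v)), v) | v <- rnds n]; split.
  by move=> _ /mapP[v _ ->] /=; apply: fine_ge0; exact: gauss_mean_ge0.
move=> g L L0 g0 gL gfin.
have mg := lip_ge0meas g0 gL.
have Eg : (fine (gauss_mean g))%:E = gauss_mean g by rewrite fineK// ge0_fin_numE// gauss_mean_ge0.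
have [mS ES] := gauss_mean_sum (rnds n) g0 mI.
have SE x : \sum_(v <- rnds n) g v * I v x = g (rnd n x).
  rewrite (bigD1_seq (rnd n x)) ?undup_uniq ?rnd_in//= /I eqxx mulr1 big1 ?addr0// => v.
  by move=> vx; rewrite eq_sym (negbTE vx) mulr0.
have PE : (\sum_(p <- [seq (fine (gauss_mean (I v)), v) | v <- rnds n]) p.1 * g p.2)%:E =
   gauss_mean (fun x => g (rnd n x)).
  have <- : (fun x => \sum_(v <- rnds n) g v * I v x) = (fun x => g (rnd n x)).
    by apply/funext => x; rewrite SE.
  rewrite big_map ES -sumEFin; apply: eq_bigr => v _ /=.
  by rewrite EFinM fineK// muleC.
have mgr : ge0meas (fun x => g (rnd n x)).
  by move: mS; congr ge0meas; apply/funext => x; rewrite SE.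
set P := \sum_(p <- _) _ in PE *.
pose err := fun x : R => L * (n%:R^-1 * 1 + n%:R^-1 * x ^+ 2).
have nV : 0 <= n%:R^-1 :> R by rewrite invr_ge0.
have m1 : ge0meas (fun x : R => n%:R^-1 * 1) by apply: ge0meas_cst; rewrite mulr1.
have m2 : ge0meas (fun x : R => n%:R^-1 * x ^+ 2) by apply: ge0meas_scale => //; exact: ge0meas_sqr.
have m12 := ge0meas_add m1 m2.
have merr : ge0meas err by exact: ge0meas_scale.
have Eerr : (gauss_mean err <= (e * L)%:E)%E.
  rewrite /err gauss_meanZ// gauss_meanD// (@gauss_mean_cst _ (n%:R^-1 * 1)) ?mulr1//.
  have -> : gauss_mean (fun x : R => n%:R^-1 * x ^+ 2) = (n%:R^-1 * s2)%:E.
    by rewrite EFinM -s2E; exact: (gauss_meanZ nV ge0meas_sqr).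
  rewrite -EFinD -EFinM lee_fin mulrC ler_wpM2r//.
  by rewrite -[X in X + _]mulr1 -mulrDr ltW.
have h1 : fine (gauss_mean g) <= P + e * L.
  rewrite -lee_fin EFinD PE Eg.
  apply: (@le_trans _ _ (gauss_mean (fun x => g (rnd n x) + err x))).
    apply: le_gauss_mean => //; first exact: ge0meas_add.
    by move=> x; apply: (le_trans (gL x (rnd n x))); rewrite lerD2l ler_wpM2l// rnd_err.
  by rewrite gauss_meanD// leeD2l.
have h2 : P <= fine (gauss_mean g) + e * L.
  rewrite -lee_fin EFinD PE Eg.
  apply: (@le_trans _ _ (gauss_mean (fun x => g x + err x))).
    apply: le_gauss_mean => //; first exact: ge0meas_add.
    move=> x; apply: (le_trans (gL (rnd n x) x)); rewrite lerD2l ler_wpM2l//.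
    by rewrite distrC rnd_err.
  by rewrite gauss_meanD// leeD2l.
by rewrite ler_norml; lra.
Qed.

End discretization.

(** * Balls as limits of zonotopes *)

Section zonotope_directions.
Context {R : realType}.

Lemma dot_rcons_hd n (v : R) (u : 'rV[R]_n) (y : 'rV[R]_n.+1) :
  dot (rcons_hd v u) y = v * y 0 0 + dot u (tl y).
Proof.
rewrite /dot big_ord_recl rcons_hd0; congr (_ + _); apply: eq_bigr => i _.
by rewrite rcons_hdS !mxE.
Qed.

Lemma enorm_tl n (y : 'rV[R]_n.+1) :
  enorm y = Num.sqrt (y 0 0 ^+ 2 + enorm (tl y) ^+ 2).
Proof.
rewrite enorm_sqr /enorm /nsq big_ord_recl; congr (Num.sqrt (_ + _)).
by apply: eq_bigr => i _; rewrite !mxE.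
Qed.

(* A discretized Gaussian vector g: by rotation invariance c + <g, y> is
   Gaussian with variance proportional to |y|^2. The constant c is what makes
   the induction on the dimension work. *)
Lemma gauss_dirs n (e : R) : 0 < e -> exists ws : seq (R * 'rV[R]_n),
  (forall w, w \in ws -> 0 <= w.1) /\
  forall y c, `|\sum_(w <- ws) w.1 * `|c + dot w.2 y| - gauss_abs (enorm y) c| <= e * enorm y.
Proof.
elim: n e => [|n IH] e e0.
  exists [:: (1, 0)]; split; first by move=> w; rewrite inE => /eqP ->.
  move=> y c; have y0 : enorm y = 0 by rewrite /enorm /nsq big_ord0 sqrtr0.
  rewrite y0 gauss_abs0 big_seq1 /dot big_ord0 addr0 mul1r subrr normr0 mulr0//.
have e2 : 0 < e / 2 by lra.
have [ws [ws0 wsP]] := IH _ e2.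
have [ps [ps0 psP]] := discretize e2.
(* A constant function has Lipschitz constant 0, so its discretized mean is exact: the total mass is
   1. *)
have ps1 : \sum_(p <- ps) p.1 = 1.
  have := psP (fun=> 1) 0 (lexx _) (fun=> ler01).
  rewrite gauss_mean_cst//= mulr0 => h.
  have {}h : `|\sum_(p <- ps) p.1 * 1 - 1| <= 0.
    by apply: h => // [x y|]; rewrite ?mul0r ?addr0// ltry.
  by move: h; rewrite normr_le0 subr_eq0 => /eqP <-; apply: eq_bigr => p _; rewrite mulr1.
exists [seq (p.1 * w.1, rcons_hd p.2 w.2) | p <- ps, w <- ws]; split.
  move=> _ /allpairsP[[p w] /= [pp ww ->]] /=.
  by rewrite mulr_ge0 ?ps0 ?ws0.
move=> y c; set a := y 0 0; set r := enorm (tl y).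
rewrite big_allpairs_dep /=.
under eq_bigr => p _.
  under eq_bigr => w _ do rewrite dot_rcons_hd addrA -mulrA.
  rewrite -mulr_sumr; over.
rewrite /=.
pose g s := gauss_abs r (c + s * a).
have gE : gauss_mean g = (gauss_abs (enorm y) c)%:E.
  rewrite enorm_tl -(gauss_mean_stable a c (enorm_ge0 (tl y))); congr gauss_mean; apply/funext => s.
  by rewrite /g mulrC.
(* The error from discretizing the first coordinate; as a function of s, [g] has Lipschitz constant
   |a|. *)
have A1 : `|\sum_(p <- ps) p.1 * g p.2 - gauss_abs (enorm y) c| <= e / 2 * `|a|.
  rewrite -[gauss_abs _ c]/(fine (gauss_abs (enorm y) c)%:E) -gE; apply: psP => //.
  - by move=> x; exact: gauss_abs_ge0.
  - move=> x z; apply: (le_trans (gauss_abs_lip _ _ (c + z * a))); rewrite /g lerD2l.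
    by rewrite (_ : _ - _ = a * (x - z)) ?normrM//; ring.
  - by rewrite gE ltry.
(* The error from the remaining coordinates: the induction hypothesis at the constant c + p.2 a,
   averaged with weights of total mass 1. *)
have A2 : `|\sum_(p <- ps) p.1 * (\sum_(w <- ws) w.1 * `|c + p.2 * a + dot w.2 (tl y)|)
   - \sum_(p <- ps) p.1 * g p.2| <= e / 2 * r.
  rewrite -sumrB; apply: (le_trans (ler_norm_sum _ _ _)).
  have -> : e / 2 * r = \sum_(p <- ps) p.1 * (e / 2 * r) by rewrite -mulr_suml ps1 mul1r.
  rewrite big_seq [leRHS]big_seq; apply: ler_sum => p pp.
  rewrite -mulrBr normrM (ger0_norm (ps0 _ pp)); apply: ler_wpM2l; [exact: ps0|exact: wsP].
have ra : `|a| <= enorm y by exact: coord_le_enorm.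
have rr : r <= enorm y.
  rewrite /r enorm_tl -[leLHS]ger0_norm ?enorm_ge0// -sqrtr_sqr ler_wsqrtr//.
  by rewrite lerDr sqr_ge0.
rewrite -/a; set S1 := \sum_(p <- ps) _ in A2 *; set S2 := \sum_(p <- ps) _ in A1 A2.
have := ler_normD (S1 - S2) (S2 - gauss_abs (enorm y) c).
rewrite addrA subrK => h; apply: (le_trans h).
nra.
Qed.

(* The zonotope spanned by the u's approximates a ball; a perturbation makes
   their first coordinates nonzero, as slicing along the first axis requires. *)
Lemma ball_dirs n (e : R) : 0 < e -> exists us : seq 'rV[R]_n.+1,
  (forall u, u \in us -> u 0 0 != 0) /\
  forall y, `|\sum_(u <- us) `|dot u y| - gauss_abs 1 0 * enorm y| <= e * enorm y.
Proof.
move=> e0; have e2 : 0 < e / 2 by lra.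
have [ws [ws0 wsP]] := gauss_dirs n.+1 e2.
(* At most [size ws] directions are moved, each by d along the first axis, so the total change stays
   below (e / 2) |y|. *)
pose d := e / 2 / (size ws).+1%:R.
have d0 : 0 < d by rewrite divr_gt0.
pose E0 : 'rV[R]_n.+1 := rcons_hd 1 0.
pose fu (w : R * 'rV[R]_n.+1) : 'rV[R]_n.+1 :=
  if w.1 * w.2 0 0 == 0 then w.1 *: w.2 + d *: E0 else w.1 *: w.2.
have dE (y : 'rV[R]_n.+1) : dot E0 y = y 0 0.
  rewrite dot_rcons_hd mul1r /dot big1 ?addr0// => i _.
  by rewrite mxE mul0r.
exists [seq fu w | w <- ws]; split.
  move=> _ /mapP[w _ ->]; rewrite /fu; case: ifPn => h; last by rewrite mxE.
  by rewrite rowDZ rcons_hd0 mxE (eqP h) add0r mulr1 gt_eqF.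
move=> y; rewrite big_map.
have A : `|\sum_(w <- ws) `|dot (fu w) y| - \sum_(w <- ws) w.1 * `|0 + dot w.2 y| | <= e / 2 * enorm y.
  rewrite -sumrB; apply: (le_trans (ler_norm_sum _ _ _)).
  apply: (@le_trans _ _ (\sum_(w <- ws) d * enorm y)).
    rewrite big_seq [leRHS]big_seq; apply: ler_sum => w ww.
    rewrite add0r -[X in X * `|_|]ger0_norm ?ws0// -normrM -dotZl.
    apply: (le_trans (ler_dist_dist _ _)); rewrite /fu; case: ifP => _; last first.
      by rewrite subrr normr0 mulr_ge0 ?enorm_ge0// ltW.
    rewrite dotDl (dotZl d) dE (addrC (dot _ _)) addrK normrM gtr0_norm//.
    by apply: ler_wpM2l; [exact: ltW|exact: coord_le_enorm].
  rewrite big_const_seq count_predT iter_addr_0 -[_ *+ size ws]mulr_natl mulrA ler_wpM2r ?enorm_ge0//.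
  rewrite /d mulrCA ger_pMr// ler_pdivrMr// mul1r ler_nat.
  by [].
have := wsP y 0; rewrite gauss_abs_homo ?enorm_ge0// [enorm y * _]mulrC.
set S1 := \sum_(w <- ws) _ in A *; set S2 := \sum_(w <- ws) _ in A *.
move=> B; have := ler_normD (S1 - S2) (S2 - gauss_abs 1 0 * enorm y).
by rewrite addrA subrK => h; apply: (le_trans h); lra.
Qed.

End zonotope_directions.

(** * Log-convexity of parallel volumes *)

Section logconvex.
Context {R : realType}.
Local Notation mR := (measurableTypeR R).
Local Notation leb := (@lebesgue_measure R).

Lemma vol_ge0 n (A : set 'rV[R]_n) : (0 <= vol A)%E.
Proof. by rewrite volE; apply: itr_ge0 => x; rewrite lee_fin. Qed.

Lemma le_vol n (A B : set 'rV[R]_n) : compact A -> compact B -> A `<=` B ->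
  (vol A <= vol B)%E.
Proof.
move=> cA cB AB; rewrite !volE; apply: le_itr.
- by move=> x; rewrite lee_fin.
- exact: compact_rmeas.
- exact: compact_rmeas.
- move=> x; rewrite lee_fin !indicE ler_nat; case: (boolP (x \in A)) => // /set_mem/AB Bx.
  by rewrite mem_set.
Qed.

Definition box n (M : R) : set 'rV[R]_n := [set x | forall i, - M <= x 0 i <= M].

Lemma compact_box n M : compact (@box n M).
Proof.
have K : compact [set v : 'rV[R]_n | forall i, v ord0 i \in `[- M, M]].
  apply: (@rV_compact _ _ (fun=> `[- M, M]%classic)) => i; exact: segment_compact.
by move: K; congr compact; apply/seteqP; split => x h i; have := h i; rewrite in_itv.
Qed.

Lemma vol_box n M : 0 <= M -> vol (@box n M) = ((2 * M) ^+ n)%:E.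
Proof.
move=> M0; elim: n => [|n IH].
  by rewrite volE /itr /= indicE mem_set ?expr0// => -[].
rewrite volE itr_hd.
transitivity (\int[leb]_x (((2 * M) ^+ n)%:E * (\1_(`[- M, M]%classic : set R) x)%:E))%E.
  apply: eq_integral => x _; rewrite -IH volE muleC -itrZl.
  - congr itr; apply/funext => y; rewrite -EFinM !indicE -natrM mulnb.
    congr ((nat_of_bool _)%:R%:E).
    apply/idP/andP => [/set_mem h|[/set_mem h1 /set_mem h2]].
      split; apply/mem_set.
        by have := h 0; rewrite rcons_hd0 /= in_itv.
      by move=> i; have := h (lift 0 i); rewrite rcons_hdS.
    apply/mem_set => i; case: (unliftP 0 i) => [j ->|->].
      by rewrite rcons_hdS; exact: h2.
    by move: h1; rewrite rcons_hd0 /= in_itv.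
  - by rewrite lee_fin indicE ler0n.
  - by move=> y; rewrite lee_fin indicE ler0n.
  - exact: (compact_rmeas (@compact_box _ _)).
rewrite ge0_integralZl//; last 2 first.
- by apply/measurable_EFinP; exact: measurable_indic.
- by rewrite lee_fin exprn_ge0// mulr_ge0.
rewrite integral_indic//= setIT lebesgue_measure_itv/= lte_fin.
rewrite exprSr EFinM; congr (_ * _)%E.
case: ltP => h; rewrite -?EFinD; congr EFin; lra.
Qed.

Lemma vol_fin n (A : set 'rV[R]_n) : compact A -> vol A \is a fin_num.
Proof.
move=> cA; rewrite ge0_fin_numE ?vol_ge0//.
have [M [_ MA]] := compact_bounded cA.
pose N := `|M| + 1.
have N0 : 0 <= N by rewrite addr_ge0.
apply: (@le_lt_trans _ _ (vol (@box n N))); last by rewrite vol_box// ltry.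
apply: le_vol => //; first exact: compact_box.
move=> x Ax i; rewrite -ler_norml.
have MN : M < N by rewrite (le_lt_trans (ler_norm M))// ltrDl.
apply: le_trans (MA _ MN x Ax).
rewrite [leRHS]/Num.norm/= mx_normrE.
by apply/bigmax_geP; right => /=; exists (0, i).
Qed.

Lemma msumAC n (A B C : set 'rV[R]_n) : msum (msum A B) C = msum (msum A C) B.
Proof.
apply/seteqP; split => x [_ [a Aa [b Bb <-]] [c Cc <-]].
  by exists (a + c); [exists a => //; exists c|exists b => //; rewrite addrAC].
by exists (a + c); [exists a => //; exists c|exists b => //; rewrite addrAC].
Qed.

(** The sum of K and a zonotope. Each segment keeps its own length, so that the volume becomes a
    function of several variables, to be studied in one of them at a time. *)
Fixpoint addsegs n (K : set 'rV[R]_n) (us : seq 'rV[R]_n) (ls : seq R) : set 'rV[R]_n :=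
  match us, ls with
  | u :: us', l :: ls' => addsegs (msum K (seg u l)) us' ls'
  | _, _ => K
  end.

Lemma addsegs_msum n (K L : set 'rV[R]_n) us ls :
  addsegs (msum K L) us ls = msum (addsegs K us ls) L.
Proof. by elim: us ls K => [|u us IH] [|l ls] K //=; rewrite msumAC IH. Qed.

Lemma compact_addsegs n (K : set 'rV[R]_n) us ls : compact K -> compact (addsegs K us ls).
Proof.
elim: us ls K => [|u us IH] [|l ls] K //= cK; apply: IH.
by apply: compact_minkowski => //; exact: compact_seg.
Qed.

Lemma cvx_addsegs n (K : set 'rV[R]_n) us ls : cvx K -> cvx (addsegs K us ls).
Proof.
elim: us ls K => [|u us IH] [|l ls] K //= cK; apply: IH.
by apply: cvx_minkowski => //; exact: cvx_seg.
Qed.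

Lemma addsegs_cat n (K : set 'rV[R]_n) us1 u us2 l1 l l2 : size us1 = size l1 ->
  addsegs K (us1 ++ u :: us2) (l1 ++ l :: l2) =
  msum (addsegs (addsegs K us1 l1) us2 l2) (seg u l).
Proof.
elim: us1 l1 K => [|v us1 IH] [|l1 ls1] K //=.
  by move=> _; rewrite addsegs_msum.
by move=> [sz]; rewrite IH.
Qed.

(** A polynomial of degree at most one in each of N variables that is nonnegative on the orthant;
    its coefficients are then nonnegative. *)
Definition sepaff (N : nat) (f : seq R -> R) : Prop :=
  (forall l, size l = N -> (forall t, t \in l -> 0 <= t) -> 0 <= f l) /\
  (forall l1 l2 s, (size l1 + (size l2).+1)%N = N ->
    (forall t, t \in l1 ++ l2 -> 0 <= t) -> 0 <= s ->
    f (l1 ++ s :: l2) = f (l1 ++ 0 :: l2) + s * (f (l1 ++ 1 :: l2) - f (l1 ++ 0 :: l2))).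

(* Cauchy-Schwarz on the coefficients, one variable at a time. *)
Lemma sepaff_logconvex N f (a b m : R) : sepaff N f ->
  0 <= a -> 0 <= b -> 0 <= m -> m ^+ 2 = a * b ->
  f (nseq N m) ^+ 2 <= f (nseq N a) * f (nseq N b).
Proof.
move=> + a0 b0 m0 mab; elim: N f => [|N IH] f [f0 fa] /=; first by rewrite expr2.
pose g l := f (0 :: l); pose h l := f (1 :: l) - f (0 :: l).
have fE s l : 0 <= s -> size l = N -> (forall t, t \in l -> 0 <= t) ->
    f (s :: l) = g l + s * h l.
  by move=> s0 lN l0; apply: (fa [::] l s) => //=; rewrite add0n lN.
have gP : sepaff N g.
  split=> [l lN l0|l1 l2 s ln l0 s0]; last first.
    apply: (fa (0 :: l1) l2 s) => //=; first by rewrite -ln.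
    by move=> t; rewrite inE => /predU1P[->//|]; exact: l0.
  apply: f0; first by rewrite /= lN.
  by move=> t; rewrite inE => /predU1P[->//|]; exact: l0.
(* If the slope h l were negative, f would take the value -1 at the nonnegative argument (g l + 1) /
   (- h l). *)
have h0 l : size l = N -> (forall t, t \in l -> 0 <= t) -> 0 <= h l.
  move=> lN l0; rewrite leNgt; apply/negP => hl.
  have gl0 : 0 <= g l by exact: gP.1.
  have s0 : 0 <= (g l + 1) / - h l by rewrite divr_ge0 ?addr_ge0// oppr_ge0 ltW.
  have : 0 <= f ((g l + 1) / - h l :: l).
    apply: f0; first by rewrite /= lN.
    by move=> t; rewrite inE => /predU1P[->//|]; exact: l0.
  rewrite fE//.
  have -> : g l + (g l + 1) / - h l * h l = -1 by field; rewrite lt_eqF.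
  by rewrite oppr_ge0 ler10.
have hP : sepaff N h.
  split=> [|l1 l2 s ln l0 s0]; first exact: h0.
  have A c : 0 <= c -> f (c :: (l1 ++ s :: l2)) =
      f (c :: (l1 ++ 0 :: l2)) + s * (f (c :: (l1 ++ 1 :: l2)) - f (c :: (l1 ++ 0 :: l2))).
    move=> c0; apply: (fa (c :: l1) l2 s) => //=; first by rewrite -ln.
    by move=> t; rewrite inE => /predU1P[->//|]; exact: l0.
  by rewrite /h (A 0)// (A 1)//; ring.
have ns (c : R) : 0 <= c -> forall t, t \in nseq N c -> 0 <= t.
  by move=> c0 t /nseqP[-> _].
rewrite !fE ?size_nseq//; try exact: ns.
have := IH _ gP; have := IH _ hP.
have := gP.1 _ (size_nseq N m) (ns _ m0); have := hP.1 _ (size_nseq N m) (ns _ m0).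
have := gP.1 _ (size_nseq N a) (ns _ a0); have := hP.1 _ (size_nseq N a) (ns _ a0).
have := gP.1 _ (size_nseq N b) (ns _ b0); have := hP.1 _ (size_nseq N b) (ns _ b0).
move: (g (nseq N m)) (g (nseq N a)) (g (nseq N b)) => gm ga gb.
move: (h (nseq N m)) (h (nseq N a)) (h (nseq N b)) => hm ha hb.
move=> hb0 gb0 ha0 ga0 hm0 gm0 Hh Hg.
(* In the expanded squares the terms gm^2 and m^2 hm^2 are covered by the induction hypotheses for g
   and h. The cross term is left, and follows from the inequality of means for a ha gb and b hb
   ga. *)
suff X : 2 * m * gm * hm <= a * ha * gb + b * hb * ga.
  have : m ^+ 2 * hm ^+ 2 <= a * b * (ha * hb) by rewrite mab ler_wpM2l// mulr_ge0.
  by rewrite !expr2 in Hh Hg X *; lra.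
have Y0 : 0 <= a * ha * gb + b * hb * ga by rewrite addr_ge0// !mulr_ge0.
rewrite leNgt; apply/negP => lt.
have : (a * ha * gb + b * hb * ga) ^+ 2 < (2 * m * gm * hm) ^+ 2.
  by rewrite ltrXn2r// ?nnegrE// (le_trans Y0)// ltW.
apply/negP; rewrite -leNgt.
apply: (@le_trans _ _ (4 * (a * b) * (ga * gb) * (ha * hb))).
  rewrite !exprMn mab (_ : 2 ^+ 2 = 4); last by ring.
  apply: ler_pM => //; rewrite ?mulr_ge0 ?sqr_ge0//.
  by apply: ler_wpM2l => //; rewrite !mulr_ge0.
have := sqr_ge0 (a * ha * gb - b * hb * ga); rewrite !expr2; lra.
Qed.

Lemma addsegs_sepaff n (K : set 'rV[R]_n.+1) (us : seq 'rV[R]_n.+1) : compact K -> cvx K ->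
  (forall u, u \in us -> u 0 0 != 0) ->
  sepaff (size us) (fun l => fine (vol (addsegs K us l))).
Proof.
move=> cK vK us0; split=> [l _ _|l1 l2 s ln l0 s0].
  by apply: fine_ge0; exact: vol_ge0.
have l1us : (size l1 < size us)%N by rewrite -ln addnS ltnS leq_addr.
pose u := nth 0 us (size l1).
have usE : us = take (size l1) us ++ u :: drop (size l1).+1 us.
  by rewrite -drop_nth// cat_take_drop.
have st : size (take (size l1) us) = size l1 by rewrite size_take l1us.
rewrite usE !addsegs_cat//.
set K' := addsegs _ _ _.
have cK' : compact K' by do 2 apply: compact_addsegs.
have vK' : cvx K' by do 2 apply: cvx_addsegs.
have u0 : u 0 0 != 0 by apply: us0; exact: mem_nth.
have [h h0 hP] := vol_segment cK' vK' u0.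
have fh : h \is a fin_num.
  have cs : compact (msum K' (seg u 1)) by apply: compact_minkowski => //; exact: compact_seg.
  have := vol_fin cs; rewrite hP// mul1e fin_numD => /andP[_ ->//].
rewrite !hP// -(fineK fh) -(fineK (vol_fin cK')) -!EFinM -!EFinD /=; ring.
Qed.

Lemma addsegs_supp n (K : set 'rV[R]_n) us r x :
  addsegs K us (nseq (size us) r) x -> exists2 k, K k &
  exists2 z, x = k + z & forall y, dot z y <= r * \sum_(u <- us) `|dot u y|.
Proof.
elim: us K => [|u us IH] K /=.
  move=> Kx; exists x => //; exists 0; first by rewrite addr0.
  by move=> y; rewrite big_nil mulr0 /dot big1// => i _; rewrite mxE mul0r.
case/IH => _ [k Kk [_ [c + <-] <-]] [z -> zP]; rewrite /= in_itv/= -ler_norml => cr.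
exists k => //; exists (c *: u + z); first by rewrite addrA.
move=> y; rewrite dotDl big_cons mulrDr; apply: lerD => //; rewrite dotZl.
by rewrite (le_trans (ler_norm _))// normrM ler_wpM2r.
Qed.

Lemma addsegs_supp_ge n us r y : 0 <= r ->
  exists2 z, addsegs [set (0 : 'rV[R]_n)] us (nseq (size us) r) z &
    r * \sum_(u <- us) `|dot u y| <= dot z y.
Proof.
move=> r0; elim: us => [|u us [z Zz zP]] /=.
  by exists 0 => //; rewrite big_nil mulr0 /dot big1// => i _; rewrite mxE mul0r.
pose c := if 0 <= dot u y then r else - r.
exists (z + c *: u).
  rewrite addsegs_msum; exists z => //; exists (c *: u) => //; exists c => //=.
  by rewrite in_itv/= /c; case: ifP => _; lra.
rewrite big_cons mulrDr dotDl addrC; apply: lerD => //; rewrite dotZl /c.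
have [h|h] := boolP (0 <= dot u y); first by rewrite ger0_norm.
by rewrite ltr0_norm ?ltNge// mulrN mulNr.
Qed.

(** Let p be the point of Z nearest to y and q = y - p. Then <q, z - p> <= 0 on Z, so rho |q| <= <p,
    q> = <y, q> - |q|^2 <= rho |q| - |q|^2, which forces q = 0. *)
Lemma nearest_point_mem n (Z : set 'rV[R]_n) rho y : compact Z -> cvx Z -> Z !=set0 ->
  (forall q, exists2 z, Z z & rho * enorm q <= dot z q) ->
  enorm y <= rho -> Z y.
Proof.
move=> cZ vZ Z0 sZ yr.
have cont : continuous (fun z : 'rV[R]_n => nsq (y + (-1) *: z)).
  apply: continuous_sum_row => i.
  rewrite (_ : (fun _ => _) = (fun t : 'rV[R]_n => (y 0 i + (-1) * t 0 i) * (y 0 i + (-1) * t 0 i))); last first.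
    by apply/funext => t; rewrite rowDZ expr2.
  have c1 : continuous (fun t : 'rV[R]_n => y 0 i + (-1) * t 0 i).
    apply: continuous_add; first exact: cst_continuous.
    by apply: continuous_mul; [exact: cst_continuous|exact: continuous_coord].
  exact: continuous_mul.
have [p /set_mem Zp pmin] := compact_EVT_min Z0 cZ (continuous_subspaceT cont).
set q := y + (-1) *: p in pmin.
have qz z : Z z -> dot q (z - p) <= 0.
  move=> Zz; rewrite leNgt; apply/negP => d0.
  have gauss_abs t : 0 <= t <= 1 -> 2 * t * dot q (z - p) <= t ^+ 2 * nsq (z - p).
    move=> t01.
    have := pmin (t *: z + (1 - t) *: p) (mem_set (vZ _ _ Zz Zp _ t01)).
    have -> : y + (-1) *: (t *: z + (1 - t) *: p) = (- t) *: (z - p) + q.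
      by apply/rowP => i; rewrite !mxE; ring.
    rewrite (nsqD _ q) nsqZ dotZl sqrrN (dotC (z - p)); lra.
  have n0 := nsq_ge0 (z - p).
  have dn : 0 < dot q (z - p) + nsq (z - p) by rewrite ltr_pwDl.
  (* For this t, t |z - p|^2 is smaller than <q, z - p>, which contradicts the minimality inequality
     just proved, divided by t. *)
  have [t [t0 t1 tE]] : exists t, [/\ 0 < t, t <= 1 & t * (dot q (z - p) + nsq (z - p)) = dot q (z - p)].
    exists (dot q (z - p) / (dot q (z - p) + nsq (z - p))); split.
    - by rewrite divr_gt0.
    - by rewrite ler_pdivrMr// mul1r lerDl.
    - by rewrite divfK// gt_eqF.
  have t01 : 0 <= t <= 1 by rewrite ltW.
  have := gauss_abs _ t01; rewrite expr2 (mulrC 2) -!mulrA ler_pM2l//.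
  by have := mulr_gt0 t0 d0; move: tE; rewrite mulrDr; lra.
have [z Zz zq] := sZ q.
have := qz z Zz; rewrite dotC dotDl => h1.
have pE : - p = q + (-1) *: y by apply/rowP => i; rewrite !mxE; ring.
rewrite pE dotDl dotxx dotZl in h1.
have h2 := dot_le y q.
have h3 : enorm y * enorm q <= rho * enorm q by rewrite ler_wpM2r ?enorm_ge0.
have q0 : q = 0 by apply: nsq_eq0; apply/eqP; rewrite eq_le nsq_ge0 andbT; lra.
suff -> : y = p by [].
by apply/eqP; rewrite -subr_eq0 -scaleN1r -/q q0.
Qed.

Lemma addsegs_set0 n (K : set 'rV[R]_n) us ls :
  addsegs K us ls = msum K (addsegs [set 0] us ls).
Proof.
have -> : K = msum [set 0] K.
  apply/seteqP; split => x; first by exists 0 => //; exists x => //; rewrite add0r.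
  by case=> _ -> [y Ky <-]; rewrite add0r.
rewrite addsegs_msum; apply/seteqP; split => x.
  case=> z Zz [k Kk <-]; exists k; last by exists z => //; rewrite addrC.
  by exists 0 => //; exists k => //; rewrite add0r.
case=> _ [_ -> [k Kk <-]] [z Zz <-]; exists z => //; exists k => //.
by rewrite add0r addrC.
Qed.

Lemma minkowski_subr n (A B C : set 'rV[R]_n) : B `<=` C -> msum A B `<=` msum A C.
Proof. by move=> BC x [a Aa [b Bb <-]]; exists a => //; exists b => //; exact: BC. Qed.

(** The zonotope attains r \sum |<u, y>| >= r (m - e) |y| in every direction y, so its support
    function dominates that of the ball; the nearest-point argument turns this into inclusion. *)
Lemma ball_sub_addsegs n (K : set 'rV[R]_n) us (m e r : R) : 0 <= r ->
  (forall y, `|\sum_(u <- us) `|dot u y| - m * enorm y| <= e * enorm y) ->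
  msum K (eball n (r * (m - e))) `<=` addsegs K us (nseq (size us) r).
Proof.
move=> r0 usP; rewrite addsegs_set0; apply: minkowski_subr => y yr.
have cs : compact [set (0 : 'rV[R]_n)] by exact: compact_set1.
apply: (@nearest_point_mem _ _ (r * (m - e))) => //.
- exact: compact_addsegs.
- apply: cvx_addsegs => _ _ -> -> l _; rewrite !scaler0 addr0//.
- by have [z Zz _] := addsegs_supp_ge us 0 r0; exists z.
- move=> q; have [z Zz zq] := addsegs_supp_ge us q r0; exists z => //.
  apply: le_trans zq; rewrite -mulrA ler_wpM2l//.
  by have := usP q; rewrite ler_norml; lra.
Qed.

(** Pairing a point z of the zonotope with itself gives |z|^2 <= r \sum |<u, z>| <= r (m + e)
    |z|. *)
Lemma addsegs_sub_ball n (K : set 'rV[R]_n) us (m e r : R) : 0 <= r -> 0 <= m + e ->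
  (forall y, `|\sum_(u <- us) `|dot u y| - m * enorm y| <= e * enorm y) ->
  addsegs K us (nseq (size us) r) `<=` msum K (eball n (r * (m + e))).
Proof.
move=> r0 me0 usP x /addsegs_supp[k Kk [z -> zP]]; exists k => //; exists z => //.
apply/eballE; have [->|z0] := eqVneq (enorm z) 0.
  by rewrite mulr_ge0.
have zp : 0 < enorm z by rewrite lt_def z0 enorm_ge0.
rewrite -(ler_pM2r zp) -expr2 enorm_sqr -dotxx (le_trans (zP z))// -mulrA ler_wpM2l//.
by have := usP z; rewrite ler_norml; lra.
Qed.

(** A zonotope with equal lengths lies between two balls whose radii have ratio k, so the inequality
    for zonotopes gives f(M)^2 <= f(a k) f(b k). Continuity of f lets k decrease to 1; in the
    application f is a Steiner polynomial. *)
Lemma vol_ball_logconvex n (K : set 'rV[R]_n.+1) (f : R -> R) (a b : R) :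
  compact K -> cvx K -> continuous f ->
  (forall r, 0 <= r -> vol (msum K (eball n.+1 r)) = (f r)%:E) ->
  0 < a -> 0 < b -> f (Num.sqrt (a * b)) ^+ 2 <= f a * f b.
Proof.
move=> cK vK cf fE a0 b0; set M := Num.sqrt _.
have M0 : 0 < M by rewrite sqrtr_gt0 mulr_gt0.
have M2 : M ^+ 2 = a * b by rewrite sqr_sqrtr// mulr_ge0// ltW.
have f0 r : 0 <= r -> 0 <= f r by move=> r0; rewrite -lee_fin -fE// vol_ge0.
have key k : 1 < k -> f M ^+ 2 <= f (a * k) * f (b * k).
  move=> k1.
  have m0 := @gauss_abs1_gt0 R; set m := gauss_abs 1 0 in m0.
  (* The solution of m + e = k (m - e), the ratio of the outer to the inner radius. *)
  pose e := m * (k - 1) / (k + 1).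
  have e0 : 0 < e by rewrite divr_gt0 ?mulr_gt0//; lra.
  have em : m - e = 2 * m / (k + 1) by rewrite /e; field; lra.
  have em0 : 0 < m - e by rewrite em divr_gt0 ?mulr_gt0//; lra.
  have ke : m + e = k * (m - e) by rewrite em /e; field; lra.
  have [us [us0 usP]] := ball_dirs n e0.
  have sa := addsegs_sepaff cK vK us0.
  pose V c := fine (vol (addsegs K us (nseq (size us) c))).
  have low c : 0 <= c -> f c <= V (c / (m - e)).
    move=> c0; rewrite -lee_fin -fE// fineK; last by apply/vol_fin/compact_addsegs.
    apply: le_vol; [by apply: compact_minkowski => //; exact: compact_eball|exact: compact_addsegs|].
    rewrite -[in X in X `<=` _](divfK (lt0r_neq0 em0) c).
    by apply: ball_sub_addsegs => //; rewrite divr_ge0 ?(ltW em0).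
  have up c : 0 <= c -> V (c / (m - e)) <= f (c * k).
    move=> c0; have ck : 0 <= c * k by rewrite mulr_ge0//; lra.
    rewrite -lee_fin -fE// fineK; last by apply/vol_fin/compact_addsegs.
    apply: le_vol; [exact: compact_addsegs|by apply: compact_minkowski => //; exact: compact_eball|].
    have -> : c * k = c / (m - e) * (m + e) by rewrite ke; field; rewrite gt_eqF.
    by apply: addsegs_sub_ball => //; [rewrite divr_ge0 ?(ltW em0)|lra].
  have V0 c : 0 <= V c by apply: fine_ge0; exact: vol_ge0.
  have em0' : 0 <= (m - e)^-1 by rewrite invr_ge0 ltW.
  apply: (@le_trans _ _ (V (M / (m - e)) ^+ 2)).
    by rewrite lerXn2r ?nnegrE ?f0 ?low// ltW.
  apply: (@le_trans _ _ (V (a / (m - e)) * V (b / (m - e)))); last first.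
    by apply: ler_pM => //; apply: up; exact: ltW.
  apply: (sepaff_logconvex sa); rewrite ?mulr_ge0 ?(ltW a0) ?(ltW b0) ?(ltW M0)//.
  by rewrite expr_div_n M2 expr2 mulf_div.
rewrite leNgt; apply/negP => lt.
pose g k := f (a * k) * f (b * k).
have cg : continuous g.
  apply: continuous_mul => x.
    apply: (@continuous_comp _ _ _ (fun k => a * k) f); last exact: cf.
    by apply: mulrl_continuous.
  apply: (@continuous_comp _ _ _ (fun k => b * k) f); last exact: cf.
  by apply: mulrl_continuous.
have g1 : g 1 < f M ^+ 2 by rewrite /g !mulr1.
have nb : \forall k \near 1^'+, g k < f M ^+ 2.
  have gc : g k @[k --> (1:R)^'+] --> g 1 by apply: cvg_at_right_filter; exact: cg.
  exact: (cvgr_lt _ gc).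
have : \forall k \near (1 : R)^'+, False.
  near=> k.
  have k1 : 1 < k by near: k; exact: nbhs_right_gt.
  have : g k < f M ^+ 2 by near: k; exact: nb.
  by rewrite ltNge key.
by move/filter_ex => -[].
Unshelve. all: by end_near. Qed.

End logconvex.

(** * The Wills functional *)

Section layer_cake.
Context {R : realType}.
Local Notation mR := (measurableTypeR R).
Local Notation leb := (@lebesgue_measure R).

Lemma itint_prod_le m n (f g h : seq R -> \bar R) :
  (forall s, 0 <= f s)%E -> (forall s, 0 <= g s)%E -> (forall s, 0 <= h s)%E ->
  tmeas (m + n) f -> tmeas m g -> tmeas n h ->
  (forall s t, size s = m -> size t = n -> f (s ++ t) <= g s * h t)%E ->
  (itint (m + n) f <= itint m g * itint n h)%E.
Proof.
move=> f0 g0 h0 mf mg mh fgh.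
have mc := tmeas_cat mf.
rewrite itint_cat muleC -itintZl//; last exact: itint_ge0.
apply: le_itint.
- by move=> s; exact: itint_ge0.
- by move=> s; rewrite mule_ge0// itint_ge0.
- by apply: (@measurable_itint _ _ (m.-tuple mR)).
- by apply: measurable_funeM.
- move=> s sm; rewrite muleC -itintZl//.
  have mst : tmeas n (fun t => f (s ++ t)).
    by have := pmeas_sec (Tuple (introT eqP sm) : m.-tuple mR) mc.
  apply: le_itint => //.
  + by move=> t; rewrite mule_ge0.
  + exact: measurable_funeM.
  + by move=> t tn; exact: fgh.
Qed.

Lemma itint_prod_ge m n (f g h : seq R -> \bar R) :
  (forall s, 0 <= f s)%E -> (forall s, 0 <= g s)%E -> (forall s, 0 <= h s)%E ->
  tmeas (m + n) f -> tmeas m g -> tmeas n h ->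
  (forall s t, size s = m -> size t = n -> g s * h t <= f (s ++ t))%E ->
  (itint m g * itint n h <= itint (m + n) f)%E.
Proof.
move=> f0 g0 h0 mf mg mh fgh.
have mc := tmeas_cat mf.
rewrite itint_cat muleC -itintZl//; last exact: itint_ge0.
apply: le_itint.
- by move=> s; rewrite mule_ge0// itint_ge0.
- by move=> s; exact: itint_ge0.
- by apply: measurable_funeM.
- by apply: (@measurable_itint _ _ (m.-tuple mR)).
- move=> s sm; rewrite muleC -itintZl//.
  have mst : tmeas n (fun t => f (s ++ t)).
    by have := pmeas_sec (Tuple (introT eqP sm) : m.-tuple mR) mc.
  apply: le_itint => //.
  + by move=> t; rewrite mule_ge0.
  + exact: measurable_funeM.
  + by move=> t tn; exact: fgh.
Qed.

Definition prodset m n (A : set 'rV[R]_m) (B : set 'rV[R]_n) : set 'rV[R]_(m + n) :=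
  [set row_mx x y | x in A & y in B].

Lemma compact_prodset m n (A : set 'rV[R]_m) (B : set 'rV[R]_n) :
  compact A -> compact B -> compact (prodset A B).
Proof.
move=> cA cB.
rewrite (_ : prodset A B = (fun p => row_mx p.1 p.2) @` (A `*` B)).
  apply: continuous_compact; last exact: compact_setX.
  apply: continuous_subspaceT; apply: continuous_row => i.
  case: (split_ordP i) => j ->.
    rewrite (_ : (fun _ => _) = (fun p : 'rV[R]_m * 'rV[R]_n => p.1 0 j)); last first.
      by apply/funext => p; rewrite row_mxEl.
    by move=> p; apply: (@continuous_comp _ _ _ fst (fun x : 'rV[R]_m => x 0 j)); [exact: cvg_fst|exact: continuous_coord].
  rewrite (_ : (fun _ => _) = (fun p : 'rV[R]_m * 'rV[R]_n => p.2 0 j)); last first.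
    by apply/funext => p; rewrite row_mxEr.
  by move=> p; apply: (@continuous_comp _ _ _ snd (fun x : 'rV[R]_n => x 0 j)); [exact: cvg_snd|exact: continuous_coord].
apply/seteqP; split => x.
  by case=> a Aa [b Bb <-]; exists (a, b).
by case=> -[a b] [/= Aa Bb] <-; exists a => //; exists b.
Qed.

Lemma vol_prodset_le m n (A : set 'rV[R]_m) (B : set 'rV[R]_n) (D : set 'rV[R]_(m + n)) :
  compact A -> compact B -> compact D -> prodset A B `<=` D ->
  (vol A * vol B <= vol D)%E.
Proof.
move=> cA cB cD ABD; rewrite !volE; apply: itint_prod_ge.
- by move=> s; rewrite lee_fin.
- by move=> s; rewrite lee_fin.
- by move=> s; rewrite lee_fin.
- exact: compact_rmeas.
- exact: compact_rmeas.
- exact: compact_rmeas.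
- move=> s t sm tn; rewrite rv_cat// -EFinM lee_fin !indicE -natrM mulnb ler_nat.
  case: andP => // -[/set_mem a /set_mem b]; rewrite mem_set//; apply: ABD.
  by exists (rv m s) => //; exists (rv n t).
Qed.

Definition d2 n (K : set 'rV[R]_n) (x : 'rV[R]_n) : R := inf [set nsq (x - k) | k in K].

Section distance.
Variables (n : nat) (K : set 'rV[R]_n).
Hypotheses (cK : compact K) (K0 : K !=set0).

Lemma d2_le x k : K k -> d2 K x <= nsq (x - k).
Proof.
move=> Kk; apply: ge_inf; last by exists k.
by exists 0 => _ [z _ <-]; exact: nsq_ge0.
Qed.

Lemma d2_min x : exists2 k, K k & d2 K x = nsq (x - k).
Proof.
have cont : continuous (fun z : 'rV[R]_n => nsq (x - z)).
  apply: continuous_sum_row => i.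
  rewrite (_ : (fun _ => _) = (fun t : 'rV[R]_n => (x 0 i + (-1) * t 0 i) * (x 0 i + (-1) * t 0 i))); last first.
    by apply/funext => t; rewrite !mxE expr2 mulN1r.
  have c1 : continuous (fun t : 'rV[R]_n => x 0 i + (-1) * t 0 i).
    apply: continuous_add; first exact: cst_continuous.
    by apply: continuous_mul; [exact: cst_continuous|exact: continuous_coord].
  exact: continuous_mul.
have [p /set_mem Kp pmin] := compact_EVT_min K0 cK (continuous_subspaceT cont).
exists p => //; apply/eqP; rewrite eq_le d2_le//=.
apply: lb_le_inf; first by exists (nsq (x - p)), p.
by move=> _ [z Kz <-]; apply: pmin; rewrite inE.
Qed.

Lemma d2_ge0 x : 0 <= d2 K x.
Proof. by have [k _ ->] := d2_min x; exact: nsq_ge0. Qed.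

Lemma msum_eballP r x : msum K (eball n r) x <-> Num.sqrt (d2 K x) <= r.
Proof.
split=> [[k Kk [z zr <-]]|].
  apply: le_trans zr; rewrite ler_wsqrtr//.
  by apply: (le_trans (d2_le _ Kk)); rewrite addrC addKr.
have [k Kk ->] := d2_min x => xr; exists k => //; exists (x - k) => //.
by rewrite addrC subrK.
Qed.

(** For c >= 0 the set where the squared distance exceeds c is the complement of a compact parallel
    body, hence open. *)
Lemma measurable_d2 : measurable_fun [set: n.-tuple mR] (fun t => d2 K (rv n (tval t))).
Proof.
apply: (measurability _ (RGenOInfty.measurableE R)) => // _ [_ [c ->] <-].
rewrite setTI; have [c0|c0] := ltP c 0.
  rewrite (_ : _ @^-1` _ = setT)//; apply/seteqP; split => // t _ /=.
  by rewrite in_itv/= andbT (lt_le_trans c0)// d2_ge0.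
apply: (@measurable_rv_open _ n [set x | `]c, +oo[%classic (d2 K x)]).
rewrite (_ : mkset _ = ~` msum K (eball n (Num.sqrt c))).
  apply: closed_openC; apply: compact_closed; first exact: norm_hausdorff.
  by apply: compact_minkowski => //; exact: compact_eball.
apply/seteqP; split => x /=; rewrite in_itv/= andbT.
  by move=> cx /msum_eballP; rewrite ler_sqrt// leNgt cx.
by move=> h; rewrite ltNge; apply/negP => xc; apply/h/msum_eballP; rewrite ler_wsqrtr.
Qed.

(** For S_n and b = e^(2t) this is W_n(t). *)
Definition wills (b : R) : \bar R := itr (fun x => (expR (- (pi * b * d2 K x)))%:E).

(* Minus the derivative of exp (- pi b r^2) on r >= 0, and 0 for r < 0. *)
Definition kb (b r : R) : R := 2 * pi * b * Num.max r 0 * expR (- (pi * b * r ^+ 2)).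

Lemma kb_ge0 b r : 0 <= b -> 0 <= kb b r.
Proof.
move=> b0; rewrite /kb !mulr_ge0 ?pi_ge0 ?expR_ge0//.
by rewrite le_max lexx orbT.
Qed.

Lemma measurable_kb b : measurable_fun [set: mR] (kb b).
Proof.
apply: measurable_funM.
  apply: measurable_funM; first exact: measurable_cst.
  exact: measurable_maxr.
apply: measurableT_comp => //; apply: measurableT_comp => //.
by apply: measurable_funM => //; exact: exprn_measurable.
Qed.

Lemma continuous_kb_exp (b : R) : continuous (fun r : R => expR (- (pi * b * r ^+ 2))).
Proof.
move=> r; apply: (@continuous_comp _ _ _ (fun r : R => - (pi * b * r ^+ 2)) expR).
  apply: cvgN; apply: cvgM; first exact: cvg_cst.
  exact: exprn_continuous.
exact: continuous_expR.
Qed.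

Lemma integral_kb_tail (b d : R) : 0 < b -> 0 <= d ->
  (\int[leb]_(r in `[d, +oo[) (kb b r)%:E = (expR (- (pi * b * d ^+ 2)))%:E)%E.
Proof.
move=> b0 d0.
pose F (r : R) := - expR (- (pi * b * r ^+ 2)).
have FD (x : R) : is_derive x 1 F (2 * pi * b * x * expR (- (pi * b * x ^+ 2))).
  rewrite /F; apply: is_derive_eq; rewrite /GRing.scale/=.
  by set A := expR _; ring.
rewrite (@ge0_continuous_FTC2y _ (kb b) F d 0).
- by rewrite /F sub0e -EFinN opprK.
- by move=> x _; apply: kb_ge0; exact: ltW.
- apply: continuous_subspaceT; apply: continuous_mul; last exact: continuous_kb_exp.
  apply: continuous_mul; first exact: cst_continuous.
  by move=> x; apply: continuous_max; [exact: cvg_id|exact: cvg_cst].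
- rewrite /F -oppr0; apply: cvgN.
  apply: (@cvg_comp _ _ _ (fun r : R => r ^+ 2) (fun x => expR (- (pi * b * x))) _ (pinfty_nbhs R)).
    exact: cvgr_expr2.
  apply: (@cvg_comp _ _ _ (fun z => pi * b * z) (fun x => expR (- x)) _ (pinfty_nbhs R)); last exact: cvgr_expR.
  have pb : 0 < pi * b by rewrite mulr_gt0 ?pi_gt0.
  exact: gt0_cvgMry.
- by move=> x _; exact: (@ex_derive _ _ _ _ _ _ _ (FD x)).
- apply: cvg_at_right_filter; apply: cvgN; exact: continuous_kb_exp.
- move=> x; rewrite in_itv/= andbT => dx.
  rewrite derive1E (@derive_val _ _ _ _ _ _ _ (FD x)) /kb.
  by rewrite max_l// (le_trans d0)// ltW.
Qed.

Lemma layer_cake (b : R) : 0 < b ->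
  (\int[leb]_r (vol (msum K (eball n r)) * (kb b r)%:E) = wills b)%E.
Proof.
move=> b0; have kb0 r := kb_ge0 r (ltW b0).
pose S (s : seq R) : set R := `[Num.sqrt (d2 K (rv n s)), +oo[%classic.
pose J (r : mR) (s : seq R) : \bar R := ((kb b r)%:E * (\1_(S s) r)%:E)%E.
have J0 r s : (0 <= J r s)%E by rewrite mule_ge0 ?lee_fin.
have mS : measurable [set p : mR * n.-tuple mR | S (tval p.2) p.1].
  pose g (p : mR * n.-tuple mR) := p.1 - Num.sqrt (d2 K (rv n (tval p.2))).
  have mg : measurable_fun setT g.
    apply: measurable_funB; first exact: measurable_fst.
    have msq : measurable_fun [set: mR] (@Num.sqrt R).
      by apply: continuous_measurable_fun; exact: sqrt_continuous.
    apply: (measurableT_comp msq).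
    exact: (measurableT_comp measurable_d2 measurable_snd).
  rewrite (_ : mkset _ = g @^-1` `[0, +oo[%classic); last first.
    by apply/seteqP; split => p; rewrite /S /g /= !in_itv/= !andbT subr_ge0.
  by rewrite -[X in measurable X]setTI; apply: mg => //; exact: measurable_itv.
have mJ : pmeas n J.
  apply: emeasurable_funM.
    apply/measurable_EFinP; exact: (measurableT_comp (measurable_kb b) measurable_fst).
  apply/measurable_EFinP.
  rewrite (_ : (fun _ => _) = \1_([set p : mR * n.-tuple mR | S (tval p.2) p.1])).
    exact: measurable_indic.
  apply/funext => p; rewrite !indicE; congr ((nat_of_bool _)%:R).
transitivity (\int[leb]_r itint n (J r))%E.
  apply: eq_integral => r _; rewrite volE muleC -itrZl.
  - apply: eq_itint => s _; rewrite /J; congr (_ * _)%E; rewrite !indicE.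
    congr ((nat_of_bool _)%:R%:E).
    apply/idP/idP => /set_mem; rewrite /S /= ?in_itv/= ?andbT.
      by move=> /msum_eballP h; apply/mem_set; rewrite /= in_itv/= andbT.
    by move=> h; apply/mem_set/msum_eballP.
  - by rewrite lee_fin.
  - by move=> x; rewrite lee_fin.
  - apply: compact_rmeas; apply: compact_minkowski => //; exact: compact_eball.
rewrite -(itint_swap leb)//; apply: eq_itint => s _.
rewrite -[RHS](_ : (expR (- (pi * b * Num.sqrt (d2 K (rv n s)) ^+ 2)))%:E = _); last first.
  by rewrite sqr_sqrtr// d2_ge0.
rewrite -integral_kb_tail ?sqrtr_ge0// -/(S s) [RHS]integral_mkcond.
apply: eq_integral => r _; rewrite /J patchE indicE.
by case: ifP => _; rewrite ?mule1 ?mule0.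
Qed.

End distance.

Lemma d2_set0 n (x : 'rV[R]_n) : d2 [set 0] x = nsq x.
Proof.
have c0 : compact [set (0 : 'rV[R]_n)] by exact: compact_set1.
have n0 : [set (0 : 'rV[R]_n)] !=set0 by exists 0.
by have [k -> ->] := d2_min c0 n0 x; rewrite subr0.
Qed.

Lemma integral_exp_sqr (b : R) : 0 < b ->
  (\int[leb]_x (expR (- (pi * b * x ^+ 2)))%:E = ((Num.sqrt b)^-1)%:E)%E.
Proof.
move=> b0; have pi0 := @pi_gt0 R.
have s0 : 0 < Num.sqrt (pi * b) by rewrite sqrtr_gt0 mulr_gt0.
have mg : measurable_fun [set: mR] (fun x : mR => (gauss_fun x)%:E).
  by apply/measurable_EFinP; exact: measurable_gauss_fun.
have := ge0_integral_affine 0 s0 mg (fun x => gauss_fun_ge0 x).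
rewrite integralT_gauss -EFinM sqrtrM ?ltW// invfM mulrAC mulVf ?mul1r; last first.
  by rewrite gt_eqF// sqrtr_gt0.
move=> <-; apply: eq_integral => x _; congr EFin.
by rewrite /gauss_fun addr0 exprMn exprMn !sqr_sqrtr// ltW.
Qed.

Lemma wills_set0 n (b : R) : 0 < b -> wills [set (0 : 'rV[R]_n)] b = ((Num.sqrt b) ^- n)%:E.
Proof.
move=> b0; elim: n => [|n IH].
  by rewrite /wills /itr /= d2_set0 /nsq big_ord0 mulr0 oppr0 expR0 expr0 invr1.
rewrite /wills itr_hd.
transitivity (\int[leb]_x ((Num.sqrt b ^- n)%:E * (expR (- (pi * b * x ^+ 2)))%:E))%E.
  apply: eq_integral => x _; rewrite -IH /wills muleC -itrZl.
  - congr itr; apply/funext => y; rewrite -EFinM !d2_set0; congr EFin.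
    rewrite -expRD; congr expR.
    rewrite /nsq big_ord_recl rcons_hd0; under eq_bigr do rewrite rcons_hdS.
    by ring.
  - by rewrite lee_fin expR_ge0.
  - by move=> y; rewrite lee_fin expR_ge0.
  - apply/measurable_EFinP; apply: measurableT_comp => //; apply: measurableT_comp => //.
    apply: measurable_funM; first exact: measurable_cst.
    apply: measurable_d2; [exact: compact_set1|by exists 0].
rewrite ge0_integralZl//; last first.
  apply/measurable_EFinP; apply: continuous_measurable_fun; exact: continuous_kb_exp.
by rewrite integral_exp_sqr// -EFinM -invfM -exprSr.
Qed.

Lemma vol_eballZ n (r : R) : 0 < r -> vol (@eball R n r) = ((r ^+ n)%:E * vol (@eball R n 1))%E.
Proof.
move=> r0; rewrite !volE.
have mb := compact_rmeas (@compact_eball R n 1).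
have r1 : 0 < r^-1 by rewrite invr_gt0.
have b0 (x : 'rV[R]_n) : (0 <= (\1_(eball n 1) x)%:E :> \bar R)%E by rewrite lee_fin.
have := itr_aff 0 r1 b0 mb; rewrite exprVn invrK => <-.
congr itr; apply/funext => x; rewrite !indicE; congr ((nat_of_bool _)%:R%:E).
have E : eball n r x <-> eball n 1 (r^-1 *: x + 0).
  have E : enorm (r^-1 *: x + 0) = enorm x / r by rewrite addr0 enormZ gtr0_norm// mulrC.
  by split=> /eballE h; apply/eballE; move: h; rewrite E ler_pdivrMr// mul1r.
by apply/idP/idP => /set_mem/E h; apply/mem_set.
Qed.

Definition eps (j : nat) : R := fine (vol (@eball R j 1)).

Lemma epsE j : vol (@eball R j 1) = (eps j)%:E.
Proof. by rewrite fineK// vol_fin//; exact: compact_eball. Qed.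

Lemma eps_ge0 j : 0 <= eps j.
Proof. by apply: fine_ge0; exact: vol_ge0. Qed.

Definition moment (b : R) (j : nat) : \bar R := (\int[leb]_r (r ^+ j * kb b r)%:E)%E.

Lemma mkb_ge0 (b : R) j r : 0 <= b -> 0 <= r ^+ j * kb b r.
Proof.
move=> b0; have [r0|r0] := leP 0 r; first by rewrite mulr_ge0 ?exprn_ge0 ?kb_ge0.
by rewrite /kb max_r ?(ltW r0)// mulr0 mul0r mulr0.
Qed.

Lemma measurable_mkb (b : R) j : measurable_fun [set: mR] (fun r => r ^+ j * kb b r).
Proof. by apply: measurable_funM; [exact: exprn_measurable|exact: measurable_kb]. Qed.

(** This is the layer-cake formula for the body {0}, whose parallel volumes are eps_j r^j and whose
    Gaussian integral factorizes. It is the reason for the weight [kb]: its moments cancel the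
    unit-ball volumes in Steiner's formula. *)
Lemma eps_moment (b : R) j : 0 < b ->
  ((eps j)%:E * moment b j = ((Num.sqrt b)^-1 ^+ j)%:E)%E.
Proof.
move=> b0; rewrite exprVn -wills_set0// -layer_cake//; last 2 first.
- exact: compact_set1.
- by exists 0.
rewrite /moment -ge0_integralZl//; last 3 first.
- by apply/measurable_EFinP; exact: measurable_mkb.
- by move=> r _; rewrite lee_fin mkb_ge0// ltW.
- by rewrite lee_fin eps_ge0.
apply: eq_integral => r _.
have [r0|r0] := leP r 0; first by rewrite /kb max_r// mulr0 mul0r mulr0 !mule0.
have -> : msum [set 0] (eball j r) = eball j r.
  apply/seteqP; split => x; first by case=> _ -> [y yr <-]; rewrite add0r.
  by move=> xr; exists 0 => //; exists x => //; rewrite add0r.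
by rewrite vol_eballZ// epsE -!EFinM; congr EFin; ring.
Qed.

Lemma eps_gt0 j : 0 < eps j.
Proof.
rewrite lt_def eps_ge0 andbT; apply/eqP => e0.
have := eps_moment j ltr01; rewrite e0 mul0e sqrtr1 invr1 expr1n => /eqP.
by rewrite eqe eq_sym oner_eq0.
Qed.

Lemma momentE (b : R) j : 0 < b -> moment b j = ((Num.sqrt b)^-1 ^+ j / eps j)%:E.
Proof.
move=> b0; rewrite EFinM -eps_moment// muleAC -EFinM mulfV ?mul1e//.
by rewrite gt_eqF// eps_gt0.
Qed.

Lemma integral_poly_kb (b : R) n (c : nat -> R) : 0 < b ->
  (\int[leb]_r ((\sum_(j < n) c j * r ^+ j) * kb b r)%:E =
    (\sum_(j < n) c j * ((Num.sqrt b)^-1 ^+ j / eps j))%:E)%E.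
Proof.
move=> b0.
have im j : leb.-integrable setT (fun r : mR => (r ^+ j * kb b r)%:E).
  apply/integrableP; split; first by apply/measurable_EFinP; exact: measurable_mkb.
  under eq_integral do rewrite /= ger0_norm ?mkb_ge0 ?(ltW b0)//.
  by rewrite -/(moment b j) momentE// ltry.
transitivity (\int[leb]_r (\sum_(j < n) ((c j)%:E * (r ^+ j * kb b r)%:E)))%E.
  apply: eq_integral => r _; rewrite mulr_suml -sumEFin; apply: eq_bigr => j _.
  by rewrite -EFinM -mulrA.
rewrite (@integral_sum _ _ _ leb setT measurableT _ (fun (j : 'I_n) r => ((c j)%:E * (r ^+ j * kb b r)%:E)%E)).
  rewrite -sumEFin; apply: eq_bigr => j _.
  by rewrite integralZl// -/(moment b j) momentE// -EFinM.
by move=> j; apply: integrableZl.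
Qed.

End layer_cake.

(** * Geometry of the constraint sets *)

Section Sset_geometry.
Context {R : realType}.
Variables (sigma rho : R).
Hypotheses (sigma_gt0 : 0 < sigma) (rho_gt0 : 0 < rho).

Definition ssq n (x : 'rV[R]_n) (k l : nat) : R :=
  \sum_(i < n | (k <= i < l)%N) x 0 i ^+ 2.

Local Notation K := (Sset sigma rho).

Lemma ssq_ge0 n (x : 'rV[R]_n) k l : 0 <= ssq x k l.
Proof. by apply: sumr_ge0 => i _; exact: sqr_ge0. Qed.

Lemma compact_Sset n : compact (K n).
Proof.
(* Windows of length one give x_i^2 <= sigma + rho, hence |x_i| <= sigma + rho + 1. *)
apply: (@bounded_compact _ _ _ (sigma + rho + 1)).
  rewrite (_ : K n = \bigcap_(p in [set p : nat * nat | (p.1 < p.2 <= n)%N])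
     [set x | ssq x p.1 p.2 <= sigma + (p.2 - p.1)%:R * rho]); last first.
    apply/seteqP; split => x H.
      by move=> [k l] /= /andP[kl ln]; exact: H.
    by move=> k l kl ln; apply: (H (k, l)); rewrite /= kl ln.
  apply: closed_bigI => -[k l] _; apply: closed_le_fun.
  apply: continuous_sum_row => i.
  rewrite (_ : (fun _ => _) = (fun t : 'rV[R]_n => t 0 i * t 0 i)); last by apply/funext.
  by apply: continuous_mul; exact: continuous_coord.
move=> x Kx i; have := Kx i i.+1 (ltnSn _) (ltn_ord i).
rewrite (big_pred1 i) ?subSnn ?mul1r; last first.
  by move=> j /=; rewrite ltnS -eqn_leq eq_sym.
rewrite -(real_normK (num_real _)) => h; have := normr_ge0 (x 0 i).
by move: h; rewrite expr2; nra.
Qed.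

Lemma cvx_Sset n : cvx (K n).
Proof.
move=> x y Kx Ky l /andP[l0 l1] a b ab bn.
have h1 := Kx a b ab bn; have h2 := Ky a b ab bn.
apply: (@le_trans _ _ (l * ssq x a b + (1 - l) * ssq y a b)).
  rewrite !mulr_sumr -big_split; apply: ler_sum => i _ /=; rewrite !mxE.
  have := sqr_ge0 (x 0 i - y 0 i); rewrite !expr2 => h.
  have : 0 <= l * (1 - l) by rewrite mulr_ge0// subr_ge0.
  by nra.
rewrite /ssq; nra.
Qed.

Lemma Sset0 n : K n 0.
Proof.
move=> k l kl ln; rewrite big1 ?addr_ge0 ?mulr_ge0 ?(ltW sigma_gt0) ?(ltW rho_gt0)//.
by move=> i _; rewrite mxE expr0n.
Qed.

Lemma count_ord n k l : \sum_(i < n | (k <= i < l)%N) (1 : R) = (minn l n - k)%:R.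
Proof.
elim: n => [|n IH]; first by rewrite big_ord0 minn0.
rewrite big_mkcond big_ord_recr -big_mkcond/= IH; case: ifPn => h; rewrite -?natr1.
  by rewrite natr1; congr (_%:R); lia.
by rewrite ?addr0; congr (_%:R); lia.
Qed.

Lemma ssq_box n (z : 'rV[R]_n) d k l : box d z -> ssq z k l <= (minn l n - k)%:R * d ^+ 2.
Proof.
move=> zd; rewrite -count_ord mulr_suml; apply: ler_sum => i _; rewrite mul1r.
by have := zd i; rewrite -ler_norml => h; rewrite -(real_normK (num_real _)) lerXn2r// nnegrE (le_trans _ h).
Qed.

Lemma box_Sset n d : d ^+ 2 <= rho -> box d `<=` K n.
Proof.
move=> dr x xd k l kl ln; apply: (le_trans (ssq_box k l xd)).
rewrite (minn_idPl ln).
have : (l - k)%:R * d ^+ 2 <= (l - k)%:R * rho by rewrite ler_wpM2l.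
by have := sigma_gt0; lra.
Qed.

(** Truncated subtraction clips the window to the second block, so windows starting inside the first
    block need no separate case. *)
Lemma ssq_row m n (x : 'rV[R]_m) (y : 'rV[R]_n) k l :
  ssq (row_mx x y) k l = ssq x k l + ssq y (k - m) (l - m).
Proof.
rewrite /ssq big_split_ord /=; congr (_ + _).
  by apply: eq_bigr => i _; rewrite row_mxEl.
apply: eq_big => [i|i _]; last by rewrite row_mxEr.
lia.
Qed.

(** Arbitrary k and l are allowed, the window being clipped to the n coordinates. The indicator
    records that an empty clipped window spends no sigma. *)
Lemma ssq_Sset n (x : 'rV[R]_n) k l : K n x ->
  ssq x k l <= sigma * (k < minn l n)%:R + (minn l n - k)%:R * rho.
Proof.
move=> Kx.
have -> : ssq x k l = ssq x k (minn l n).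
  by apply: eq_bigl => i; have := ltn_ord i; lia.
have [kl|kl] := ltnP k (minn l n); first by rewrite mulr1; apply: Kx => //; exact: geq_minr.
rewrite (_ : ssq _ _ _ = 0); first by rewrite mulr0 add0r mulr_ge0// ltW.
by rewrite /ssq big_pred0// => i; lia.
Qed.

Lemma Sset_split m n (x : 'rV[R]_m) (y : 'rV[R]_n) : K (m + n) (row_mx x y) -> K m x /\ K n y.
Proof.
move=> Kxy; split=> k l kl ln.
  have := Kxy k l kl (leq_trans ln (leq_addr _ _)).
  rewrite -/(ssq _ k l) ssq_row; apply: le_trans.
  by rewrite lerDl ssq_ge0.
have ml : (m + k < m + l)%N by rewrite ltn_add2l.
have mln : (m + l <= m + n)%N by rewrite leq_add2l.
have := Kxy _ _ ml mln; rewrite -/(ssq _ (m + k) (m + l)) ssq_row !addKn subnDl.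
by apply: le_trans; rewrite lerDr ssq_ge0.
Qed.

(** The critical window meets both outer blocks. It then covers the whole middle block, where at
    most p rho / 2 of the allowed p rho is used; the saved p rho / 2 >= sigma pays for the second
    sigma. *)
Lemma Sset_join m p n (x : 'rV[R]_m) (z : 'rV[R]_p) (y : 'rV[R]_n) d :
  d ^+ 2 = rho / 2 -> 2 * sigma <= p%:R * rho ->
  K m x -> box d z -> K n y -> K (m + p + n) (row_mx (row_mx x z) y).
Proof.
move=> d2 ps Kx zd Ky k l kl ln.
rewrite -/(ssq _ k l) !ssq_row.
have h1 := ssq_Sset k l Kx.
have h2 := ssq_box (k - m) (l - m) zd.
have h3 := ssq_Sset (k - (m + p)) (l - (m + p)) Ky.
rewrite d2 in h2.
have := lerD (lerD h1 h2) h3; move=> h; apply: (le_trans h) => {h h1 h2 h3}.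
have cnt : ((minn l m - k) + (minn (l - m) p - (k - m)) +
  (minn (l - (m + p)) n - (k - (m + p))))%N = (l - k)%N by lia.
rewrite -cnt !natrD; have r0 := ltW rho_gt0; have s0 := ltW sigma_gt0.
set cA := (minn l m - k)%N; set cB := (minn (l - (m + p)) n - (k - (m + p)))%N.
have [A|A] := boolP (k < minn l m)%N; have [B|B] := boolP (k - (m + p) < minn (l - (m + p)) n)%N.
- have -> : (minn (l - m) p - (k - m))%N = p by move: A B; lia.
  by rewrite !mulr1; nra.
- rewrite !mulr1 !mulr0.
  have : 0 <= (minn (l - m) p - (k - m))%:R * rho by rewrite mulr_ge0.
  by lra.
- rewrite !mulr1 !mulr0.
  have : 0 <= (minn (l - m) p - (k - m))%:R * rho by rewrite mulr_ge0.
  by lra.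
- rewrite !mulr0.
  have : 0 <= (minn (l - m) p - (k - m))%:R * rho by rewrite mulr_ge0.
  by lra.
Qed.

Lemma nsq_row m n (x : 'rV[R]_m) (y : 'rV[R]_n) : nsq (row_mx x y) = nsq x + nsq y.
Proof.
rewrite /nsq big_split_ord /=; congr (_ + _); apply: eq_bigr => i _.
  by rewrite row_mxEl.
by rewrite row_mxEr.
Qed.

(** The middle block is not displaced, so the squared displacements of the outer blocks add up. *)
Lemma vol_superadd m p n d r1 r2 :
  0 <= d -> d ^+ 2 = rho / 2 -> 2 * sigma <= p%:R * rho -> 0 <= r1 -> 0 <= r2 ->
  (vol (msum (K m) (eball m r1)) * ((2 * d) ^+ p)%:E * vol (msum (K n) (eball n r2)) <=
   vol (msum (K (m + p + n)) (eball (m + p + n) (Num.sqrt (r1 ^+ 2 + r2 ^+ 2)))))%E.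
Proof.
move=> d0 dE ps r10 r20.
have cV q r : compact (msum (K q) (eball q r)).
  by apply: compact_minkowski; [exact: compact_Sset|exact: compact_eball].
rewrite -(vol_box p d0).
have cP : compact (prodset (msum (K m) (eball m r1)) (@box R p d)).
  by apply: compact_prodset => //; exact: compact_box.
apply: (@le_trans _ _ (vol (prodset (msum (K m) (eball m r1)) (@box R p d)) *
   vol (msum (K n) (eball n r2)))%E).
  apply: lee_wpmul2r; first exact: vol_ge0.
  by apply: vol_prodset_le => //; exact: compact_box.
apply: vol_prodset_le => // _ [_ [_ [x Kx [u ur <-]] [z zd <-]] [_ [y Ky [v vr <-]] <-]].
exists (row_mx (row_mx x z) y); first exact: (Sset_join dE ps).
exists (row_mx (row_mx u 0) v); last by rewrite !add_row_mx addr0.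
apply/eballE; rewrite /enorm !nsq_row ler_wsqrtr//.
have -> : nsq (0 : 'rV[R]_p) = 0 by rewrite /nsq big1// => i _; rewrite mxE expr0n.
rewrite addr0 -!enorm_sqr; apply: lerD; rewrite lerXn2r// ?nnegrE ?enorm_ge0//.
Qed.

Lemma wills_submul m n b : 0 < b ->
  (wills (K (m + n)) b <= wills (K m) b * wills (K n) b)%E.
Proof.
move=> b0.
have K0 q : K q !=set0 by exists 0; exact: Sset0.
have mw q : tmeas q (fun s => (expR (- (pi * b * d2 (K q) (rv q s))))%:E).
  apply/measurable_EFinP; apply: measurableT_comp => //; apply: measurableT_comp => //.
  apply: measurable_funM; first exact: measurable_cst.
  by apply: measurable_d2 => //; exact: compact_Sset.
apply: itint_prod_le.
- by move=> s; rewrite lee_fin expR_ge0.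
- by move=> s; rewrite lee_fin expR_ge0.
- by move=> s; rewrite lee_fin expR_ge0.
- exact: mw.
- exact: mw.
- exact: mw.
- move=> s t sm tn; rewrite rv_cat// -EFinM lee_fin -expRD ler_expR -opprD lerN2 -mulrDr.
  rewrite ler_wpM2l//; first by rewrite mulr_ge0 ?pi_ge0// ltW.
  have [w Kw ->] := d2_min (@compact_Sset (m + n)) (K0 _) (row_mx (rv m s) (rv n t)).
  move: Kw; rewrite -[w]hsubmxK => /Sset_split[K1 K2].
  by rewrite opp_row_mx add_row_mx nsq_row; apply: lerD; exact: d2_le.
Qed.

Lemma wills_ge n b : 0 < b -> (((Num.sqrt b) ^- n)%:E <= wills (K n) b)%E.
Proof.
move=> b0; rewrite -wills_set0//.
have K0 : K n !=set0 by exists 0; exact: Sset0.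
apply: le_itr.
- by move=> s; rewrite lee_fin expR_ge0.
- apply/measurable_EFinP; apply: measurableT_comp => //; apply: measurableT_comp => //.
  apply: measurable_funM; first exact: measurable_cst.
  by apply: measurable_d2; [exact: compact_set1|by exists 0].
- apply/measurable_EFinP; apply: measurableT_comp => //; apply: measurableT_comp => //.
  apply: measurable_funM; first exact: measurable_cst.
  by apply: measurable_d2 => //; exact: compact_Sset.
- move=> x; rewrite lee_fin ler_expR lerN2 ler_wpM2l//.
    by rewrite mulr_ge0 ?pi_ge0// ltW.
  by rewrite d2_set0 -[X in nsq X]subr0; apply: d2_le; exact: Sset0.
Qed.

Lemma wills_chernoff n b r : 0 < b -> 0 <= r ->
  (vol (msum (K n) (eball n r)) * (expR (- (pi * b * r ^+ 2)))%:E <= wills (K n) b)%E.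
Proof.
move=> b0 r0.
have K0 : K n !=set0 by exists 0; exact: Sset0.
have cV : compact (msum (K n) (eball n r)).
  by apply: compact_minkowski; [exact: compact_Sset|exact: compact_eball].
have e0 : (0 <= (expR (- (pi * b * r ^+ 2)))%:E :> \bar R)%E by rewrite lee_fin expR_ge0.
have i0 (x : 'rV[R]_n) : (0 <= (\1_(msum (K n) (eball n r)) x)%:E :> \bar R)%E by rewrite lee_fin.
rewrite volE muleC -itrZl//; last exact: compact_rmeas.
apply: le_itr.
- by move=> s; rewrite mule_ge0.
- by apply: measurable_funeM; exact: compact_rmeas.
- apply/measurable_EFinP; apply: measurableT_comp => //; apply: measurableT_comp => //.
  apply: measurable_funM; first exact: measurable_cst.
  by apply: measurable_d2 => //; exact: compact_Sset.
- move=> x; rewrite -EFinM lee_fin indicE; case: (boolP (x \in _)) => [/set_mem|_]; last first.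
    by rewrite mulr0 expR_ge0.
  move=> /(msum_eballP (@compact_Sset n) K0) h; rewrite mulr1 ler_expR lerN2 ler_wpM2l//.
    by rewrite mulr_ge0 ?pi_ge0// ltW.
  rewrite -(sqr_sqrtr (d2_ge0 (@compact_Sset n) K0 x)) lerXn2r// nnegrE//.
Qed.

End Sset_geometry.

(** * Subadditive sequences and convexity *)

Section real_analysis.
Context {R : realType}.

Lemma fekete (a : nat -> R) (C : R) :
  (forall m n, (1 <= m)%N -> (1 <= n)%N -> a (m + n)%N <= a m + a n) ->
  (forall n, (1 <= n)%N -> C * n%:R <= a n) ->
  exists l, (forall n, (1 <= n)%N -> l <= a n / n%:R) /\
    (fun n => a n / n%:R) @ \oo --> l.
Proof.
move=> sub aC.
pose A := [set a n / n%:R | n in [set n | (1 <= n)%N]].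
have A0 : A !=set0 by exists (a 1%N / 1); exists 1%N.
have nR n : (1 <= n)%N -> 0 < n%:R :> R by rewrite ltr0n.
have lbA : has_lbound A.
  by exists C => _ [n n1 <-]; rewrite ler_pdivlMr ?nR// aC.
have lA n : (1 <= n)%N -> inf A <= a n / n%:R by move=> n1; apply: ge_inf => //; exists n.
exists (inf A); split=> //.
apply/cvgrPdist_le => e e0.
have e2 : 0 < e / 2 by lra.
have [_ [m m1 <-] mlt] := inf_adherent e2 (conj A0 lbA).
pose M := \sum_(i < m.+1) `|a i|.
have M0 : 0 <= M by apply: sumr_ge0.
have aM r : (r <= m)%N -> a r <= M.
  move=> rm; apply: (le_trans (ler_norm _)).
  rewrite /M (bigD1 (Ordinal (rm : (r < m.+1)%N)))//= lerDl.
  by apply: sumr_ge0.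
have mul q r : (1 <= r)%N -> a (q * m + r)%N <= q%:R * a m + a r.
  move=> r1; elim: q => [|q IH]; first by rewrite mul0n add0n mul0r add0r.
  rewrite mulSn -addnA; apply: (le_trans (sub _ _ m1 _)); first lia.
  by rewrite -natr1 mulrDl mul1r; lra.
have [N NP] : exists N : nat, 2 * (`|a m| + M) / e < N%:R.
  exists (Num.truncn (2 * (`|a m| + M) / e)).+1; exact: truncnS_gt.
near=> n.
have n1 : (1 <= n)%N by near: n; exists 1%N.
have nN : (N <= n)%N by near: n; exists N.
rewrite ler_norml; apply/andP; split; last by have := lA n n1; lra.
suff : a n / n%:R <= inf A + e by lra.
(* The remainder r ranges over 1..m rather than 0..m-1, since nothing is assumed about a 0. *)
have nE : n = ((n.-1 %/ m) * m + (n.-1 %% m).+1)%N.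
  by rewrite addnS -divn_eq prednK.
set q := (n.-1 %/ m)%N in nE; set r := (n.-1 %% m).+1 in nE.
have rm : (r <= m)%N by rewrite /r ltn_mod.
have := mul q r isT; rewrite -nE => h.
have h2 : a n / n%:R <= a m / m%:R + (`|a m| + M) / n%:R.
  rewrite ler_pdivrMr ?nR// mulrDl divfK ?gt_eqF ?nR//.
  apply: (le_trans h).
  have -> : q%:R * a m = a m / m%:R * n%:R - a m / m%:R * r%:R.
    rewrite [in n%:R]nE natrD natrM; field; rewrite gt_eqF ?nR//.
  have : - (a m / m%:R * r%:R) <= `|a m|.
    apply: (le_trans (ler_norm _)); rewrite normrN !normrM normfV !normr_nat.
    rewrite -mulrA ler_piMr// mulrC ler_pdivrMr ?nR// mul1r ler_nat//.
  by have := aM r rm; lra.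
have h3 : (`|a m| + M) / n%:R <= e / 2.
  rewrite ler_pdivrMr ?nR//.
  have : N%:R <= n%:R :> R by rewrite ler_nat.
  move: NP; rewrite ltr_pdivrMr// => h4 h5; have := ler_wpM2r (ltW e0) h5; lra.
by lra.
Unshelve. all: by end_near. Qed.

(** If f s > f t for some s < t, midpoint convexity makes each step to the left of length t - s
    raise f by at least f s - f t, and f would be unbounded on the negative half-line. *)
Lemma midpoint_nondecreasing (f : R -> R) (C : R) :
  (forall s t, f ((s + t) / 2) <= (f s + f t) / 2) ->
  (forall t, t <= 0 -> f t <= C) ->
  forall s t, s <= t -> f s <= f t.
Proof.
move=> mid bd s t; rewrite le_eqVlt => /predU1P[->//|st].
rewrite leNgt; apply/negP => fst.
pose h := t - s; pose x (k : nat) := t - k%:R * h.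
have inc k : f s - f t <= f (x k.+1) - f (x k).
  elim: k => [|k IH].
    by rewrite /x mul0r mul1r subr0 /h subKr.
  have := mid (x k) (x k.+2).
  have -> : (x k + x k.+2) / 2 = x k.+1 by rewrite /x -!natr1; field.
  lra.
have grow k : f t + k%:R * (f s - f t) <= f (x k).
  elim: k => [|k IH]; first by rewrite mul0r addr0 /x mul0r subr0.
  have -> : k.+1%:R * (f s - f t) = k%:R * (f s - f t) + (f s - f t).
    by rewrite -natr1 mulrDl mul1r.
  by rewrite addrA; apply: (le_trans (lerD IH (inc k))); rewrite addrC subrK.
have d0 : 0 < f s - f t by rewrite subr_gt0.
have h0 : 0 < h by rewrite subr_gt0.
pose k := (Num.truncn ((C - f t) / (f s - f t)) + Num.truncn (t / h)).+1.
have k1 : (C - f t) / (f s - f t) < k%:R.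
  by apply: (lt_le_trans (truncnS_gt _)); rewrite ler_nat /k ltnS leq_addr.
have k2 : t / h < k%:R.
  by apply: (lt_le_trans (truncnS_gt _)); rewrite ler_nat /k ltnS leq_addl.
have := grow k; rewrite ltr_pdivrMr// in k1; rewrite ltr_pdivrMr// in k2.
have : f (x k) <= C by apply: bd; rewrite /x; lra.
lra.
Qed.

(** Points with d > 0 have slope b / d at most that of points with d < 0: otherwise a combination
    with positive integer coefficients would land in the forbidden quadrant d < 0 < b. Any beta
    between the two families of slopes works, and the supremum of the first is taken. *)
Lemma semigroup_separation (Q : R -> R -> Prop) :
  (forall d1 b1 d2 b2, Q d1 b1 -> Q d2 b2 -> Q (d1 + d2) (b1 + b2)) ->
  (forall d b, Q d b -> d < 0 -> b <= 0) ->
  (exists d b, Q d b /\ d < 0) ->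
  exists2 beta, 0 <= beta & forall d b, Q d b -> b <= beta * d.
Proof.
move=> Qadd Qneg [d0 [b0 [Q0 d00]]].
have Qmul k d b : Q d b -> Q (k.+1%:R * d) (k.+1%:R * b).
  move=> Qdb; elim: k => [|k IH]; first by rewrite !mul1r.
  by rewrite -(natr1 k.+1) !mulrDl !mul1r; exact: Qadd.
have cross d1 b1 d2 b2 : Q d1 b1 -> Q d2 b2 -> 0 <= d1 -> d2 < 0 -> b1 * - d2 <= - b2 * d1.
  move=> Q1 Q2 d10 d20; have b20 := Qneg _ _ Q2 d20.
  rewrite leNgt; apply/negP => lt.
  have b10 : 0 < b1.
    have : 0 < b1 * - d2 by apply: le_lt_trans lt; rewrite mulr_ge0// oppr_ge0.
    by rewrite pmulr_lgt0// oppr_gt0.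
  (* a rational strictly between -b2/b1 and -d2/d1, written k1/k2 *)
  have [k1 [k2 [A B]]] : exists k1 k2 : nat,
      k1.+1%:R * d1 < k2.+1%:R * - d2 /\ k2.+1%:R * - b2 < k1.+1%:R * b1.
    pose g := b1 * - d2 - - b2 * d1; have g0 : 0 < g by rewrite subr_gt0.
    pose k2 := Num.truncn ((b1 * d1 + b1 * d1) / g).
    have k2P : (b1 * d1 + b1 * d1) < k2.+1%:R * g.
      by rewrite -ltr_pdivrMr//; exact: truncnS_gt.
    exists (Num.truncn (k2.+1%:R * - b2 / b1)), k2.
    set x := k2.+1%:R * - b2 / b1; have xE : k2.+1%:R * - b2 = x * b1.
      by rewrite /x divfK// gt_eqF.
    have x0 : 0 <= x by rewrite /x divr_ge0 ?(ltW b10)// mulr_ge0// oppr_ge0.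
    have t1 := truncnS_gt x; have t2 := truncn_le x.
    rewrite x0 in t2.
    split; last by rewrite xE ltr_pM2r.
    have h : (Num.truncn x).+1%:R <= x + 1 by rewrite -natr1; lra.
    have h' : (Num.truncn x).+1%:R * d1 <= (x + 1) * d1 by rewrite ler_wpM2r.
    apply: (le_lt_trans h').
    rewrite -(ltr_pM2l b10).
    have : b1 * ((x + 1) * d1) = k2.+1%:R * (- b2 * d1) + b1 * d1.
      by rewrite mulrA mulrA xE; ring.
    move=> ->; have : 0 <= b1 * d1 by rewrite mulr_ge0// ltW.
    by move: k2P; rewrite /g; lra.
  have := Qneg _ _ (Qadd _ _ _ _ (Qmul k1 _ _ Q1) (Qmul k2 _ _ Q2)).
  move=> /(_ _) H.
  have : k1.+1%:R * b1 + k2.+1%:R * b2 <= 0 by apply: H; lra.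
  lra.
(* Including 0 makes the set nonempty and its supremum nonnegative. *)
pose A := [set z | z = 0 \/ exists d b, [/\ Q d b, 0 < d & z = b / d]].
have A0 : A !=set0 by exists 0; left.
have Aub d2 b2 : Q d2 b2 -> d2 < 0 -> ubound A (b2 / d2).
  move=> Q2 d20 z [->|[d [b [Qdb dp ->]]]].
    by rewrite mulr_le0 ?invr_le0 ?(ltW d20)//; exact: Qneg Q2 d20.
  have := cross _ _ _ _ Qdb Q2 (ltW dp) d20 => h.
  rewrite ler_pdivrMr// -[b2 / d2]mulrNN -invrN mulrAC ler_pdivlMr ?oppr_gt0//.
have supA : has_sup A by split=> //; exists (b0 / d0); exact: Aub.
exists (sup A).
  by apply: ub_le_sup; [case: supA|left].
move=> d b Qdb; have [dn|dp|dz] := ltgtP d 0.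
- have : sup A <= b / d by apply: ge_sup => //; exact: Aub.
  by rewrite ler_ndivlMr.
- have : b / d <= sup A.
    by apply: ub_le_sup; [case: supA|right; exists d, b].
  by rewrite ler_pdivrMr.
- have := cross _ _ _ _ Qdb Q0; rewrite dz lexx mulr0 => /(_ isT d00).
  by rewrite pmulr_lle0 ?oppr_gt0// mulr0.
Qed.

End real_analysis.

(** * Duality *)

Section duality.
Context {R : realType}.
Variables (w : R -> R) (c0 C1 C2 : R).
Hypothesis w_mid : forall s t, w ((s + t) / 2) <= (w s + w t) / 2.
Hypothesis w_geN : forall t, - t <= w t.
Hypothesis w_ge : forall t, c0 <= w t.
Hypothesis w_left : forall t, t <= 0 -> t + w t <= C1.
Hypothesis w_right : forall t, 0 <= t -> w t <= C2.

Definition cost (nu t : R) : R := w t + pi * nu * expR (2 * t).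
(** The function D of the overview. *)
Definition rate (nu : R) : R := inf [set cost nu t | t in [set: R]].

Lemma cost_ge nu t : 0 <= nu -> c0 <= cost nu t.
Proof.
by move=> nu0; rewrite /cost (le_trans (w_ge t))// lerDl !mulr_ge0 ?pi_ge0 ?expR_ge0.
Qed.

Lemma rate_le nu t : 0 <= nu -> rate nu <= cost nu t.
Proof.
move=> nu0; apply: ge_inf; last by exists t.
by exists c0 => _ [s _ <-]; exact: cost_ge.
Qed.

Lemma rate_ge nu c : (forall t, c <= cost nu t) -> c <= rate nu.
Proof.
move=> h; apply: lb_le_inf; first by exists (cost nu 0), 0.
by move=> _ [t _ <-].
Qed.

Lemma rate_near nu e : 0 <= nu -> 0 < e -> exists t, cost nu t < rate nu + e.
Proof.
move=> nu0 e0.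
have hi : has_inf [set cost nu t | t in [set: R]].
  split; first by exists (cost nu 0), 0.
  by exists c0 => _ [s _ <-]; exact: cost_ge.
by have [_ [t _ <-] h] := inf_adherent e0 hi; exists t.
Qed.

Lemma rate_mono nu nu' : 0 <= nu -> nu <= nu' -> rate nu <= rate nu'.
Proof.
move=> nu0 nn; apply: rate_ge => t; apply: (le_trans (rate_le t nu0)).
by rewrite /cost lerD2l ler_wpM2r ?expR_ge0// ler_wpM2l ?pi_ge0.
Qed.

(** An infimum of functions affine in nu is concave. Chords issuing from 0 are enough to bound
    [rate] from below just left of x. *)
Lemma rate_concave0 nu x : 0 <= nu -> nu <= x -> 0 < x ->
  (1 - nu / x) * rate 0 + nu / x * rate x <= rate nu.
Proof.
move=> nu0 nx x0; apply: rate_ge => t.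
have h0 := rate_le t (lexx 0); have hx := rate_le t (ltW x0).
have l0 : 0 <= nu / x by rewrite divr_ge0// ltW.
have l1 : 0 <= 1 - nu / x by rewrite subr_ge0 ler_pdivrMr// mul1r.
have -> : cost nu t = (1 - nu / x) * cost 0 t + nu / x * cost x t.
  by rewrite /cost; field; rewrite gt_eqF.
by apply: lerD; apply: ler_wpM2l.
Qed.

(** A nearly optimal t at nu provides an affine majorant of [rate] that is e-close at nu, which
    gives upper semicontinuity, also at 0. *)
Lemma rate_up nu e : 0 <= nu -> 0 < e -> exists2 c, 0 < c &
  forall y, 0 <= y -> rate y <= rate nu + e + c * (y - nu).
Proof.
move=> nu0 e0; have [t ht] := rate_near nu0 e0.
exists (pi * expR (2 * t)); first by rewrite mulr_gt0 ?pi_gt0 ?expR_gt0.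
move=> y y0; apply: (le_trans (rate_le t y0)).
have : cost y t = cost nu t + pi * expR (2 * t) * (y - nu) by rewrite /cost; ring.
lra.
Qed.

Lemma rate_continuous : {within `[0, +oo[, continuous rate}.
Proof.
apply/continuous_within_itvcyP; split.
  move=> x; rewrite in_itv/= andbT => x0.
  apply/cvgrPdist_le => e e0.
  have e2 : 0 < e / 2 by lra.
  have [c cp cP] := rate_up (ltW x0) e2.
  pose d := rate x - rate 0.
  have d0 : 0 <= d by rewrite subr_ge0 rate_mono// ltW.
  near=> y.
  have y0 : 0 < y by near: y; exact: lt_nbhsr.
  have xy1 : `|x - y| <= e / 2 / c.
    by near: y; apply: cvgr_dist_le => //; rewrite divr_gt0.
  have xy2 : `|x - y| <= e * x / (d + 1).
    by near: y; apply: cvgr_dist_le => //; rewrite divr_gt0 ?mulr_gt0// ltr_wpDl.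
  have up := cP y (ltW y0).
  have u2 : c * (y - x) <= e / 2.
    have : y - x <= e / 2 / c by apply: le_trans xy1; rewrite distrC ler_norm.
    by rewrite ler_pdivlMr// mulrC.
  have low : rate x - e <= rate y.
    have [xy|yx] := leP x y; first by have := rate_mono (ltW x0) xy; lra.
    have := rate_concave0 (ltW y0) (ltW yx) x0.
    have -> : (1 - y / x) * rate 0 + y / x * rate x = rate x - (x - y) / x * d.
      by rewrite /d; field; rewrite gt_eqF.
    apply: le_trans; rewrite lerD2l lerN2.
    have : x - y <= e * x / (d + 1) by apply: le_trans xy2; rewrite ler_norm.
    rewrite ler_pdivlMr ?ltr_wpDl// => h.
    rewrite mulrAC ler_pdivrMr//; apply: le_trans h.
    by rewrite ler_wpM2l ?subr_ge0 ?(ltW yx)// lerDl.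
  by rewrite ler_norml; lra.
apply/cvgrPdist_le => e e0.
have e2 : 0 < e / 2 by lra.
have [c cp cP] := rate_up (lexx 0) e2.
near=> y.
have y0 : 0 < y by near: y; exact: nbhs_right_gt.
have yc : y < e / 2 / c by near: y; apply: nbhs_right_lt; rewrite divr_gt0.
have up := cP y (ltW y0); have low := rate_mono (lexx 0) (ltW y0).
rewrite ltr_pdivlMr// in yc.
by rewrite ler_norml; lra.
Unshelve. all: by end_near. Qed.

Lemma w_nonincreasing s t : s <= t -> w t <= w s.
Proof.
move=> st.
have := @midpoint_nondecreasing _ (fun x => w (- x)) C2 _ _ (- t) (- s).
rewrite !opprK lerN2; apply => //.
- by move=> a b; rewrite (_ : - ((a + b) / 2) = (- a + - b) / 2)//; field.
- by move=> x x0; apply: w_right; rewrite oppr_ge0.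
Qed.

Lemma idw_nondecreasing s t : s <= t -> s + w s <= t + w t.
Proof.
apply: (@midpoint_nondecreasing _ (fun x => x + w x) C1) => //.
by move=> a b; have := w_mid a b; lra.
Qed.

(** [w] is nonincreasing while t + w t is nondecreasing, so [w] is 1-Lipschitz. *)
Lemma w_continuous : continuous w.
Proof.
move=> x; apply/cvgrPdist_le => e e0; near=> y.
have xy : `|x - y| <= e by near: y; exact: cvgr_dist_le.
apply: le_trans xy.
have [h|h] := leP x y.
  have h1 := w_nonincreasing h; have h2 := idw_nondecreasing h.
  by rewrite ger0_norm ?subr_ge0// ler0_norm ?subr_le0//; lra.
have h1 := w_nonincreasing (ltW h); have h2 := idw_nondecreasing (ltW h).
by rewrite ler0_norm ?subr_le0// gtr0_norm ?subr_gt0//; lra.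
Unshelve. all: by end_near. Qed.

Lemma cost_minimizer nu : 0 < nu -> exists t, forall s, cost nu t <= cost nu s.
Proof.
move=> nu0; have pn : 0 < pi * nu by rewrite mulr_gt0 ?pi_gt0.
(* Outside [-M, M] the cost exceeds its value at 0: to the left because w s >= - s, to the right
   because the exponential is at least 1 + 2 s. *)
pose M := `|cost nu 0| + (`|cost nu 0| + `|c0|) / (pi * nu).
have M0 : 0 <= M by rewrite addr_ge0// divr_ge0 ?addr_ge0// ltW.
have MM : - M <= M by lra.
have cc : continuous (cost nu).
  apply: continuous_add; first exact: w_continuous.
  apply: continuous_mul; first exact: cst_continuous.
  move=> x; apply: (@continuous_comp _ _ _ (fun t : R => 2 * t) expR); last exact: continuous_expR.
  exact: mulrl_continuous.
have [t tM tmin] := EVT_min MM (continuous_subspaceT cc).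
exists t => s.
have z0 : cost nu t <= cost nu 0 by apply: tmin; rewrite in_itv/=; lra.
have [sM|sM] := boolP (s \in `[- M, M]); first exact: tmin.
apply: (le_trans z0); apply: (le_trans (ler_norm _)).
have E0 := expR_ge0 (2 * s).
have q0 : 0 <= (`|cost nu 0| + `|c0|) / (pi * nu) by rewrite divr_ge0 ?addr_ge0// ltW.
have pe : 0 <= pi * nu * expR (2 * s) by rewrite mulr_ge0// ltW.
move: sM; rewrite in_itv/= negb_and -!ltNge => /orP[sM|sM].
  have := w_geN s; rewrite /cost in z0 *; rewrite /M in sM; lra.
have c := w_ge s.
have : pi * nu * (1 + 2 * s) <= pi * nu * expR (2 * s).
  by rewrite ler_wpM2l ?(ltW pn)// expR_ge1Dx.
have qM : (`|cost nu 0| + `|c0|) / (pi * nu) <= s.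
  by apply: le_trans (ltW sM); rewrite /M lerDr.
have : `|cost nu 0| + `|c0| <= s * (pi * nu) by rewrite -ler_pdivrMr.
have s0 : 0 <= s by exact: le_trans q0 qM.
have := mulr_ge0 s0 (ltW pn); have := ler_norm (- c0); rewrite normrN.
by rewrite {3}/cost; lra.
Qed.

(** Midpoint convexity, iterated, is convexity at the dyadic fractions; small ones are all that the
    first-order condition below needs. *)
Lemma w_dyadic t s k : w (t + s / 2 ^+ k) <= w t + (w (t + s) - w t) / 2 ^+ k.
Proof.
elim: k => [|k IH]; first by rewrite expr0 !divr1; lra.
have := w_mid t (t + s / 2 ^+ k).
have p0 : (2 : R) ^+ k != 0 by rewrite expf_neq0.
have -> : (t + (t + s / 2 ^+ k)) / 2 = t + s / 2 ^+ k.+1.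
  by rewrite exprS; field.
move=> h; apply: (le_trans h).
have -> : (w (t + s) - w t) / 2 ^+ k.+1 = (w (t + s) - w t) / 2 ^+ k / 2.
  by rewrite exprS; field.
lra.
Qed.

Lemma expR_le_quadratic (y : R) : y <= 1 / 2 -> expR y <= 1 + y + 2 * y ^+ 2.
Proof.
move=> y2; have e1 := expR_ge1Dx (- y).
have e0 := expR_gt0 y.
have : expR y * (1 - y) <= 1.
  by have := ler_wpM2l (ltW e0) e1; rewrite expRxMexpNx_1.
have : 0 <= y ^+ 2 * (1 - 2 * y) by rewrite mulr_ge0 ?sqr_ge0//; lra.
have y1 : 0 < 1 - y by lra.
move=> h1 h2; rewrite -(ler_pM2r y1); apply: (le_trans h2).
by rewrite expr2 in h1 *; nra.
Qed.

(** The first-order condition at the minimizer, obtained without differentiating [w]. If it failed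
    at s by d > 0, dyadic convexity would carry the failure to t + s / 2^k, where it decreases like
    d / 2^k while the second-order error of the exponential decreases like 1 / 4^k. *)
Lemma minimizer_subgradient nu t : 0 < nu -> (forall s, cost nu t <= cost nu s) ->
  forall s, w t - 2 * pi * nu * expR (2 * t) * s <= w (t + s).
Proof.
move=> nu0 tmin s; set th := 2 * pi * nu * expR (2 * t).
have th0 : 0 < th by rewrite !mulr_gt0 ?pi_gt0 ?expR_gt0.
rewrite leNgt; apply/negP => lt.
pose d := w t - th * s - w (t + s); have d0 : 0 < d by rewrite subr_gt0.
(* The first condition keeps the second-order error below d; the second puts 2 u within the range of
   [expR_le_quadratic]. *)
have [k [k1 k2]] : exists k, 4 * th * s ^+ 2 / d < 2 ^+ k /\ 4 * `|s| < 2 ^+ k.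
  pose k := (Num.truncn (4 * th * s ^+ 2 / d) + Num.truncn (4 * `|s|)).+1.
  have kk : k%:R <= 2 ^+ k :> R by rewrite -natrX ler_nat ltnW// ltn_expl.
  exists k; split; apply: lt_le_trans kk; apply: (lt_le_trans (truncnS_gt _)).
    by rewrite ler_nat /k ltnS leq_addr.
  by rewrite ler_nat /k ltnS leq_addl.
have p0 : 0 < (2 : R) ^+ k by rewrite exprn_gt0.
pose u := s / 2 ^+ k.
have u2 : 2 * u <= 1 / 2.
  have : u <= 1 / 4; last lra.
  rewrite /u ler_pdivrMr//; have := ler_norm s; lra.
have h1 := tmin (t + u); have h2 := w_dyadic t s k.
have h3 := expR_le_quadratic u2.
rewrite /cost in h1.
have eE : pi * nu * expR (2 * (t + u)) = th / 2 * expR (2 * u).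
  by rewrite mulrDr expRD /th; field.
rewrite eE in h1.
have eE2 : pi * nu * expR (2 * t) = th / 2 by rewrite /th; field.
rewrite eE2 in h1.
have h4 : th / 2 * expR (2 * u) <= th / 2 * (1 + 2 * u + 2 * (2 * u) ^+ 2).
  by rewrite ler_wpM2l// divr_ge0// ltW.
have h5 : 0 <= (w (t + s) - w t) / 2 ^+ k + th * u + 4 * th * u ^+ 2.
  by rewrite -/u in h2; rewrite !expr2 in h4 *; lra.
have : 0 <= (w (t + s) - w t) + th * s + 4 * th * s * u.
  have -> : (w (t + s) - w t) + th * s + 4 * th * s * u =
      2 ^+ k * ((w (t + s) - w t) / 2 ^+ k + th * u + 4 * th * u ^+ 2).
    by rewrite /u; field; rewrite gt_eqF.
  exact: (mulr_ge0 (ltW p0) h5).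
have : 4 * th * s * u < d.
  by move: k1; rewrite /u ltr_pdivrMr// mulrA ltr_pdivrMr// expr2 mulrA [d * _]mulrC.
rewrite /d; lra.
Qed.

Theorem rate_duality nu : 0 < nu ->
  (rate nu)%:E = ereal_sup [set (- conjugate (fun t => (t + w t)%R) (1 - theta)%R +
                       (ball_term nu theta)%:E)%E | theta in `[0%R, 1%R]].
Proof.
move=> nu0; apply/eqP; rewrite eq_le; apply/andP; split.
  have [t tmin] := cost_minimizer nu0.
  have sub := minimizer_subgradient nu0 tmin.
  set th := 2 * pi * nu * expR (2 * t) in sub.
  have th0 : 0 < th by rewrite !mulr_gt0 ?pi_gt0 ?expR_gt0.
  (* The subgradient inequality one unit to the left, combined with the monotonicity of t + w t. *)
  have th1 : th <= 1.
    have := sub (-1); have : t - 1 <= t by lra.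
    by move=> /idw_nondecreasing; lra.
  (* The subgradient inequality says precisely that t attains the supremum in the conjugate at 1 -
     th. *)
  have cE : conjugate (fun t => t + w t) (1 - th) = ((1 - th) * t - (t + w t))%:E.
    apply/eqP; rewrite eq_le; apply/andP; split.
      apply: ge_ereal_sup => _ [s _ <-]; rewrite lee_fin.
      have := sub (s - t); rewrite [t + (s - t)]addrC subrK; lra.
    by apply: ereal_sup_ubound; exists t.
  have bE : ball_term nu th = th / 2 * (1 - 2 * t).
    rewrite /ball_term; congr (_ * _).
    have -> : 2 * pi * expR 1 * nu / th = expR (1 - 2 * t).
      rewrite /th expRD expRN; have := @pi_gt0 R; move: (pi : R) => p p0.
      by field; rewrite !gt_eqF ?expR_gt0.
    by rewrite expRK.
  apply: (@le_trans _ _ (- conjugate (fun t => (t + w t)%R) (1 - th)%R + (ball_term nu th)%:E)%E).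
    rewrite cE bE -EFinN -EFinD lee_fin; apply: (le_trans (rate_le t (ltW nu0))).
    have : pi * nu * expR (2 * t) = th / 2 by rewrite /th; field.
    by rewrite /cost => ->; lra.
  by apply: ereal_sup_ubound; exists th => //; rewrite /= in_itv/= ltW.
apply: ge_ereal_sup => _ [th /= + <-]; rewrite in_itv/= => /andP[th0 th1].
(* Weak duality for arbitrary theta and t: it is 1 + ln x <= x at x = 2 pi nu e^(2t) / theta, and at
   theta = 0 the left side vanishes. *)
have key t : ball_term nu th <= pi * nu * expR (2 * t) - th * t.
  move: th0; rewrite le_eqVlt => /predU1P[<-|th0].
    by rewrite /ball_term !mul0r subr0 !mulr_ge0 ?pi_ge0 ?expR_ge0// ltW.
  set x := 2 * pi * nu * expR (2 * t) / th.
  have x0 : 0 < x by rewrite divr_gt0// !mulr_gt0 ?pi_gt0 ?expR_gt0.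
  have lx : 1 + ln x <= x by rewrite -[leRHS]lnK ?posrE// expR_ge1Dx.
  have -> : ball_term nu th = th / 2 * (1 + ln x - 2 * t).
    rewrite /ball_term; congr (_ * _).
    have -> : 2 * pi * expR 1 * nu / th = x * expR (1 - 2 * t).
      rewrite /x expRD expRN; move: (pi : R) => p.
      by field; rewrite !gt_eqF ?expR_gt0.
    by rewrite lnM ?posrE ?expR_gt0// expRK; ring.
  have : th / 2 * (1 + ln x) <= th / 2 * x by rewrite ler_wpM2l// divr_ge0// ltW.
  have -> : th / 2 * x = pi * nu * expR (2 * t) by rewrite /x; field; rewrite gt_eqF.
  lra.
have up t : (- conjugate (fun t => (t + w t)%R) (1 - th)%R + (ball_term nu th)%:E <= (cost nu t)%:E)%E.
  apply: (@le_trans _ _ (- ((1 - th) * t - (t + w t))%R%:E + (ball_term nu th)%:E)%E).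
    rewrite leeD2r// leeN2; apply: ereal_sup_ubound; by exists t.
  by rewrite -EFinN -EFinD lee_fin /cost; have := key t; lra.
move: up; set X := (_ + _)%E; case: X => [r||] up.
- by rewrite lee_fin; apply: rate_ge => t; have := up t; rewrite lee_fin.
- by have := up 0.
- by rewrite leNye.
Qed.

End duality.

(** * Limits superior of extended-real sequences *)

Section limsup.
Context {R : realType}.
Implicit Types u : nat -> \bar R.

Lemma limn_esup_le u c : (\forall n \near \oo, u n <= c)%E -> (limn_esup u <= c)%E.
Proof.
case=> M _ h; rewrite limn_esup_lim; apply: lime_le; first exact: is_cvg_esups.
exists M => // m /= Mm; apply: ge_ereal_sup => _ [n /= mn <-].
by apply: h => /=; exact: leq_trans Mm mn.
Qed.

Lemma limn_esup_ge u c : (forall n, (1 <= n)%N -> c <= u n)%E -> (c <= limn_esup u)%E.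
Proof.
move=> h; rewrite limn_esup_lim; apply: lime_ge; first exact: is_cvg_esups.
apply: nearW => m; apply: (@le_trans _ _ (u m.+1)); first exact: h.
by apply: ereal_sup_ubound; exists m.+1 => /=.
Qed.

Lemma limn_esup_lt u c : (limn_esup u < c)%E -> \forall n \near \oo, (u n <= c)%E.
Proof.
rewrite limn_esup_lim (cvg_lim _ (@cvg_esups_inf _ u))// => /ereal_inf_lt.
case=> _ [m _ <-] mc; exists m => // n /= mn.
by apply: le_trans (ltW mc); apply: ereal_sup_ubound; exists n.
Qed.

End limsup.

Lemma slope_le (R : realType) (x y c : R) (n0 : nat) :
  (forall n : nat, (n0 <= n)%N -> x * n%:R <= c + y * n%:R) -> x <= y.
Proof.
move=> h; rewrite leNgt; apply/negP => yx.
have xy0 : 0 < x - y by rewrite subr_gt0.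
pose k := Num.truncn (`|c| / (x - y)).
have kc : c < k.+1%:R * (x - y).
  by rewrite (le_lt_trans (ler_norm _))// -ltr_pdivrMr// truncnS_gt.
have := h (n0 + k.+1)%N (leq_addr _ _); rewrite natrD => hh.
have : 0 <= n0%:R * (x - y) by rewrite mulr_ge0// ltW.
lra.
Qed.

(** * Growth of the parallel volumes *)

Lemma dilate_eball (R : realType) n (t : R) : 0 <= t -> dilate t (eball n 1) = eball n t.
Proof.
rewrite le_eqVlt => /predU1P[<-|t0]; apply/seteqP; split => x.
- case=> y _ <-; apply/eballE; rewrite scale0r.
  by rewrite /enorm /nsq big1 ?sqrtr0// => i _; rewrite mxE expr0n.
- move=> /eballE x0; exists 0; last first.
    have : enorm x = 0 by apply/eqP; rewrite eq_le x0 enorm_ge0.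
    by move=> h; rewrite (@nsq_eq0 _ _ x) ?scaler0// -enorm_sqr h expr0n.
  by apply/eballE; rewrite /enorm /nsq big1 ?sqrtr0// => i _; rewrite mxE expr0n.
- case=> y /eballE y1 <-; apply/eballE; rewrite enormZ gtr0_norm//.
  by rewrite -[leRHS]mulr1 ler_wpM2l// ltW.
- move=> /eballE xt; exists (t^-1 *: x); last by rewrite scalerA mulfV ?scale1r// gt_eqF.
  by apply/eballE; rewrite enormZ gtr0_norm ?invr_gt0// mulrC ler_pdivrMr// mul1r.
Qed.

Section steiner.
Context {R : realType}.
Local Notation mR := (measurableTypeR R).
Local Notation leb := (@lebesgue_measure R).
Variables (sigma rho : R).
Hypotheses (sigma_gt0 : 0 < sigma) (rho_gt0 : 0 < rho).
Variable mu : nat -> nat -> R.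
Hypothesis mu_intrinsic : forall n : nat, (1 <= n)%N ->
  intrinsic_volumes (Sset sigma rho n) (mu n).

Local Notation K := (Sset sigma rho).

Definition vpoly (n : nat) (r : R) : R :=
  \sum_(j < n.+1) mu n (n - j) * eps j * r ^+ j.

Definition wpoly (n : nat) (t : R) : R :=
  \sum_(j < n.+1) mu n (n - j) * expR (- t) ^+ j.

Let cK n : compact (K n) := @compact_Sset R sigma rho n.

Let K0 n : K n !=set0. Proof. by exists 0; exact (@Sset0 R sigma rho sigma_gt0 rho_gt0 n). Qed.

Lemma compact_V n r : compact (msum (K n) (eball n r)).
Proof. exact: (compact_minkowski (@cK n) (@compact_eball R n r)). Qed.

Lemma vpolyE n r : (1 <= n)%N -> 0 <= r -> vol (msum (K n) (eball n r)) = (vpoly n r)%:E.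
Proof.
move=> n1 r0; rewrite -dilate_eball// mu_intrinsic// /vpoly -sumEFin.
by apply: eq_bigr => j _; rewrite epsE -!EFinM.
Qed.

(** Here t sits in the radius and the kernel [kb 1] is fixed, the form in which an inequality
    between values of V_n can be integrated into one for W_n. *)
Lemma integral_vpoly n t :
  (\int[leb]_r (vpoly n (expR (- t) * r) * kb 1 r)%:E = (wpoly n t)%:E)%E.
Proof.
have E := integral_poly_kb n.+1 (fun j => mu n (n - j) * eps j * expR (- t) ^+ j) (@ltr01 R).
have -> : wpoly n t = \sum_(j < n.+1) mu n (n - j) * eps j * expR (- t) ^+ j *
    ((Num.sqrt 1)^-1 ^+ j / eps j).
  apply: eq_bigr => j _; rewrite sqrtr1 invr1 expr1n mul1r mulrAC mulfK//.
  by rewrite gt_eqF// eps_gt0.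
rewrite -E; apply: eq_integral => r _; congr (_ * _)%:E.
by apply: eq_bigr => j _; rewrite exprMn mulrA.
Qed.

Lemma sqrt_expR2 (t : R) : Num.sqrt (expR (2 * t)) = expR t.
Proof. by rewrite expRM_natl sqrtr_sqr ger0_norm// expR_ge0. Qed.

Lemma willsE n t : (1 <= n)%N -> wills (K n) (expR (2 * t)) = (wpoly n t)%:E.
Proof.
move=> n1; have b0 := expR_gt0 (2 * t).
rewrite -(layer_cake (@cK n) (@K0 n) b0).
have E := integral_poly_kb n.+1 (fun j => mu n (n - j) * eps j) b0.
have -> : wpoly n t = \sum_(j < n.+1) mu n (n - j) * eps j *
    ((Num.sqrt (expR (2 * t)))^-1 ^+ j / eps j).
  apply: eq_bigr => j _; rewrite sqrt_expR2 -expRN mulrA mulrAC mulfK//.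
  by rewrite gt_eqF// eps_gt0.
rewrite -E; apply: eq_integral => r _.
have [r0|r0] := leP 0 r; first by rewrite vpolyE// -EFinM.
by rewrite /kb max_r ?(ltW r0)// mulr0 mul0r mulr0 mule0.
Qed.

Lemma wpoly_ge n t : (1 <= n)%N -> expR (- t) ^+ n <= wpoly n t.
Proof.
move=> n1; rewrite -lee_fin -willsE//.
have := @wills_ge R sigma rho sigma_gt0 rho_gt0 n _ (expR_gt0 (2 * t)).
by rewrite sqrt_expR2 expRN exprVn.
Qed.

Lemma wpoly_gt0 n t : (1 <= n)%N -> 0 < wpoly n t.
Proof. by move=> n1; apply: lt_le_trans (wpoly_ge t n1); rewrite exprn_gt0// expR_gt0. Qed.

Lemma wpoly_submul m n t : (1 <= m)%N -> (1 <= n)%N ->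
  wpoly (m + n) t <= wpoly m t * wpoly n t.
Proof.
move=> m1 n1; rewrite -lee_fin EFinM -!willsE ?addn_gt0 ?m1//.
exact: (wills_submul sigma_gt0 rho_gt0 m n (expR_gt0 (2 * t))).
Qed.

Lemma wpoly_chernoff n t r : (1 <= n)%N -> 0 <= r ->
  vpoly n r <= expR (pi * expR (2 * t) * r ^+ 2) * wpoly n t.
Proof.
move=> n1 r0.
have := wills_chernoff sigma_gt0 rho_gt0 n (expR_gt0 (2 * t)) r0.
rewrite vpolyE// willsE// -EFinM lee_fin expRN ler_pdivrMr ?expR_gt0//.
by rewrite mulrC.
Qed.

Lemma continuous_vpoly n : continuous (vpoly n).
Proof.
apply: continuous_sum_row => j; apply: continuous_mul; first exact: cst_continuous.
exact: exprn_continuous.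
Qed.

Lemma vpoly_logconvex n a b : (1 <= n)%N -> 0 < a -> 0 < b ->
  vpoly n (Num.sqrt (a * b)) ^+ 2 <= vpoly n a * vpoly n b.
Proof.
case: n => // n n1 a0 b0.
apply: (vol_ball_logconvex (@cK n.+1) _ (@continuous_vpoly n.+1) _ a0 b0).
  exact (@cvx_Sset R sigma rho n.+1).
by move=> r r0; exact: vpolyE.
Qed.

Lemma vpoly_ge0 n r : (1 <= n)%N -> 0 <= r -> 0 <= vpoly n r.
Proof. by move=> n1 r0; rewrite -lee_fin -vpolyE// vol_ge0. Qed.

Lemma integrable_vpoly n t :
  leb.-integrable setT (fun r : mR => (vpoly n (expR (- t) * r) * kb 1 r)%:E).
Proof.
have im j : leb.-integrable setT (fun r : mR => (r ^+ j * kb 1 r)%:E).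
  apply/integrableP; split; first by apply/measurable_EFinP; exact: measurable_mkb.
  under eq_integral do rewrite /= ger0_norm ?mkb_ge0//.
  by rewrite -/(moment 1 j) momentE// ltry.
rewrite (_ : (fun _ => _) = (fun r : mR =>
   \sum_(j < n.+1) ((mu n (n - j) * eps j * expR (- t) ^+ j)%:E * (r ^+ j * kb 1 r)%:E)%E)).
  by apply: integrable_sum => // j _; exact: integrableZl.
apply/funext => r; rewrite mulr_suml -sumEFin; apply: eq_bigr => j _.
by rewrite -EFinM exprMn !mulrA.
Qed.

(* AM-GM under the integral: 2 V(e^(-(s+t)/2) r) <= c V(e^(-s) r) + V(e^(-t) r) / c. *)
Lemma wpoly_logconvex n s t : (1 <= n)%N ->
  wpoly n ((s + t) / 2) ^+ 2 <= wpoly n s * wpoly n t.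
Proof.
move=> n1.
have amgm c : 0 < c -> 2 * wpoly n ((s + t) / 2) <= c * wpoly n s + c^-1 * wpoly n t.
  move=> c0; rewrite -lee_fin EFinD !EFinM -!integral_vpoly.
  rewrite -!integralZl//; try exact: integrable_vpoly.
  rewrite -integralD//; try by apply: integrableZl => //; exact: integrable_vpoly.
  apply: le_integral => //.
  - by apply: integrableZl => //; exact: integrable_vpoly.
  - by apply: integrableD => //; apply: integrableZl => //; exact: integrable_vpoly.
  move=> r _; rewrite -!EFinM -EFinD lee_fin.
  have [r0|r0] := leP r 0; first by rewrite /kb max_r// mulr0 mul0r !mulr0 addr0.
  move: (kb 1 r) (kb_ge0 r (@ler01 R)) => k k0.
  rewrite !mulrA -mulrDl ler_wpM2r//.
  have es : 0 < expR (- s) * r by rewrite mulr_gt0 ?expR_gt0.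
  have et : 0 < expR (- t) * r by rewrite mulr_gt0 ?expR_gt0.
  have := vpoly_logconvex n1 es et.
  have -> : Num.sqrt (expR (- s) * r * (expR (- t) * r)) = expR (- ((s + t) / 2)) * r.
    rewrite mulrACA -expRD -expr2 sqrtrM ?expR_ge0// sqrtr_sqr gtr0_norm//; congr (_ * _).
    by rewrite (_ : - s - t = 2 * (- ((s + t) / 2))) ?sqrt_expR2//; field.
  set A := vpoly n _; set B := vpoly n _; set C := vpoly n _ => h.
  have B0 : 0 <= B by apply: vpoly_ge0 => //; exact: ltW.
  have C0 : 0 <= C by apply: vpoly_ge0 => //; exact: ltW.
  have [Y Yc] : exists Y, C = c * Y by exists (c^-1 * C); rewrite mulrA mulfV ?mul1r// gt_eqF.
  rewrite Yc mulrA mulVf ?mul1r ?gt_eqF//; rewrite Yc in h C0.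
  have Y0 : 0 <= Y by rewrite -(pmulr_rge0 _ c0).
  rewrite leNgt; apply/negP => lt.
  have cB : 0 <= c * B by rewrite mulr_ge0// ltW.
  have lt2 : (c * B + Y) ^+ 2 < (2 * A) ^+ 2.
    by rewrite ltrXn2r// ?nnegrE ?addr_ge0// (le_trans _ (ltW lt))// addr_ge0.
  have := sqr_ge0 (c * B - Y); rewrite !expr2 in h lt2 *; lra.
have W1 := wpoly_gt0 s n1; have W2 := wpoly_gt0 t n1; have W0 := wpoly_gt0 ((s + t) / 2) n1.
(* The c for which the right side of [amgm] is smallest. *)
pose q := Num.sqrt (wpoly n t / wpoly n s).
have q0 : 0 < q by rewrite sqrtr_gt0 divr_gt0.
have q2 : q ^+ 2 = wpoly n t / wpoly n s by rewrite sqr_sqrtr// divr_ge0// ltW.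
have := amgm q q0.
have -> : wpoly n t = q ^+ 2 * wpoly n s by rewrite q2 divfK// gt_eqF.
rewrite [q^-1 * _]mulrA expr2 mulKf ?gt_eqF//.
by move=> h; rewrite expr2; have := mulr_gt0 q0 W1; nra.
Qed.

Lemma expGE n t : \sum_(j < n.+1) mu n j * expR (j%:R * t) = expR (n%:R * t) * wpoly n t.
Proof.
rewrite (reindex_inj rev_ord_inj) /= mulr_sumr; apply: eq_bigr => j _.
rewrite subSS [expR _ * _]mulrC -mulrA; congr (_ * _).
rewrite -expRM_natl -expRD; congr expR.
have jn : (j <= n)%N by have := ltn_ord j; lia.
by rewrite natrB//; ring.
Qed.

Lemma gfunE n t : (1 <= n)%N -> gfun mu n t = t + ln (wpoly n t) / n%:R.
Proof.
move=> n1; have nR : (n%:R : R) != 0 by rewrite pnatr_eq0; case: n n1.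
rewrite /gfun /Gfun expGE lnM ?posrE ?expR_gt0 ?wpoly_gt0// expRK mulrDl.
by congr (_ + _); rewrite mulrAC mulfV ?mul1r.
Qed.

Lemma vpoly0 n : vpoly n 0 = mu n n * eps 0.
Proof.
rewrite /vpoly big_ord_recl /= subn0 expr0 mulr1 big1 ?addr0// => i _.
by rewrite expr0n/= mulr0.
Qed.

Lemma eps0 : eps 0 = 1 :> R.
Proof.
rewrite /eps volE /itr /= indicE mem_set//; apply/eballE.
by rewrite /enorm /nsq big_ord0 sqrtr0.
Qed.

Lemma vpoly_le n r s : (1 <= n)%N -> 0 <= r -> r <= s -> vpoly n r <= vpoly n s.
Proof.
move=> n1 r0 rs; rewrite -lee_fin -!vpolyE//; last exact: le_trans rs.
apply: le_vol; try exact: compact_V.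
move=> _ [x Kx [y yr <-]]; exists x => //; exists y => //.
by move: yr => /= /le_trans; apply.
Qed.

Lemma vpoly_ge_cube n r d : (1 <= n)%N -> 0 <= r -> 0 <= d -> d ^+ 2 <= rho ->
  (2 * d) ^+ n <= vpoly n r.
Proof.
move=> n1 r0 d0 dr; rewrite -lee_fin -vpolyE// -vol_box//.
apply: le_vol; [exact: compact_box|exact: compact_V|] => x xd.
exists x; first exact: (@box_Sset R sigma rho sigma_gt0 rho_gt0 n d dr).
by exists 0; [apply/eballE; rewrite /enorm /nsq big1 ?sqrtr0// => i _; rewrite mxE expr0n|rewrite addr0].
Qed.

Lemma vpoly_superadd m p n d r1 r2 : (1 <= m)%N -> (1 <= n)%N ->
  0 <= d -> d ^+ 2 = rho / 2 -> 2 * sigma <= p%:R * rho -> 0 <= r1 -> 0 <= r2 ->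
  vpoly m r1 * (2 * d) ^+ p * vpoly n r2 <= vpoly (m + p + n) (Num.sqrt (r1 ^+ 2 + r2 ^+ 2)).
Proof.
move=> m1 n1 d0 dE ps r10 r20.
have := vol_superadd sigma_gt0 rho_gt0 m n d0 dE ps r10 r20.
by rewrite !vpolyE ?sqrtr_ge0 ?addn_gt0 ?m1//.
Qed.

Lemma kb_expR (b beta r : R) : b != beta ->
  expR (pi * beta * r ^+ 2) * kb b r = b / (b - beta) * kb (b - beta) r.
Proof.
move=> bb; rewrite /kb mulrCA -expRD.
have -> : pi * beta * r ^+ 2 + - (pi * b * r ^+ 2) = - (pi * (b - beta) * r ^+ 2) by ring.
by rewrite !mulrA; congr (_ * _ * _); rewrite -!mulrA mulrC; field; rewrite subr_eq0.
Qed.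

(** The growth e^(pi beta r^2) turns the weight of parameter b = e^(2t) into b / (b - beta) times
    the weight of parameter b - beta, which has mass 1. The resulting factor does not depend on
    n. *)
Lemma wpoly_le n t C beta : (1 <= n)%N -> 0 <= C -> 0 <= beta -> beta < expR (2 * t) ->
  (forall r, 0 <= r -> vpoly n r <= C * expR (pi * beta * r ^+ 2)) ->
  wpoly n t <= C * (expR (2 * t) / (expR (2 * t) - beta)).
Proof.
move=> n1 C0 beta0 betab h; have b0 := expR_gt0 (2 * t); set b := expR (2 * t) in betab b0 *.
have bb0 : 0 < b - beta by rewrite subr_gt0.
have i1 : (\int[leb]_r (kb (b - beta) r)%:E = 1)%E.
  have := momentE 0 bb0; rewrite /moment expr0 eps0 divr1 => <-.
  by apply: eq_integral => r _; rewrite expr0 mul1r.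
rewrite -lee_fin -willsE// -(layer_cake (@cK n) (@K0 n) b0).
have C'0 : 0 <= C * (b / (b - beta)) by rewrite mulr_ge0// divr_ge0// ltW.
rewrite (eq_integral (fun r : mR => (vpoly n r * kb b r)%:E)); last first.
  move=> r _; have [r0|r0] := leP 0 r; first by rewrite vpolyE// -EFinM.
  by rewrite /kb max_r ?(ltW r0)// !(mulr0, mul0r) mule0.
apply: (@le_trans _ _ (\int[leb]_r ((C * (b / (b - beta)))%:E * (kb (b - beta) r)%:E))%E); last first.
  rewrite ge0_integralZl//.
  - by rewrite i1 mule1.
  - by apply/measurable_EFinP; exact: measurable_kb.
  - by move=> r _; rewrite lee_fin kb_ge0// ltW.
apply: ge0_le_integral => //.
- move=> r _; rewrite lee_fin; have [r0|r0] := leP 0 r; first by rewrite mulr_ge0 ?vpoly_ge0 ?kb_ge0 ?(ltW b0).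
  by rewrite /kb max_r ?(ltW r0)// !(mulr0, mul0r).
- apply/measurable_EFinP; apply: measurable_funM; last exact: measurable_kb.
  apply: continuous_measurable_fun; exact: continuous_vpoly.
- apply/measurable_EFinP; apply: measurable_funM; first exact: measurable_cst.
  exact: measurable_kb.
move=> r _; have [r0|r0] := leP 0 r.
  rewrite lee_fin -[leRHS]mulrA -kb_expR; last by rewrite gt_eqF.
  by rewrite [leRHS]mulrA ler_wpM2r ?kb_ge0 ?(ltW b0)// h.
by rewrite lee_fin /kb !max_r ?(ltW r0)// !(mulr0, mul0r).
Qed.

(** W_n(t) is a polynomial in e^(-t) with constant term V_n(0), approached as t grows. *)
Lemma wpoly_lim n c : (forall t, c <= wpoly n t) -> c <= vpoly n 0.
Proof.
move=> h; rewrite vpoly0 eps0 mulr1.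
pose P (u : R) := \sum_(j < n.+1) mu n (n - j) * u ^+ j.
have cP : continuous P.
  apply: continuous_sum_row => j; apply: continuous_mul; first exact: cst_continuous.
  exact: exprn_continuous.
have P0 : P 0 = mu n n.
  by rewrite /P big_ord_recl /= subn0 expr0 mulr1 big1 ?addr0// => i _; rewrite expr0n mulr0.
rewrite -P0 leNgt; apply/negP => Pc.
have /cvgrPdist_lt/(_ (c - P 0)) := cP 0; rewrite subr_gt0 => /(_ Pc).
case=> e /= e0 he; have e20 : 0 < e / 2 by rewrite divr_gt0.
have : `|P 0 - P (e / 2)| < c - P 0.
  by apply: he; rewrite /= sub0r normrN gtr0_norm// ltr_pdivrMr// mulr2n mulrDr mulr1 ltrDl.
have := h (- ln (e / 2)); rewrite /wpoly opprK lnK ?posrE// -/(P _) => h1.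
by rewrite distrC => /(le_lt_trans (ler_norm _)); lra.
Qed.

Lemma growth_exists : exists w : R -> R,
  (forall n t, (1 <= n)%N -> w t <= ln (wpoly n t) / n%:R) /\
  (forall t, (fun n => ln (wpoly n t) / n%:R) @ \oo --> w t).
Proof.
have key t : exists l, (forall n, (1 <= n)%N -> l <= ln (wpoly n t) / n%:R) /\
    (fun n => ln (wpoly n t) / n%:R) @ \oo --> l.
  apply: (@fekete R (fun n => ln (wpoly n t)) (- t)) => [m n m1 n1|n n1].
    by rewrite -lnM ?posrE ?wpoly_gt0// ler_ln ?posrE ?mulr_gt0 ?wpoly_gt0 ?addn_gt0 ?m1// wpoly_submul.
  rewrite mulrC -[leLHS]expRK ler_ln ?posrE ?expR_gt0 ?wpoly_gt0// expRM_natl.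
  exact: wpoly_ge.
have [w hw] := choice key.
by exists w; split=> [n t|t]; [exact: (hw t).1|exact: (hw t).2].
Qed.

Lemma gap_exists : exists p d, [/\ 0 < d, d ^+ 2 = rho / 2 & 2 * sigma <= p%:R * rho].
Proof.
exists (Num.truncn (2 * sigma / rho)).+1, (Num.sqrt (rho / 2)); split.
- by rewrite sqrtr_gt0 divr_gt0.
- by rewrite sqr_sqrtr// divr_ge0// ltW.
- by rewrite -ler_pdivrMr// ltW// truncnS_gt.
Qed.

Variable w : R -> R.
Hypothesis w_le : forall n t, (1 <= n)%N -> w t <= ln (wpoly n t) / n%:R.
Hypothesis w_lim : forall t, (fun n => ln (wpoly n t) / n%:R) @ \oo --> w t.

Let nR n : (1 <= n)%N -> 0 < n%:R :> R. Proof. by rewrite ltr0n. Qed.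

Lemma w_lim_ge t c : (forall n, (1 <= n)%N -> c <= ln (wpoly n t) / n%:R) -> c <= w t.
Proof.
move=> h; rewrite -(cvg_lim (@Rhausdorff R) (@w_lim t)).
by apply: limr_ge; [apply/cvg_ex; exists (w t); exact: (@w_lim t)|exists 1%N].
Qed.

Lemma w_mid s t : w ((s + t) / 2) <= (w s + w t) / 2.
Proof.
have hl : (fun n => (ln (wpoly n s) / n%:R + ln (wpoly n t) / n%:R) / 2) @ \oo --> (w s + w t) / 2.
  by apply: cvgMl; apply: cvgD.
rewrite -(cvg_lim (@Rhausdorff R) hl).
apply: limr_ge; first by apply/cvg_ex; exists ((w s + w t) / 2).
exists 1%N => // n /= n1; apply: (le_trans (w_le _ n1)).
have h : ln (wpoly n ((s + t) / 2)) *+ 2 <= ln (wpoly n s) + ln (wpoly n t).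
  rewrite -lnXn ?wpoly_gt0// -lnM ?posrE ?wpoly_gt0//.
  by rewrite ler_ln ?posrE ?mulr_gt0 ?exprn_gt0 ?wpoly_gt0// wpoly_logconvex.
have := nR n1; rewrite -mulrDl mulrAC => n0; rewrite ler_pM2r ?invr_gt0//.
by move: h; rewrite mulr2n; lra.
Qed.

Lemma w_geN t : - t <= w t.
Proof.
apply: w_lim_ge => n n1; rewrite ler_pdivlMr ?nR// mulrC.
rewrite -[leLHS]expRK ler_ln ?posrE ?expR_gt0 ?wpoly_gt0// expRM_natl.
exact: wpoly_ge.
Qed.

Lemma w_ge d t : 0 < d -> d ^+ 2 <= rho -> ln (2 * d) <= w t.
Proof.
move=> d0 dr; have dd0 : 0 < 2 * d by rewrite mulr_gt0.
apply: w_lim_ge => n n1; rewrite ler_pdivlMr ?nR// mulr_natr -lnXn//.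
rewrite ler_ln ?posrE ?exprn_gt0 ?wpoly_gt0//.
apply: (le_trans (vpoly_ge_cube n1 (lexx 0) (ltW d0) dr)).
by apply: (le_trans (wpoly_chernoff t n1 (lexx 0))); rewrite expr0n mulr0 expR0 mul1r.
Qed.

(** As [w] lies below ln W_1, the explicit W_1(t) = mu_1(1) + mu_1(0) e^(-t) controls it on both
    half-lines. *)
Let M : R := `|mu 1 1| + `|mu 1 0| + 1.
Let M0 : 0 < M. Proof. by rewrite ltr_wpDl ?addr_ge0. Qed.

Lemma wpoly1E t : wpoly 1 t = mu 1 1 + mu 1 0 * expR (- t).
Proof. by rewrite /wpoly !big_ord_recl big_ord0 /= subn0 subnn expr0 mulr1 addr0 expr1. Qed.

Lemma w_left t : t <= 0 -> t + w t <= ln M.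
Proof.
move=> t0; have := w_le t (leqnn 1); rewrite divr1 => h.
have : wpoly 1 t <= M * expR (- t).
  have e1 : 1 <= expR (- t) by rewrite -expR0 ler_expR oppr_ge0.
  have h1 := ler_norm (mu 1 1); have h2 := ler_norm (mu 1 0); have h3 := normr_ge0 (mu 1 1).
  rewrite wpoly1E /M; nra.
rewrite -ler_ln ?posrE ?wpoly_gt0 ?mulr_gt0 ?expR_gt0// lnM ?posrE ?expR_gt0// expRK.
lra.
Qed.

Lemma w_right t : 0 <= t -> w t <= ln M.
Proof.
move=> t0; apply: (le_trans (w_le t (leqnn 1))); rewrite divr1 ler_ln ?posrE ?wpoly_gt0//.
have e1 : expR (- t) <= 1 by rewrite -expR0 ler_expR oppr_le0.
have e0 := expR_gt0 (- t).
have h1 := ler_norm (mu 1 1); have h2 := ler_norm (mu 1 0); have h3 := normr_ge0 (mu 1 0).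
rewrite wpoly1E /M; nra.
Qed.

Let gap_le d : d ^+ 2 = rho / 2 -> d ^+ 2 <= rho.
Proof. by move=> ->; have := rho_gt0; lra. Qed.

Lemma vpoly_gt0 n r : (1 <= n)%N -> 0 <= r -> 0 < vpoly n r.
Proof.
move=> n1 r0; have [p [d [d0 dE _]]] := gap_exists.
by apply: lt_le_trans (vpoly_ge_cube n1 r0 (ltW d0) (gap_le dE)); rewrite exprn_gt0// mulr_gt0.
Qed.

Definition lnvol (nu : R) (n : nat) : R := ln (vpoly n (Num.sqrt (n%:R * nu))) / n%:R.

(** The sequence stays abstract because Steiner's formula is available from n = 1 only; the limsup
    does not see the first term. *)
Lemma ell_lnvol nu : 0 <= nu -> exists2 u : nat -> \bar R,
  ell sigma rho nu = limn_esup u & forall n, (1 <= n)%N -> u n = (lnvol nu n)%:E.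
Proof.
move=> nu0; eexists; first by rewrite /ell; reflexivity.
move=> n n1 /=; rewrite vpolyE// lne_EFin; last exact: vpoly_gt0.
by rewrite -EFinM mulrC.
Qed.

Lemma lnvol_ge nu d n : (1 <= n)%N -> 0 < d -> d ^+ 2 <= rho -> ln (2 * d) <= lnvol nu n.
Proof.
move=> n1 d0 dr; have dd0 : 0 < 2 * d by rewrite mulr_gt0.
rewrite ler_pdivlMr ?nR// mulr_natr -lnXn//.
by rewrite ler_ln ?posrE ?exprn_gt0 ?vpoly_gt0// vpoly_ge_cube// ltW.
Qed.

Lemma lnvol_le nu t n : (1 <= n)%N -> 0 <= nu ->
  lnvol nu n <= ln (wpoly n t) / n%:R + pi * nu * expR (2 * t).
Proof.
move=> n1 nu0; have n0 := nR n1.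
have nnu : 0 <= n%:R * nu by rewrite mulr_ge0// ltW.
have := wpoly_chernoff t n1 (sqrtr_ge0 (n%:R * nu)); rewrite sqr_sqrtr//.
rewrite -ler_ln ?posrE ?vpoly_gt0 ?mulr_gt0 ?expR_gt0 ?wpoly_gt0//.
rewrite lnM ?posrE ?expR_gt0 ?wpoly_gt0// expRK => h.
rewrite /lnvol ler_pdivrMr// mulrDl divfK ?gt_eqF//.
by apply: (le_trans h); rewrite addrC lerD2l le_eqVlt; apply/orP; left; apply/eqP; ring.
Qed.

Lemma ell_le_rate nu : 0 <= nu -> (ell sigma rho nu <= (rate w nu)%:E)%E.
Proof.
move=> nu0; have [u -> uE] := ell_lnvol nu0.
suff H t e : 0 < e -> (limn_esup u <= (cost w nu t + e)%:E)%E.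
  have [p [d [d0 dE _]]] := gap_exists.
  apply/lee_addgt0Pr => e e0.
  have [t ht] := rate_near (fun t => w_ge t d0 (gap_le dE)) nu0 (divr_gt0 e0 (ltr0Sn _ 1)).
  apply: (le_trans (H t (e / 2) (divr_gt0 e0 (ltr0Sn _ 1)))).
  by rewrite -EFinD lee_fin; lra.
move=> e0; apply: limn_esup_le.
have /cvgrPdist_lt/(_ e e0)[N _ hN] := @w_lim t.
exists (maxn N 1) => // n /=; rewrite geq_max => /andP[Nn n1].
rewrite uE// lee_fin; apply: (le_trans (lnvol_le t n1 nu0)).
have := hN n Nn; rewrite distrC => /(le_lt_trans (ler_norm _)); rewrite /cost; lra.
Qed.

(** At nu = 0 the semigroup has no point with d < 0, so the separation is replaced by a limit: e^(n
    D(0)) <= W_n(t) for every t, and W_n(t) tends to V_n(0). *)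
Lemma rate0_le_ell : ((rate w 0)%:E <= ell sigma rho 0)%E.
Proof.
have [u -> uE] := ell_lnvol (lexx 0); have [p [d [d0 dE _]]] := gap_exists.
apply: limn_esup_ge => n n1; rewrite uE// lee_fin /lnvol mulr0 sqrtr0.
have n0 := nR n1; rewrite ler_pdivlMr// -[leLHS]expRK ler_ln ?posrE ?expR_gt0 ?vpoly_gt0//.
apply: wpoly_lim => t; rewrite -[leRHS]lnK ?posrE ?wpoly_gt0// ler_expR -ler_pdivlMr//.
apply: le_trans (w_le t n1).
apply: (le_trans (rate_le (fun t => w_ge t d0 (gap_le dE)) t (lexx 0))).
by rewrite /cost mulr0 mul0r addr0.
Qed.

(** * Lower bound for ell by superadditivity and a separating line *)

Section supporting_line.
Variables (p : nat) (d : R).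
Hypotheses (d0 : 0 < d) (dE : d ^+ 2 = rho / 2) (ps : 2 * sigma <= p%:R * rho).

Let kap : R := (2 * d) ^+ p.
Let kap0 : 0 < kap. Proof. by rewrite exprn_gt0// mulr_gt0. Qed.

(* The factor kap pays for the p coordinates separating two sequences, which
   makes L superadditive for the shifted dimension n + p. *)
Let L (n : nat) (E : R) : R := ln (kap * vpoly n (Num.sqrt E)).

Let L_superadd m n E F : (1 <= m)%N -> (1 <= n)%N -> 0 <= E -> 0 <= F ->
  L m E + L n F <= L (m + p + n) (E + F).
Proof.
move=> m1 n1 E0 F0.
have mn1 : (1 <= m + p + n)%N by rewrite !addn_gt0 m1.
have vm := vpoly_gt0 m1 (sqrtr_ge0 E); have vn := vpoly_gt0 n1 (sqrtr_ge0 F).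
have vmn := vpoly_gt0 mn1 (sqrtr_ge0 (E + F)).
rewrite /L -lnM ?posrE ?mulr_gt0// ler_ln ?posrE ?mulr_gt0//.
have := vpoly_superadd m1 n1 (ltW d0) dE ps (sqrtr_ge0 E) (sqrtr_ge0 F).
rewrite !sqr_sqrtr// -/kap -(ler_pM2l kap0); apply: le_trans.
by rewrite le_eqVlt; apply/orP; left; apply/eqP; ring.
Qed.

(** Concatenating k + 1 copies of one block multiplies both n + p and E by k + 1. *)
Let L_multiple n E k : (1 <= n)%N -> 0 <= E -> exists m : nat,
  [/\ (1 <= m)%N, (m + p = k.+1 * (n + p))%N & k.+1%:R * L n E <= L m (k.+1%:R * E)].
Proof.
move=> n1 E0; elim: k => [|k [m [m1 mE h]]].
  by exists n; rewrite mul1n !mul1r.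
exists (m + p + n)%N; split; first by rewrite !addn_gt0 m1.
  by rewrite mE; lia.
rewrite -(natr1 k.+1) !mulrDl !mul1r.
apply: le_trans (L_superadd m1 n1 _ E0); last by rewrite mulr_ge0.
by rewrite lerD2r.
Qed.

(** After k + 1 concatenations the dimension is m = (k + 1) (n + p) - p. The strict inequality on E
    leaves room for the missing p coordinates, so (k + 1) E <= m nu for large k, and the limsup
    bound at dimension m applies; dividing by k + 1 gives a bound for the given n. *)
Lemma L_asymptotic nu v n E : 0 <= nu -> ell sigma rho nu = v%:E ->
  (1 <= n)%N -> 0 <= E -> E < (n + p)%:R * nu -> L n E <= (n + p)%:R * v.
Proof.
move=> nu0 ellv n1 E0 Enu.
have [u ellE uE] := ell_lnvol nu0.
have N0 : 0 < (n + p)%:R :> R by rewrite ltr0n addn_gt0 n1.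
apply/ler_addgt0Pr => e e0.
pose e' := e / (n + p)%:R.
have e'0 : 0 < e' by rewrite divr_gt0.
have : (limn_esup u < (v + e')%:E)%E by rewrite -ellE ellv lte_fin ltrDl.
case/limn_esup_lt => n0 _ hu.
(* From this number of copies on, (k + 1) ((n + p) nu - E) exceeds p nu. *)
pose q0 := Num.truncn (p%:R * nu / ((n + p)%:R * nu - E)).
have -> : (n + p)%:R * v + e = (n + p)%:R * (v + e').
  by rewrite mulrDr /e' mulrCA mulfV ?mulr1// gt_eqF.
apply: (@slope_le R _ _ (ln kap - p%:R * (v + e')) (q0 + n0 + p).+1) => -[//|k] hk.
have [m [m1 mE h]] := L_multiple k n1 E0.
have mR : m%:R + p%:R = k.+1%:R * (n + p)%:R :> R by rewrite -natrD mE natrM.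
have n0m : (n0 <= m)%N.
  rewrite -(leq_add2r p) mE (@leq_trans k.+1)//; last by rewrite leq_pmulr// addn_gt0 n1.
  by apply: leq_trans hk; rewrite -addnA leqW// leq_addl.
have le1 : k.+1%:R * E <= m%:R * nu.
  have : p%:R * nu <= k.+1%:R * ((n + p)%:R * nu - E).
    rewrite -ler_pdivrMr ?subr_gt0//; apply: (le_trans (ltW (truncnS_gt _))).
    by rewrite ler_nat (leq_trans _ hk)// ltnS -addnA leq_addr.
  have -> : m%:R = k.+1%:R * (n + p)%:R - p%:R :> R by rewrite -mR addrK.
  lra.
have := hu m n0m; rewrite uE// lee_fin /lnvol ler_pdivrMr ?nR// => h2.
rewrite mulrC; apply: (le_trans h).
rewrite /L lnM ?posrE ?vpoly_gt0 ?sqrtr_ge0//.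
have h3 : ln (vpoly m (Num.sqrt (k.+1%:R * E))) <= ln (vpoly m (Num.sqrt (m%:R * nu))).
  rewrite ler_ln ?posrE ?vpoly_gt0 ?sqrtr_ge0// vpoly_le ?sqrtr_ge0//.
  by rewrite ler_wsqrtr.
have -> : ln kap - p%:R * (v + e') + (n + p)%:R * (v + e') * k.+1%:R =
    ln kap + (v + e') * (k.+1%:R * (n + p)%:R - p%:R) by ring.
by rewrite -mR addrK lerD2l; exact: le_trans h2.
Qed.

Lemma rate_le_ell_fin nu v : 0 < nu -> ell sigma rho nu = v%:E -> rate w nu <= v.
Proof.
move=> nu0 ellv.
(* D is the excess of the energy over nu per shifted dimension, b at most the excess of the
   log-volume over v. The inequality for b lets superadditivity make Q a semigroup, and
   [L_asymptotic] keeps it out of the quadrant D < 0 < b. *)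
pose Q (D b : R) := exists n E, [/\ (1 <= n)%N, 0 <= E, D = E - (n + p)%:R * nu &
  b <= L n E - (n + p)%:R * v].
have [||| beta beta0 sep] := @semigroup_separation R Q.
- move=> D1 b1 D2 b2 [m [E [m1 E0 -> h1]]] [n [F [n1 F0 -> h2]]].
  exists (m + p + n)%N, (E + F); split.
  + by rewrite !addn_gt0 m1.
  + by rewrite addr_ge0.
  + by rewrite -addnA natrD; ring.
  + have := L_superadd m1 n1 E0 F0; rewrite -(addnA (m + p)) (natrD _ (m + p)); lra.
- move=> D b [n [E [n1 E0 -> h]]]; rewrite subr_lt0 => Enu.
  by have := L_asymptotic (ltW nu0) ellv n1 E0 Enu; lra.
- exists (0 - (1 + p)%:R * nu), (L 1 0 - (1 + p)%:R * v); split; first by exists 1%N, 0.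
  by rewrite sub0r oppr_lt0 mulr_gt0// ltr0n.
have pi0 := @pi_gt0 R.
(* The slope in the normalization exp(pi beta' r^2) of the Gaussian weight. *)
pose beta' := beta / pi.
have beta'0 : 0 <= beta' by rewrite divr_ge0// ltW.
have piE : pi * beta' = beta by rewrite /beta' mulrCA mulfV ?mulr1// gt_eqF.
have bound n r : (1 <= n)%N -> 0 <= r ->
    vpoly n r <= kap^-1 * expR ((n + p)%:R * (v - beta * nu)) * expR (pi * beta' * r ^+ 2).
  move=> n1 r0; have := sep _ _ (ex_intro _ n (ex_intro _ (r ^+ 2) (And4 n1 (sqr_ge0 r) erefl (lexx _)))).
  rewrite /L sqrtr_sqr ger0_norm// lnM ?posrE ?vpoly_gt0// => h.
  rewrite piE -mulrA -expRD mulrC ler_pdivlMr// mulrC -ler_ln ?posrE ?mulr_gt0 ?expR_gt0 ?vpoly_gt0//.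
  by rewrite lnM ?posrE ?vpoly_gt0// expRK; lra.
have wle t : beta' < expR (2 * t) -> w t <= v - beta * nu.
  move=> bt; have b0 := expR_gt0 (2 * t).
  have q0 : 0 < expR (2 * t) / (expR (2 * t) - beta') by rewrite divr_gt0// subr_gt0.
  apply: (@slope_le R _ _ (ln kap^-1 + p%:R * (v - beta * nu) +
     ln (expR (2 * t) / (expR (2 * t) - beta'))) 1) => n n1.
  have := w_le t n1; rewrite ler_pdivlMr ?nR// => /le_trans; apply.
  have C0 : 0 < kap^-1 * expR ((n + p)%:R * (v - beta * nu)).
    by rewrite mulr_gt0 ?invr_gt0 ?expR_gt0.
  have := wpoly_le n1 (ltW C0) beta'0 bt (fun r => bound n r n1).
  move: (expR (2 * t) / _) q0 => q q0.
  rewrite -ler_ln ?posrE ?wpoly_gt0//; last exact: mulr_gt0.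
  rewrite (lnM C0 q0) lnM ?posrE ?invr_gt0 ?expR_gt0// expRK natrD.
  lra.
apply/ler_addgt0Pr => e e0.
(* With e^(2t) = beta' + s the term pi nu e^(2t) equals beta nu + e. A positive s provides
   convergence of the integral, and the logarithm also when beta' = 0. *)
pose s := e / (pi * nu).
have s0 : 0 < s by rewrite divr_gt0// mulr_gt0.
pose t := ln (beta' + s) / 2.
have tE : expR (2 * t) = beta' + s.
  by rewrite /t mulrC divfK ?pnatr_eq0// lnK// posrE ltr_wpDl.
have wt : w t <= v - beta * nu by apply: wle; rewrite tE ltrDl.
apply: (le_trans (rate_le (fun t => w_ge t d0 (gap_le dE)) t (ltW nu0))).
rewrite /cost tE mulrDr [pi * nu * s]mulrC divfK ?gt_eqF ?mulr_gt0//.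
by rewrite mulrAC piE; lra.
Qed.

End supporting_line.

Lemma ellE nu : 0 <= nu -> ell sigma rho nu = (rate w nu)%:E.
Proof.
move=> nu0; apply/eqP; rewrite eq_le ell_le_rate//=.
have [->|] := eqVneq nu 0; first exact: rate0_le_ell.
move=> nu_neq0; have {nu_neq0}nu0 : 0 < nu by rewrite lt_def nu_neq0.
have [p [d [d0 dE ps]]] := gap_exists.
have [u uE hu] := ell_lnvol (ltW nu0).
(* The cube inside S_n bounds ell from below; with the upper bound D(nu) this makes ell finite. *)
have lb : ((ln (2 * d))%:E <= ell sigma rho nu)%E.
  by rewrite uE; apply: limn_esup_ge => n n1; rewrite hu// lee_fin lnvol_ge// gap_le.
have := ell_le_rate (ltW nu0); move: lb; case E : (ell sigma rho nu) => [v||]//= _ _.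
by rewrite lee_fin; apply: (@rate_le_ell_fin p d d0 dE ps nu v).
Qed.

End steiner.

Theorem theorem8p1 (R : realType) (sigma rho : R)
  (sigma_gt0 : 0 < sigma) (rho_gt0 : 0 < rho)
  (mu : nat -> nat -> R)
  (mu_intrinsic : forall n : nat, (1 <= n)%N ->
     intrinsic_volumes (Sset sigma rho n) (mu n)) :
  exists Lambda : R -> R,
    (forall t : R, (fun n : nat => gfun mu n t) @ \oo --> Lambda t) /\
    ((forall nu : R, 0 <= nu -> ell sigma rho nu \is a fin_num) /\
     {within `[0, +oo[, continuous (fun nu : R => fine (ell sigma rho nu))}) /\
    (forall nu : R, 0 < nu ->
       ell sigma rho nu =
       ereal_sup [set (- conjugate Lambda (1 - theta) +
                       (ball_term nu theta)%:E)%E | theta in `[0%R, 1%R]]).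
Proof.
have [w [w_le w_lim]] := growth_exists sigma_gt0 rho_gt0 mu_intrinsic.
have [p [d [d0 dE _]]] := gap_exists sigma rho_gt0.
have dr : d ^+ 2 <= rho by rewrite dE; lra.
have mid := w_mid sigma_gt0 rho_gt0 mu_intrinsic w_le w_lim.
have geN := w_geN sigma_gt0 rho_gt0 mu_intrinsic w_lim.
have ge t : ln (2 * d) <= w t := w_ge sigma_gt0 rho_gt0 mu_intrinsic w_lim t d0 dr.
have left := w_left sigma_gt0 rho_gt0 mu_intrinsic w_le.
have right := w_right sigma_gt0 rho_gt0 mu_intrinsic w_le.
have rateE nu := @ellE R sigma rho sigma_gt0 rho_gt0 mu mu_intrinsic w w_le w_lim nu.
exists (fun t => t + w t); split; [|split; [split|]].
- move=> t; apply/cvgrPdist_lt => e e0.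
  have /cvgrPdist_lt/(_ e e0)[N _ hN] := @w_lim t.
  exists (maxn N 1) => // n /=; rewrite geq_max => /andP[Nn n1].
  rewrite (gfunE sigma_gt0 rho_gt0 mu_intrinsic)//.
  by rewrite opprD addrACA subrr add0r; exact: hN.
- by move=> nu nu0; rewrite rateE.
- have := rate_continuous ge.
  apply: subspace_eq_continuous => nu; rewrite inE/= in_itv/= andbT => nu0.
  by rewrite /from_subspace/= rateE.
- move=> nu nu0; rewrite rateE ?ltW//.
  exact: (rate_duality mid geN ge left right nu0).
Qed.
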